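(* Let $\alpha>0$ and let $\bm{T}\colon\mathbb{R}^q\to\mathrm{Sym}_p(\mathbb{R})$ be measurable with $\mathbb{P}(\bm{T}(\bm{y})\neq\bm{0}_{p\times p})>0$ and $\|\bm{T}(\bm{y})\|_{\mathrm{op}}\le C_T$ almost surely for some finite $C_T>0$. Then the limiting upper spectral edge $\lambda_+(\alpha)=\sup\operatorname{supp}(\mu_\alpha)$ satisfies $$\lambda_+(\alpha)=\inf_{\bm{Z}\in\mathcal{D}_\alpha}\lambda_1\left(\mathcal{G}_\alpha(\bm{Z})\right),$$ where $$\mathcal{D}_\alpha=\left\{\bm{Z}\in\mathrm{Sym}_p^{++}(\mathbb{R})\colon\operatorname*{ess\,inf}_{\bm{y}}\lambda_{\min}\left(\bm{Z}^{-1}-\alpha^{-1}\bm{T}(\bm{y})\right)>0\right\}$$ and $$\mathcal{G}_\alpha(\bm{Z})=\bm{Z}^{-1}+\mathbb{E}_{\bm{y}}\left[\bm{T}(\bm{y})\left(\bm{I}_p-\alpha^{-1}\bm{Z}\bm{T}(\bm{y})\right)^{-1}\right].$$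
   Context: $\bm{y}$ is a random vector in $\mathbb{R}^q$ whose law is determined by $\bm{s}\sim\mathcal{N}(\bm{0}_r,\bm{I}_r)$, $\bm{y}\mid\bm{s}\sim P_\ast(\cdot\mid\bm{s})$ for a fixed Markov kernel $P_\ast$ from $\mathbb{R}^r$ to $\mathbb{R}^q$; $\mathbb{E}_{\bm{y}}$ and $\operatorname{ess\,inf}_{\bm{y}}$ are with respect to this law. $\mathrm{Sym}_p(\mathbb{R})$, $\mathrm{Sym}_p^{++}(\mathbb{R})$ are the real symmetric, respectively real positive definite, $p\times p$ matrices; $\lambda_1$ and $\lambda_{\min}$ are the largest and smallest eigenvalues. Write $\Im\bm{X}=(\bm{X}-\bm{X}^\ast)/(2i)$, $\mathbb{C}_+=\{z\colon\Im z>0\}$. $\bm{M}_\alpha\colon\mathbb{C}_+\to\mathbb{C}^{p\times p}$ is the unique analytic function with $\Im\bm{M}_\alpha(z)\succeq0$ on $\mathbb{C}_+$, $\lim_{\eta\to\infty}i\eta\bm{M}_\alpha(i\eta)=-\bm{I}_p$, and $$\bm{M}_\alpha(z)^{-1}=-z\bm{I}_p+\mathbb{E}_{\bm{y}}\left[\bm{T}(\bm{y})\left(\bm{I}_p+\tfrac1\alpha\bm{M}_\alpha(z)\bm{T}(\bm{y})\right)^{-1}\right],\quad z\in\mathbb{C}_+.$$ $\mu_\alpha$ is the (compactly supported) probability measure on $\mathbb{R}$ whose Stieltjes transform is $\int(\lambda-z)^{-1}\mu_\alpha(\mathrm{d}\lambda)=\frac1p\operatorname{Tr}\bm{M}_\alpha(z)$,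 $z\in\mathbb{C}_+$. It is the almost sure weak limit of the empirical spectral measure of $\frac1n\sum_{i=1}^n\bm{T}(\bm{y}_i)\otimes\bm{u}_i\bm{u}_i^\top$, with $\bm{y}_i$ i.i.d. copies of $\bm{y}$ and independent $\bm{u}_i\sim\mathcal{N}(\bm{0}_{d-r},\bm{I}_{d-r})$, as $n,d\to\infty$, $n/d\to\alpha$. *)

(* Defs.v *)
From HB Require Import structures.
From mathcomp Require Import all_boot all_order all_algebra.
From mathcomp Require Import all_classical all_reals all_analysis.
From mathcomp Require Import ess_sup_inf complex.

Set Implicit Arguments.
Unset Strict Implicit.
Unset Printing Implicit Defensive.

Import Order.TTheory GRing.Theory Num.Theory.
Import numFieldNormedType.Exports.

Local Open Scope classical_set_scope.
Local Open Scope ring_scope.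

(* R^n with its Borel sigma-algebra, generated by the coordinate maps *)
Notation Rvec R n := (n.-tuple (measurableTypeR R)).

Section random_vectors.
Context {R : realType}.

Definition cons_tuple n (x : measurableTypeR R * Rvec R n) : Rvec R n.+1 :=
  [the n.+1.-tuple (measurableTypeR R) of x.1 :: x.2].

Lemma measurable_cons_tuple n : measurable_fun [set: _] (@cons_tuple n).
Proof. by apply: measurable_cons. Qed.

HB.instance Definition _ n :=
  isMeasurableFun.Build _ _ _ _ (@cons_tuple n) (@measurable_cons_tuple n).

(* N(0, I_n): product of n standard normal laws *)
Fixpoint std_gaussian n : probability (Rvec R n) R :=
  match n with
  | 0 => \d_([tuple] : Rvec R 0)
  | m.+1 => distribution
      ((normal_prob (0 : R) 1 : probability (measurableTypeR R) R)
         \x std_gaussian m)%E (@cons_tuple m)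
  end.

Context {d1 d2} {S : measurableType d1} {Y : measurableType d2}.
Variables (gamma : probability S R) (P : R.-pker S ~> Y).

Definition mixture (A : set Y) : \bar R := (\int[gamma]_s P s A)%E.

Let mixture0 : mixture set0 = 0%E.
Proof. by apply: integral0_eq => s _; rewrite measure0. Qed.

Let mixture_ge0 A : (0 <= mixture A)%E.
Proof. by apply: integral_ge0 => s _; exact: measure_ge0. Qed.

Let mixture_sigma_additive : semi_sigma_additive mixture.
Proof.
move=> U mU tU mUU; rewrite [X in _ --> X](_ : _ =
  (\int[gamma]_s (\sum_(n <oo) P s (U n)))%E); last first.
  apply: eq_integral => s _.
  by apply/esym/cvg_lim => //; exact: measure_semi_sigma_additive.
rewrite integral_nneseries//; last first.
  by move=> n; exact: measurable_kernel.
apply: is_cvg_nneseries => n _ _; exact: integral_ge0.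
Qed.

HB.instance Definition _ := isMeasure.Build _ _ _ mixture
  mixture0 mixture_ge0 mixture_sigma_additive.

Let mixture_setT : mixture [set: Y] = 1%E.
Proof.
rewrite /mixture; under eq_integral do rewrite prob_kernel.
by rewrite integral_cst// mul1e; exact: probability_setT.
Qed.

HB.instance Definition _ :=
  Measure_isProbability.Build _ _ _ mixture mixture_setT.

End random_vectors.

(* the law of y when s ~ N(0, I_r) and y | s ~ Pstar(. | s) *)
Definition law_y {R : realType} {r q : nat}
    (Pstar : R.-pker (Rvec R r) ~> (Rvec R q)) : probability (Rvec R q) R :=
  mixture (std_gaussian r) Pstar.

Section matrices.
Context {R : realType} {p : nat}.
Implicit Types (A Z : 'M[R]_p) (X : 'M[R[i]]_p).

Definition lambda_max A : R := sup [set a | eigenvalue A a].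

Definition lambda_min A : R := inf [set a | eigenvalue A a].

Definition eucl_norm (v : 'cV[R]_p) : R := Num.sqrt (\sum_i v i 0 ^+ 2).

Definition op_norm A : R :=
  sup [set eucl_norm (A *m v) | v in [set v | eucl_norm v <= 1]].

Definition posdef Z : Prop :=
  Z \is symmetricmx /\ forall v : 'rV_p, v != 0 -> 0 < (v *m Z *m v^T) 0 0.

Definition adjoint X : 'M[R[i]]_p := map_mx Num.conj X^T.

Definition Im_mx X : 'M[R[i]]_p := (2%:R * (0 +i* 1)%C)^-1 *: (X - adjoint X).

(* The order of R[i] makes [0 <= z] say that z is real and nonnegative. *)
Definition psd X : Prop :=
  adjoint X = X /\
  forall v : 'rV_p, 0 <= (v *m X *m map_mx Num.conj v^T) 0 0.

Definition complex_mx A : 'M[R[i]]_p := map_mx (real_complex R) A.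

End matrices.

Section expectation.
Context {R : realType} {d} {Y : measurableType d}.
Variable mu : probability Y R.

Definition Cexpectation (f : Y -> R[i]) : R[i] :=
  ((\int[mu]_y complex.Re (f y)) +i* (\int[mu]_y complex.Im (f y)))%C.

Definition E_mx p (F : Y -> 'M[R]_p) : 'M[R]_p :=
  \matrix_(i, j) \int[mu]_y F y i j.

Definition E_Cmx p (F : Y -> 'M[R[i]]_p) : 'M[R[i]]_p :=
  \matrix_(i, j) Cexpectation (fun y => F y i j).

End expectation.

Definition upper_half_plane (R : realType) : set R[i] :=
  [set z | 0 < complex.Im z].

(* [derivable] over the field R[i] is complex differentiability, so on the open
   set [D] this is analyticity. *)
Definition analytic_on (R : realType) (D : set R[i]) (f : R[i] -> R[i]) : Prop :=
  forall z, D z -> derivable (f : R[i]^o -> R[i]^o) z 1.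

Section edge.
Context {R : realType} {d} {Y : measurableType d} {p : nat}.
Variables (alpha : R) (law : probability Y R) (T : Y -> 'M[R]_p).

(* The right-hand side of the fixed-point equation makes sense for every T(y)
   because the other clauses force Im M(z) to be positive definite; only the
   invertibility of M(z) has to be required ([invmx] is total). *)
Definition is_M_alpha (M : R[i] -> 'M[R[i]]_p) : Prop :=
  [/\ forall i j, analytic_on (@upper_half_plane R) (fun z => M z i j),
      forall z, upper_half_plane z -> psd (Im_mx (M z)),
      forall i j, ((0 +i* eta)%C * M (0 +i* eta)%C i j : R[i]^o)
        @[eta --> +oo] --> ((- 1%:M : 'M[R[i]]_p) i j : R[i]^o) &
      forall z, upper_half_plane z ->
        M z \in unitmx /\
        invmx (M z) = - z%:M + E_Cmx law (fun y => complex_mx (T y) *m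
          invmx (1%:M + (alpha^-1)%:C%C *: (M z *m complex_mx (T y))))].

Definition mx_domain : set 'M[R]_p :=
  [set Z | posdef Z /\
    (0 < ess_inf law
       (fun y => (lambda_min (invmx Z - alpha^-1 *: T y))%:E))%E].

Definition mx_G (Z : 'M[R]_p) : 'M[R]_p :=
  invmx Z + E_mx law (fun y => T y *m
    invmx (1%:M - alpha^-1 *: (Z *m T y))).

End edge.

Section measure_on_R.
Context {R : realType}.
Variable mu : probability (measurableTypeR R) R.

Definition measure_support : set R :=
  [set x | forall U : set R, open U -> U x -> (0 < mu U)%E].

Definition stieltjes (z : R[i]) : R[i] :=
  Cexpectation mu (fun l => (l%:C%C - z)^-1).

Definition is_mu_alpha p (M : R[i] -> 'M[R[i]]_p) : Prop :=
  compact measure_support /\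
  forall z, upper_half_plane z -> stieltjes z = (p%:R)^-1 * \tr (M z).

Definition upper_edge : \bar R := ereal_sup [set x%:E | x in measure_support].

End measure_on_R.

(* Main.v *)
(* Put W(z) = - M(z)^-1, S = T / alpha, R = (W - S)^-1 and Phi(W) = W + alpha E[S + S R S].
   The equation for M says Phi(W(z)) = z, and G(Z) = Phi(Z^-1) on the dual domain.  The
   normalized imaginary part n = Im W / Im z satisfies n = 1 + alpha E[S R^* n R S] >= 1,
   so that X |-> alpha E[S R^* X R S] is strictly contracting for the gauge given by n.

   Upper bound.  If W0 is in the domain and Phi(W0) <= x - delta, operator convexity of the
   inverse gives D >= delta + alpha E[S R^* D R S] for D = Re W(x + i eta) - W0, hence
   D >= delta n by the contraction.  Thus Tr Im M(x + i eta) = O(eta), and mu has no mass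
   to the right of lambda_1(Phi(W0)).

   Lower bound.  To the right of the support Tr Im M(x + i eta) = O(eta), which bounds
   W^-1, E |R|^2, W and n uniformly, and then makes W Lipschitz.  For large x the real part
   of W - S is positive; when x decreases, losing positivity for some value of y forces |R|
   to be of order 1 / h at some point of a grid of mesh h, which has small probability
   because E |R|^2 is bounded.  Hence Re W(x + i eta) + O(eta) lies in the domain, and there
   Phi = x + O(eta). *)
Require Import Defs.
From HB Require Import structures.
From mathcomp Require Import all_boot all_order all_algebra.
From mathcomp Require Import all_classical all_reals all_analysis.
From mathcomp Require Import ess_sup_inf complex.
From mathcomp Require Import measurable_realfun ring lra.

Set Implicit Arguments.
Unset Strict Implicit.
Unset Printing Implicit Defensive.

Import Order.TTheory GRing.Theory Num.Theory.
Import numFieldNormedType.Exports.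

Local Open Scope classical_set_scope.
Local Open Scope ring_scope.

(** No boundary value of W on the real axis is ever formed. All estimates hold at x + i eta with
    constants independent of eta, and eta is fixed only at the end, so neither analytic continuation
    nor compactness enters; the price is an error O(eta) in the dual witness, which the infimum
    absorbs. The obstacle in the lower bound is that E |R|^2 is bounded but |R| is not bounded for
    each y, so positivity of W - S(y) cannot be followed continuously in x. On a grid of n + 2
    points its loss forces |R|^2 >= const n^2 at one of them; the probabilities sum to O(n / n^2),
    and the square is what wins against the number of points. Contractions are used by improving the
    constant m of an inequality ([contraction_limit]) instead of summing a series. Matrix
    inequalities are inequalities between the numbers Re u^* X u for all u, so the Hermitian part of
    W stays implicit until the witness is built, where the symmetry of W makes it a real matrix. *)

Section ComplexScalars.
Context {R : realType}.
Implicit Types (a b : R[i]) (c : R).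

Lemma ReD a b : complex.Re (a + b) = complex.Re a + complex.Re b.
Proof. by case: a b => [? ?] []. Qed.

Lemma ImD a b : complex.Im (a + b) = complex.Im a + complex.Im b.
Proof. by case: a b => [? ?] []. Qed.

Lemma ReN a : complex.Re (- a) = - complex.Re a.
Proof. by case: a. Qed.

Lemma ImN a : complex.Im (- a) = - complex.Im a.
Proof. by case: a. Qed.

Lemma ReM a b : complex.Re (a * b) =
  complex.Re a * complex.Re b - complex.Im a * complex.Im b.
Proof. by case: a b => [? ?] []. Qed.

Lemma ImM a b : complex.Im (a * b) =
  complex.Re a * complex.Im b + complex.Im a * complex.Re b.
Proof. by case: a b => [? ?] []. Qed.

Lemma conjcE a : Num.conj a = (complex.Re a +i* (- complex.Im a))%C.
Proof. by case: a. Qed.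

Lemma Re_conj a : complex.Re (Num.conj a) = complex.Re a.
Proof. by rewrite conjcE. Qed.

Lemma Im_conj a : complex.Im (Num.conj a) = - complex.Im a.
Proof. by rewrite conjcE. Qed.

Lemma Re_sum (I : Type) (s : seq I) (P : pred I) (F : I -> R[i]) :
  complex.Re (\sum_(i <- s | P i) F i) = \sum_(i <- s | P i) complex.Re (F i).
Proof. by elim/big_rec2: _ => [|i x y _ <-] //; rewrite ReD. Qed.

Lemma Im_sum (I : Type) (s : seq I) (P : pred I) (F : I -> R[i]) :
  complex.Im (\sum_(i <- s | P i) F i) = \sum_(i <- s | P i) complex.Im (F i).
Proof. by elim/big_rec2: _ => [|i x y _ <-] //; rewrite ImD. Qed.

Lemma complex_ext a b :
  complex.Re a = complex.Re b -> complex.Im a = complex.Im b -> a = b.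
Proof. by case: a b => [? ?] [? ?] /= -> ->. Qed.

Lemma conj_real c : Num.conj (c%:C)%C = (c%:C)%C.
Proof. by rewrite conjcE /= oppr0. Qed.

(** The squared modulus as an element of R; the norm of R[i] takes its values in R[i] itself. *)
Definition sqc a : R := complex.Re a ^+ 2 + complex.Im a ^+ 2.

Lemma sqc_ge0 a : 0 <= sqc a.
Proof. by rewrite addr_ge0 ?sqr_ge0. Qed.

Lemma sqc_eq0 a : sqc a = 0 -> a = 0.
Proof.
by move=> /eqP; rewrite paddr_eq0 ?sqr_ge0// !sqrf_eq0 => /andP[/eqP r0 /eqP i0];
  apply: complex_ext.
Qed.

Lemma sqc0 : sqc 0 = 0. Proof. by rewrite /sqc /= expr0n addr0. Qed.

Lemma sqcM a b : sqc (a * b) = sqc a * sqc b.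
Proof. by rewrite /sqc ReM ImM; ring. Qed.

Lemma sqcN a : sqc (- a) = sqc a.
Proof. by rewrite /sqc ReN ImN; ring. Qed.

Lemma sqc_conj a : sqc (Num.conj a) = sqc a.
Proof. by rewrite /sqc Re_conj Im_conj; ring. Qed.

Lemma sqc_real c : sqc (c%:C)%C = c ^+ 2.
Proof. by rewrite /sqc /= expr0n addr0. Qed.

Lemma mul_conj_sqc a : Num.conj a * a = ((sqc a)%:C)%C.
Proof. by apply: complex_ext; rewrite ?ReM ?ImM Re_conj Im_conj /sqc /=; ring. Qed.

End ComplexScalars.

(** * Complex matrices: sesquilinear forms, Frobenius norm, operator bounds *)

Section ComplexMatrices.
Context {R : realType}.

(* The square of the Frobenius norm. *)
Definition fro m n (X : 'M[R[i]]_(m, n)) : R := \sum_i \sum_j sqc (X i j).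

(** The [adjoint] of the statement, extended to rectangular matrices so that it also applies to
    vectors. *)
Definition ct m n (X : 'M[R[i]]_(m, n)) : 'M[R[i]]_(n, m) :=
  map_mx Num.conj X^T.

(** On the diagonal this is the quadratic form of the Hermitian part of X, so non-Hermitian matrices
    can be compared without extracting that part. *)
Definition rform m n (X : 'M[R[i]]_(m, n)) (a : 'cV[R[i]]_m) (b : 'cV[R[i]]_n) : R :=
  complex.Re ((ct a *m X *m b) 0 0).

Lemma fro_ge0 m n (X : 'M[R[i]]_(m, n)) : 0 <= fro X.
Proof. by apply: sumr_ge0 => i _; apply: sumr_ge0 => j _; exact: sqc_ge0. Qed.

Lemma fro_eq0 m n (X : 'M[R[i]]_(m, n)) : fro X = 0 -> X = 0.
Proof.
move=> /eqP; rewrite psumr_eq0 => [/allP X0|i _]; last first.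
  by apply: sumr_ge0 => j _; exact: sqc_ge0.
apply/matrixP => i j; have := X0 i (mem_index_enum i).
rewrite psumr_eq0 => [/allP/(_ j (mem_index_enum j)) /eqP/sqc_eq0 ->|k _].
  by rewrite mxE.
exact: sqc_ge0.
Qed.

Lemma fro0 m n : fro (0 : 'M[R[i]]_(m, n)) = 0.
Proof. by rewrite /fro big1// => i _; rewrite big1// => j _; rewrite mxE sqc0. Qed.

Lemma ctE m n (X : 'M[R[i]]_(m, n)) i j : ct X i j = Num.conj (X j i).
Proof. by rewrite !mxE. Qed.

Lemma ctK m n (X : 'M[R[i]]_(m, n)) : ct (ct X) = X.
Proof. by apply/matrixP => i j; rewrite !ctE conjCK. Qed.

Lemma ctM m n k (X : 'M[R[i]]_(m, n)) (Y : 'M[R[i]]_(n, k)) :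
  ct (X *m Y) = ct Y *m ct X.
Proof. by rewrite /ct trmx_mul map_mxM. Qed.

Lemma ctD m n (X Y : 'M[R[i]]_(m, n)) : ct (X + Y) = ct X + ct Y.
Proof. by rewrite /ct linearD /= map_mxD. Qed.

Lemma ctN m n (X : 'M[R[i]]_(m, n)) : ct (- X) = - ct X.
Proof. by rewrite /ct linearN /= map_mxN. Qed.

Lemma ctB m n (X Y : 'M[R[i]]_(m, n)) : ct (X - Y) = ct X - ct Y.
Proof. by rewrite ctD ctN. Qed.

Lemma ctZ m n c (X : 'M[R[i]]_(m, n)) : ct (c *: X) = Num.conj c *: ct X.
Proof. by rewrite /ct linearZ /= map_mxZ. Qed.

Lemma ct1 n : ct (1%:M : 'M[R[i]]_n) = 1%:M.
Proof. by rewrite /ct trmx1 map_mx1. Qed.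

Lemma fro_ct m n (X : 'M[R[i]]_(m, n)) : fro (ct X) = fro X.
Proof.
rewrite /fro exchange_big; apply: eq_bigr => i _; apply: eq_bigr => j _.
by rewrite ctE sqc_conj.
Qed.

Lemma froN m n (X : 'M[R[i]]_(m, n)) : fro (- X) = fro X.
Proof. by apply: eq_bigr => i _; apply: eq_bigr => j _; rewrite mxE sqcN. Qed.

Lemma froZ m n c (X : 'M[R[i]]_(m, n)) : fro (c *: X) = sqc c * fro X.
Proof.
rewrite /fro mulr_sumr; apply: eq_bigr => i _; rewrite mulr_sumr.
by apply: eq_bigr => j _; rewrite mxE sqcM.
Qed.

Lemma fro_conj m n (X : 'M[R[i]]_(m, n)) : fro (map_mx Num.conj X) = fro X.
Proof. by apply: eq_bigr => i _; apply: eq_bigr => j _; rewrite mxE sqc_conj. Qed.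

Section Forms.
Context {m n : nat}.
Implicit Types (X Y : 'M[R[i]]_(m, n)) (a : 'cV[R[i]]_m) (b : 'cV[R[i]]_n).

Lemma rformDm X Y a b : rform (X + Y) a b = rform X a b + rform Y a b.
Proof. by rewrite /rform mulmxDr mulmxDl mxE ReD. Qed.

Lemma rformNm X a b : rform (- X) a b = - rform X a b.
Proof. by rewrite /rform mulmxN mulNmx mxE ReN. Qed.

Lemma rformBm X Y a b : rform (X - Y) a b = rform X a b - rform Y a b.
Proof. by rewrite rformDm rformNm. Qed.

Lemma rformZm (c : R) X a b : rform ((c%:C)%C *: X) a b = c * rform X a b.
Proof. by rewrite /rform -scalemxAr -scalemxAl mxE ReM /= mul0r subr0. Qed.

Lemma rform0m a b : rform 0 a b = 0.
Proof. by rewrite /rform mulmx0 mul0mx mxE. Qed.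

Lemma rformDl X a a' b : rform X (a + a') b = rform X a b + rform X a' b.
Proof. by rewrite /rform ctD !mulmxDl mxE ReD. Qed.

Lemma rformNl X a b : rform X (- a) b = - rform X a b.
Proof. by rewrite /rform ctN !mulNmx mxE ReN. Qed.

Lemma rformDr X a b b' : rform X a (b + b') = rform X a b + rform X a b'.
Proof. by rewrite /rform !mulmxDr mxE ReD. Qed.

Lemma rformNr X a b : rform X a (- b) = - rform X a b.
Proof. by rewrite /rform !mulmxN mxE ReN. Qed.

Lemma rformZl (c : R) X a b : rform X ((c%:C)%C *: a) b = c * rform X a b.
Proof. by rewrite /rform ctZ conj_real -!scalemxAl mxE ReM /= mul0r subr0. Qed.

Lemma rformZr (c : R) X a b : rform X a ((c%:C)%C *: b) = c * rform X a b.
Proof. by rewrite /rform -!scalemxAr mxE ReM /= mul0r subr0. Qed.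

Lemma rform_ct X a b : rform (ct X) b a = rform X a b.
Proof.
rewrite /rform -[RHS]Re_conj -ctE; congr (complex.Re (_ 0 0)).
by rewrite !ctM ctK mulmxA.
Qed.

End Forms.

Lemma rform_mul m n k l (L : 'M[R[i]]_(k, m)) (X : 'M[R[i]]_(k, l)) (K : 'M[R[i]]_(l, n)) a b :
  rform (ct L *m X *m K) a b = rform X (L *m a) (K *m b).
Proof. by rewrite /rform ctM !mulmxA. Qed.

Lemma rform_mulr m n k (X : 'M[R[i]]_(m, k)) (K : 'M[R[i]]_(k, n)) a b :
  rform (X *m K) a b = rform X a (K *m b).
Proof. by rewrite /rform !mulmxA. Qed.

Lemma rform_mull m n k (L : 'M[R[i]]_(k, m)) (X : 'M[R[i]]_(k, n)) a b :
  rform (ct L *m X) a b = rform X (L *m a) b.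
Proof. by rewrite /rform ctM !mulmxA. Qed.

Lemma rform1 n (a : 'cV[R[i]]_n) : rform 1%:M a a = fro a.
Proof.
rewrite /rform mulmx1 mxE Re_sum; apply: eq_bigr => i _.
by rewrite big_ord1 ctE mul_conj_sqc.
Qed.

Lemma rform1C n (a b : 'cV[R[i]]_n) : rform 1%:M a b = rform 1%:M b a.
Proof. by rewrite -rform_ct ct1. Qed.

Lemma rform1_mulr n k (X : 'M[R[i]]_(n, k)) a b : rform 1%:M a (X *m b) = rform X a b.
Proof. by rewrite -rform_mulr mul1mx. Qed.

(** Expand |s a - b|^2 >= 0 and divide by s. With its free weight this stands in for Cauchy-Schwarz
    and needs no square root. *)
Lemma rform1_le n (s : R) (a b : 'cV[R[i]]_n) : 0 < s ->
  2 * rform 1%:M a b <= s * fro a + s^-1 * fro b.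
Proof.
move=> s0; have := fro_ge0 ((s%:C)%C *: a - b).
rewrite -rform1 rformDl !rformDr !rformNl !rformNr !rformZl !rformZr (rform1C b a).
rewrite !rform1 => h.
rewrite -subr_ge0 -(pmulr_rge0 _ s0).
suff -> : s * (s * fro a + s^-1 * fro b - 2 * rform 1%:M a b) =
  s * (s * fro a) + - (s * rform 1%:M a b) + (- (s * rform 1%:M a b) - - fro b) by [].
by field; rewrite gt_eqF.
Qed.

Lemma sqc_mulmx11_le n (x : 'rV[R[i]]_n) (v : 'cV[R[i]]_n) :
  sqc ((x *m v) 0 0) <= fro x * fro v.
Proof.
have [/eqP/fro_eq0 ->|x0] := boolP (fro x == 0).
  by rewrite mul0mx mxE sqc0 fro0 mul0r.
have {}x0 : 0 < fro x by rewrite lt_def x0 fro_ge0.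
set c := (x *m v) 0 0.
(* The test vector c x^* turns the form into |c|^2, and the weight 1 / |x|^2 makes the first term on
   the right equal to |c|^2 as well. *)
have := rform1_le (c *: ct x) v (s := (fro x)^-1).
rewrite invr_gt0 => /(_ x0); rewrite froZ fro_ct.
have -> : rform 1%:M (c *: ct x) v = sqc c.
  rewrite /rform ctZ ctK mulmx1 -scalemxAl mxE -/c mul_conj_sqc //.
rewrite invrK => h.
suff : 2 * sqc c <= sqc c + fro x * fro v by lra.
apply: le_trans h _; rewrite mulrCA mulVf ?gt_eqF// mulr1 lexx //.
Qed.

Lemma fro_mulmx_le m n k (X : 'M[R[i]]_(m, n)) (Y : 'M[R[i]]_(n, k)) :
  fro (X *m Y) <= fro X * fro Y.
Proof.
rewrite /fro mulr_suml; apply: ler_sum => i _.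
rewrite [X in _ * X]exchange_big mulr_sumr; apply: ler_sum => j _.
have -> : (X *m Y) i j = (row i X *m col j Y) 0 0.
  by rewrite !mxE; apply: eq_bigr => l _; rewrite !mxE.
apply: le_trans (sqc_mulmx11_le _ _) _.
rewrite /fro big_ord1 le_eqVlt; apply/orP; left; apply/eqP; congr (_ * _).
  by apply: eq_bigr => l _; rewrite mxE.
by apply: eq_bigr => l _; rewrite big_ord1 mxE.
Qed.

(* The operator norm of [X] is at most [k]; this form needs no square roots. *)
Definition op_le m n (X : 'M[R[i]]_(m, n)) (k : R) : Prop :=
  forall a b, 2 * rform X a b <= k * (fro a + fro b).

Lemma op_le_fro m n (X : 'M[R[i]]_(m, n)) (k : R) : 0 <= k -> fro X <= k ^+ 2 -> op_le X k.
Proof.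
move=> k0 Xk a b; have [k1|] := ltP 0 k; last first.
  move=> k1; have k2 : k = 0 by apply/le_anti; rewrite k0 k1.
  move: Xk; rewrite k2 expr0n /= => X0.
  have -> : X = 0 by apply: fro_eq0; apply: le_anti; rewrite X0 fro_ge0.
  by rewrite rform0m mulr0 mul0r.
rewrite -rform1_mulr; apply: le_trans (rform1_le _ _ k1) _.
rewrite mulrDr lerD2l ler_pdivrMl// mulrA -expr2.
apply: le_trans (fro_mulmx_le _ _) _; by rewrite ler_wpM2r ?fro_ge0.
Qed.

Lemma op_leD m n (X Y : 'M[R[i]]_(m, n)) (k l : R) : op_le X k -> op_le Y l -> op_le (X + Y) (k + l).
Proof.
by move=> hX hY a b; rewrite rformDm mulrDr (mulrDl k l) lerD.
Qed.

Lemma op_leN m n (X : 'M[R[i]]_(m, n)) (k : R) : op_le X k -> op_le (- X) k.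
Proof.
by move=> h a b; rewrite rformNm -rformNr -[fro b]froN.
Qed.

Lemma op_le_ct m n (X : 'M[R[i]]_(m, n)) (k : R) : op_le X k -> op_le (ct X) k.
Proof. by move=> h a b; rewrite rform_ct addrC. Qed.

Lemma op_le_mulmx m n (X : 'M[R[i]]_(m, n)) (k : R) (b : 'cV[R[i]]_n) :
  0 <= k -> op_le X k -> fro (X *m b) <= k ^+ 2 * fro b.
Proof.
rewrite le_eqVlt => /orP[/eqP k0|k0] h.
  have := h (X *m b) b; rewrite -k0 expr0n /= !mul0r -rform1_mulr rform1.
  by rewrite pmulr_rle0.
(* Testing against X b / k gives 2 |X b|^2 / k <= |X b|^2 / k + k |b|^2. *)
have := h (((k^-1)%:C)%C *: (X *m b)) b.
rewrite -rform1_mulr rformZl rform1 froZ sqc_real => h1.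
have : k ^+ 2 * (2 * (k^-1 * fro (X *m b)) ) <= k ^+ 2 * (k * (k^-1 ^+ 2 * fro (X *m b) + fro b)).
  by rewrite ler_wpM2l ?sqr_ge0.
have -> : k ^+ 2 * (2 * (k^-1 * fro (X *m b))) = k * (2 * fro (X *m b)).
  by field; rewrite gt_eqF.
have -> : k ^+ 2 * (k * (k^-1 ^+ 2 * fro (X *m b) + fro b)) =
  k * (fro (X *m b) + k ^+ 2 * fro b) by field; rewrite gt_eqF.
by rewrite ler_pM2l//; lra.
Qed.

Lemma op_le_rform n (X : 'M[R[i]]_n) (k : R) a : op_le X k -> rform X a a <= k * fro a.
Proof. by move=> /(_ a a); rewrite -mulr2n -[fro a *+ 2]mulr_natl mulrCA ler_pM2l. Qed.

Lemma op_leM m n l (X : 'M[R[i]]_(m, n)) (Y : 'M[R[i]]_(n, l)) (k k' : R) :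
  0 <= k -> 0 <= k' -> op_le X k -> op_le Y k' -> op_le (X *m Y) (k * k').
Proof.
move=> k0 k'0 hX hY a b; rewrite rform_mulr.
have hYb := op_le_mulmx b k'0 hY; have hXY := op_le_mulmx (Y *m b) k0 hX.
move: k'0; rewrite le_eqVlt => /orP[/eqP k'E|k'0].
  move: hYb; rewrite -k'E expr0n /= mul0r => h.
  have -> : Y *m b = 0 by apply: fro_eq0; apply: le_anti; rewrite h fro_ge0.
  by rewrite mulr0 mul0r /rform mulmx0 mxE mulr0.
(* Scaling a by k' balances k'^2 |a|^2 against |Y b|^2 <= k'^2 |b|^2, after which a factor k'
   cancels. *)
have := hX (k'%:C%C *: a) (Y *m b); rewrite rformZl froZ sqc_real => h.
have {hYb} : k * (k' ^+ 2 * fro a + fro (Y *m b)) <= k * (k' ^+ 2 * fro a + k' ^+ 2 * fro b).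
  by apply: ler_wpM2l => //; rewrite lerD2l.
move/(le_trans h) => h2; rewrite -(ler_pM2l k'0).
by move: h2; congr (_ <= _); ring.
Qed.

Lemma op_le_scalar n (z : R[i]) (k : R) : 0 < k -> sqc z <= k ^+ 2 ->
  op_le (z%:M : 'M[R[i]]_n) k.
Proof.
move=> k0 hz a b; have -> : rform z%:M a b = rform 1%:M a (z *: b).
  by rewrite -mul_scalar_mx rform1_mulr.
apply: le_trans (rform1_le _ _ k0) _; rewrite mulrDr lerD2l ler_pdivrMl// froZ mulrA.
by rewrite -expr2 ler_wpM2r ?fro_ge0.
Qed.

End ComplexMatrices.

(** * Almost surely bounded random variables and their expectations *)

Section BoundedRandomVariables.
Context {R : realType} {d} {Y : measurableType d}.
Variable law : probability Y R.

(** A class stable under sums and products whose members are all integrable, so that linearity of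
    [Ex] needs no separate integrability argument. *)
Definition ae_bounded (f : Y -> R) : Prop :=
  measurable_fun [set: Y] f /\ exists k, {ae law, forall y, `|f y| <= k}.

Definition Ex (f : Y -> R) : R := \int[law]_y f y.

Lemma ae_bounded_cst (c : R) : ae_bounded (fun=> c).
Proof. by split; [exact: measurable_cst | exists `|c|; exact: aeW]. Qed.

Lemma ae_boundedD f g : ae_bounded f -> ae_bounded g -> ae_bounded (fun y => f y + g y).
Proof.
move=> [mf [k hk]] [mg [l hl]]; split; first exact: measurable_funD.
exists (k + l); apply: filterS2 hk hl => y hf hg.
by apply: le_trans (ler_normD _ _) _; exact: lerD.
Qed.

Lemma ae_boundedM f g : ae_bounded f -> ae_bounded g -> ae_bounded (fun y => f y * g y).
Proof.
move=> [mf [k hk]] [mg [l hl]]; split; first exact: measurable_funM.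
by exists (k * l); apply: filterS2 hk hl => y hf hg; rewrite normrM ler_pM.
Qed.

Lemma ae_boundedZ c f : ae_bounded f -> ae_bounded (fun y => c * f y).
Proof. by apply: ae_boundedM; exact: ae_bounded_cst. Qed.

Lemma ae_boundedB f g : ae_bounded f -> ae_bounded g -> ae_bounded (fun y => f y - g y).
Proof.
move=> hf hg; have := ae_boundedD hf (ae_boundedZ (-1) hg); congr ae_bounded.
by apply/funext => y; rewrite mulN1r.
Qed.

Lemma ae_bounded_sum I (s : seq I) (F : I -> Y -> R) :
  (forall i, ae_bounded (F i)) -> ae_bounded (fun y => \sum_(i <- s) F i y).
Proof.
move=> hF; elim: s => [|i s IH].
  by have := ae_bounded_cst 0; congr ae_bounded; apply/funext => y; rewrite big_nil.
have := ae_boundedD (hF i) IH; congr ae_bounded; apply/funext => y; by rewrite big_cons.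
Qed.

Lemma ae_bounded_integrable f : ae_bounded f -> law.-integrable [set: Y] (EFin \o f).
Proof.
move=> [mf [k hk]]; apply/integrableP; split; first exact/measurable_EFinP.
apply: (@le_lt_trans _ _ (\int[law]_y (`|k|%:E))%E).
  apply: ae_ge0_le_integral => //=.
  - by apply/measurable_EFinP; apply: measurableT_comp.
  - apply: filterS hk => y hy _; rewrite lee_fin; apply: le_trans hy _.
    exact: ler_norm.
by rewrite integral_cst//= probability_setT mule1 ltry.
Qed.

Lemma Ex_cst c : Ex (fun=> c) = c.
Proof. by rewrite /Ex Rintegral_cst//= probability_setT mulr1. Qed.

Lemma ExD f g : ae_bounded f -> ae_bounded g -> Ex (fun y => f y + g y) = Ex f + Ex g.
Proof. by move=> hf hg; rewrite /Ex RintegralD//; exact: ae_bounded_integrable. Qed.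

Lemma ExB f g : ae_bounded f -> ae_bounded g -> Ex (fun y => f y - g y) = Ex f - Ex g.
Proof. by move=> hf hg; rewrite /Ex RintegralB//; exact: ae_bounded_integrable. Qed.

Lemma ExZ c f : ae_bounded f -> Ex (fun y => c * f y) = c * Ex f.
Proof. by move=> hf; rewrite /Ex RintegralZl//; exact: ae_bounded_integrable. Qed.

Lemma Ex_sum I (s : seq I) (F : I -> Y -> R) : (forall i, ae_bounded (F i)) ->
  Ex (fun y => \sum_(i <- s) F i y) = \sum_(i <- s) Ex (F i).
Proof.
move=> hF; elim: s => [|i s IH].
  by rewrite big_nil -[RHS](Ex_cst 0); congr Ex; apply/funext => y; rewrite big_nil.
rewrite big_cons -IH -ExD //; last exact: ae_bounded_sum.
by congr Ex; apply/funext => y; rewrite big_cons.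
Qed.

Lemma ae_eq_Ex f g : measurable_fun [set: Y] f -> measurable_fun [set: Y] g ->
  {ae law, forall y, f y = g y} -> Ex f = Ex g.
Proof.
move=> mf mg fg; rewrite /Ex /Rintegral; congr fine; apply: ae_eq_integral => //.
- exact/measurable_EFinP.
- exact/measurable_EFinP.
by apply: filterS fg => y ->.
Qed.

Lemma le_Ex f g : ae_bounded f -> ae_bounded g -> {ae law, forall y, f y <= g y} -> Ex f <= Ex g.
Proof.
(* Monotonicity of the integral wants a pointwise inequality: max(f, g) dominates f everywhere and
   equals g almost surely. *)
move=> hf hg fg; have mh : measurable_fun [set: Y] (fun y => Num.max (f y) (g y)).
  by apply: measurable_maxr; [case: hf | case: hg].
have hgE : {ae law, forall y, g y = Num.max (f y) (g y)}.
  by apply: filterS fg => y /max_idPr ->.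
have hh : ae_bounded (fun y => Num.max (f y) (g y)).
  split => //; case: hg => mg [k hk]; exists k.
  by apply: filterS2 hk hgE => y hy <-.
rewrite (ae_eq_Ex _ mh hgE); last by case: hg.
apply: le_Rintegral => //; try exact: ae_bounded_integrable.
by move=> y _; rewrite le_max lexx.
Qed.

Lemma Ex_ge0 f : ae_bounded f -> {ae law, forall y, 0 <= f y} -> 0 <= Ex f.
Proof. by move=> hf f0; rewrite -(Ex_cst 0); apply: le_Ex => //; exact: ae_bounded_cst. Qed.

End BoundedRandomVariables.

Lemma measurable_funV {R : realType} {d} {Y : measurableType d} (f : Y -> R) :
  measurable_fun [set: Y] f -> measurable_fun [set: Y] (fun y => (f y)^-1).
Proof.
move=> mf; have oD : open [set x : R | x != 0] by exact: open_neq.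
have inv0 : measurable_fun [set x : R | x != 0] (fun x : R => x^-1).
  apply: open_continuous_measurable_fun => // x /set_mem /= x0.
  exact: inv_continuous.
(* Inversion is continuous off 0, and 0^-1 = 0 by convention settles the remaining point. *)
have -> : (fun y => (f y)^-1) = (fun y => if f y == 0 then 0 else (f y)^-1).
  by apply/funext => y; case: eqVneq => // ->; rewrite invr0.
apply: measurable_fun_if => //.
  by apply: measurable_fun_eqr => //; exact: measurable_cst.
move=> mD B mB.
have := mf measurableT _ (inv0 (open_measurable oD) B mB).
rewrite !setTI; congr measurable; apply/seteqP; split => y /=.
  by case => /negbTE ->.
by case => /negbT.
Qed.

(** * Random complex matrices: measurability and expectation of forms *)

Section ComplexRandomMatrices.
Context {R : realType} {d} {Y : measurableType d}.
Variable law : probability Y R.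

Definition cmeasurable (f : Y -> R[i]) : Prop :=
  measurable_fun [set: Y] (fun y => complex.Re (f y)) /\
  measurable_fun [set: Y] (fun y => complex.Im (f y)).

Lemma cmeasurable_cst c : cmeasurable (fun=> c).
Proof. by split; exact: measurable_cst. Qed.

Lemma cmeasurableD f g : cmeasurable f -> cmeasurable g -> cmeasurable (fun y => f y + g y).
Proof.
by move=> [fr fi] [gr gi]; split;
  [under eq_fun do rewrite ReD | under eq_fun do rewrite ImD]; exact: measurable_funD.
Qed.

Lemma cmeasurableM f g : cmeasurable f -> cmeasurable g -> cmeasurable (fun y => f y * g y).
Proof.
move=> [fr fi] [gr gi]; split.
  under eq_fun do rewrite ReM.
  by apply: measurable_funB; exact: measurable_funM.
under eq_fun do rewrite ImM.
by apply: measurable_funD; exact: measurable_funM.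
Qed.

Lemma cmeasurable_conj f : cmeasurable f -> cmeasurable (fun y => Num.conj (f y)).
Proof.
move=> [fr fi]; split; first by under eq_fun do rewrite Re_conj.
by under eq_fun do rewrite Im_conj; exact: measurable_funN.
Qed.

Lemma cmeasurable_sum I (s : seq I) (F : I -> Y -> R[i]) :
  (forall i, cmeasurable (F i)) -> cmeasurable (fun y => \sum_(i <- s) F i y).
Proof.
move=> hF; elim: s => [|i s IH].
  by under eq_fun do rewrite big_nil; exact: cmeasurable_cst.
by under eq_fun do rewrite big_cons; exact: cmeasurableD.
Qed.

Lemma cmeasurable_prod I (s : seq I) (F : I -> Y -> R[i]) :
  (forall i, cmeasurable (F i)) -> cmeasurable (fun y => \prod_(i <- s) F i y).
Proof.
move=> hF; elim: s => [|i s IH].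
  by under eq_fun do rewrite big_nil; exact: cmeasurable_cst.
by under eq_fun do rewrite big_cons; exact: cmeasurableM.
Qed.

Lemma cmeasurable_sqc f : cmeasurable f -> measurable_fun [set: Y] (fun y => sqc (f y)).
Proof.
by move=> [fr fi]; apply: measurable_funD; exact: measurable_funX.
Qed.

Lemma cmeasurableV f : cmeasurable f -> cmeasurable (fun y => (f y)^-1).
Proof.
move=> hf; have -> : (fun y => (f y)^-1) =
    (fun y => ((sqc (f y))^-1)%:C%C * Num.conj (f y)).
  apply/funext => y; have [->|f0] := eqVneq (f y) 0.
    by rewrite invr0 rmorph0 mulr0.
  apply: (mulIf f0); rewrite mulVf// -mulrA mul_conj_sqc.
  have s0 : sqc (f y) != 0 by apply: contra f0 => /eqP/sqc_eq0 ->.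
  by rewrite -rmorphM mulVf.
apply: cmeasurableM; last exact: cmeasurable_conj.
split; last exact: measurable_cst.
exact: measurable_funV (cmeasurable_sqc hf).
Qed.

Definition mx_measurable m n (F : Y -> 'M[R[i]]_(m, n)) : Prop :=
  forall i j, cmeasurable (fun y => F y i j).

Lemma mx_measurableM m n k (F : Y -> 'M[R[i]]_(m, n)) (G : Y -> 'M[R[i]]_(n, k)) :
  mx_measurable F -> mx_measurable G -> mx_measurable (fun y => F y *m G y).
Proof.
move=> hF hG i j; under eq_fun do rewrite mxE.
by apply: cmeasurable_sum => l; exact: cmeasurableM.
Qed.

Lemma mx_measurable_det n (F : Y -> 'M[R[i]]_n) : mx_measurable F -> cmeasurable (fun y => \det (F y)).
Proof.
move=> hF; apply: cmeasurable_sum => s; apply: cmeasurableM; first exact: cmeasurable_cst.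
exact: cmeasurable_prod.
Qed.

Lemma mx_measurable_adj n (F : Y -> 'M[R[i]]_n) : mx_measurable F -> mx_measurable (fun y => \adj (F y)).
Proof.
move=> hF i j; under eq_fun do rewrite mxE.
apply: cmeasurableM; first exact: cmeasurable_cst.
apply: mx_measurable_det => k l; under eq_fun do rewrite !mxE; exact: hF.
Qed.

Lemma mx_measurable_invmx n (F : Y -> 'M[R[i]]_n) : mx_measurable F -> mx_measurable (fun y => invmx (F y)).
Proof.
move=> hF i j.
have mb : measurable_fun [set: Y] (fun y => sqc (\det (F y)) == 0).
  apply: measurable_fun_eqr; last exact: measurable_cst.
  exact: cmeasurable_sqc (mx_measurable_det hF).
(* [invmx] is Cramer's formula when the determinant is nonzero and returns its argument otherwise;
   both branches are measurable. *)
have -> : (fun y => invmx (F y) i j) = (fun y => if sqc (\det (F y)) == 0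
    then F y i j else (\det (F y))^-1 * (\adj (F y)) i j).
  apply/funext => y; rewrite /invmx unitmxE unitfE.
  have [/sqc_eq0 ->|s0] := eqVneq (sqc _) 0; first by rewrite eqxx.
  have -> : \det (F y) != 0 by apply: contra s0 => /eqP ->; rewrite sqc0.
  by rewrite [LHS]mxE.
have h : cmeasurable (fun y => (\det (F y))^-1 * (\adj (F y)) i j).
  by apply: cmeasurableM; [exact/cmeasurableV/mx_measurable_det | exact: mx_measurable_adj].
case: (hF i j) h => fr fi [gr gi]; split.
  by under eq_fun do rewrite (fun_if (@complex.Re R)); exact: measurable_fun_ifT.
by under eq_fun do rewrite (fun_if (@complex.Im R)); exact: measurable_fun_ifT.
Qed.

Definition ae_bounded_mx m n (F : Y -> 'M[R[i]]_(m, n)) : Prop :=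
  mx_measurable F /\ exists k, {ae law, forall y, fro (F y) <= k}.

Lemma froD_le m n (X Z : 'M[R[i]]_(m, n)) : fro (X + Z) <= 2 * fro X + 2 * fro Z.
Proof.
rewrite /fro !mulr_sumr -big_split; apply: ler_sum => i _ /=.
rewrite !mulr_sumr -big_split; apply: ler_sum => j _ /=.
rewrite mxE /sqc ReD ImD; set a := complex.Re _; set b := complex.Re _.
set a' := complex.Im _; set b' := complex.Im _.
by have := sqr_ge0 (a - b); have := sqr_ge0 (a' - b'); rewrite !expr2; lra.
Qed.

Lemma ae_bounded_mx_cst m n (X : 'M[R[i]]_(m, n)) : ae_bounded_mx (fun=> X).
Proof.
by split; [move=> i j; exact: cmeasurable_cst | exists (fro X); exact: aeW].
Qed.

Lemma ae_bounded_mxD m n (F G : Y -> 'M[R[i]]_(m, n)) :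
  ae_bounded_mx F -> ae_bounded_mx G -> ae_bounded_mx (fun y => F y + G y).
Proof.
move=> [mF [k hk]] [mG [l hl]]; split.
  by move=> i j; under eq_fun do rewrite mxE; exact: cmeasurableD.
exists (2 * k + 2 * l); apply: filterS2 hk hl => y hF hG.
by apply: le_trans (froD_le _ _) _; lra.
Qed.

Lemma ae_bounded_mxM m n k (F : Y -> 'M[R[i]]_(m, n)) (G : Y -> 'M[R[i]]_(n, k)) :
  ae_bounded_mx F -> ae_bounded_mx G -> ae_bounded_mx (fun y => F y *m G y).
Proof.
move=> [mF [a ha]] [mG [b hb]]; split; first exact: mx_measurableM.
exists (a * b); apply: filterS2 ha hb => y hF hG.
by apply: le_trans (fro_mulmx_le _ _) _; rewrite ler_pM ?fro_ge0.
Qed.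

Lemma ae_bounded_mxN m n (F : Y -> 'M[R[i]]_(m, n)) : ae_bounded_mx F -> ae_bounded_mx (fun y => - F y).
Proof.
move=> [mF [k hk]]; split; last first.
  by exists k; apply: filterS hk => y hy; rewrite froN.
move=> i j; under eq_fun do rewrite mxE -mulN1r.
by apply: cmeasurableM; first exact: cmeasurable_cst.
Qed.

Lemma ae_bounded_mx_ct m n (F : Y -> 'M[R[i]]_(m, n)) : ae_bounded_mx F -> ae_bounded_mx (fun y => ct (F y)).
Proof.
move=> [mF [k hk]]; split; last first.
  by exists k; apply: filterS hk => y hy; rewrite fro_ct.
by move=> i j; under eq_fun do rewrite ctE; exact: cmeasurable_conj.
Qed.

Lemma ae_bounded_mx_ext m n (F G : Y -> 'M[R[i]]_(m, n)) : F =1 G -> ae_bounded_mx F -> ae_bounded_mx G.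
Proof. by move=> /funext ->. Qed.

Lemma sqc_fro m n (X : 'M[R[i]]_(m, n)) i j : sqc (X i j) <= fro X.
Proof.
rewrite /fro (bigD1 i)//= (bigD1 j)//= -addrA lerDl addr_ge0 ?sumr_ge0//.
  by move=> k _; exact: sqc_ge0.
by move=> k _; apply: sumr_ge0 => l _; exact: sqc_ge0.
Qed.

Lemma ae_bounded_mx_fro m n (F : Y -> 'M[R[i]]_(m, n)) : ae_bounded_mx F -> ae_bounded law (fun y => fro (F y)).
Proof.
move=> [mF [k hk]]; split; last first.
  by exists k; apply: filterS hk => y hy; rewrite ger0_norm ?fro_ge0.
apply: measurable_sum => i; apply: measurable_sum => j; exact: cmeasurable_sqc.
Qed.

Lemma ae_bounded_mx_entry m n (F : Y -> 'M[R[i]]_(m, n)) i j : ae_bounded_mx F ->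
  ae_bounded law (fun y => complex.Re (F y i j)) /\ ae_bounded law (fun y => complex.Im (F y i j)).
Proof.
move=> [mF [k hk]]; case: (mF i j) => fr fi.
have bound (x : R) (X : 'M[R[i]]_(m, n)) : x ^+ 2 <= sqc (X i j) -> fro X <= k -> `|x| <= 1 + k.
  move=> xX Xk; have : `|x| ^+ 2 <= k.
    by rewrite real_normK ?num_real//; apply: le_trans xX (le_trans (sqc_fro _ _ _) Xk).
  by have := sqr_ge0 (`|x| - 1); have := normr_ge0 x; rewrite !expr2; lra.
split; split => //; exists (1 + k); apply: filterS hk => y /(bound _ _ _); apply.
  by rewrite /sqc lerDl sqr_ge0.
by rewrite /sqc lerDr sqr_ge0.
Qed.

Lemma rform_sumE m n (X : 'M[R[i]]_(m, n)) a b : rform X a b =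
  \sum_i \sum_j (complex.Re (Num.conj (a i 0) * b j 0) * complex.Re (X i j) -
                 complex.Im (Num.conj (a i 0) * b j 0) * complex.Im (X i j)).
Proof.
rewrite /rform -mulmxA mxE Re_sum; apply: eq_bigr => i _.
rewrite ctE mxE mulr_sumr Re_sum; apply: eq_bigr => j _.
by rewrite -ReM mulrCA mulrC.
Qed.

Lemma ae_bounded_mx_rform m n (F : Y -> 'M[R[i]]_(m, n)) a b :
  ae_bounded_mx F -> ae_bounded law (fun y => rform (F y) a b).
Proof.
move=> mF; under eq_fun do rewrite rform_sumE.
apply: ae_bounded_sum => i; apply: ae_bounded_sum => j; have [hr hi] := ae_bounded_mx_entry i j mF.
by apply: ae_boundedB; exact: ae_boundedZ.
Qed.

Lemma rform_E n (F : Y -> 'M[R[i]]_n) a b : ae_bounded_mx F ->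
  rform (E_Cmx law F) a b = Ex law (fun y => rform (F y) a b).
Proof.
move=> mF; have hE i j := ae_bounded_mx_entry i j mF.
under [in RHS]eq_fun do rewrite rform_sumE.
rewrite rform_sumE Ex_sum => [|i]; last first.
  by apply: ae_bounded_sum => j; case: (hE i j) => hr hi; apply: ae_boundedB; exact: ae_boundedZ.
apply: eq_bigr => i _; rewrite Ex_sum => [|j]; last first.
  by case: (hE i j) => hr hi; apply: ae_boundedB; exact: ae_boundedZ.
apply: eq_bigr => j _; case: (hE i j) => hr hi.
by rewrite ExB ?ExZ//; [rewrite mxE | exact: ae_boundedZ | exact: ae_boundedZ].
Qed.

(** With D = X - Z, the choice a = D e_j, b = e_j turns the form of D into |D e_j|^2; real parts
    alone therefore determine a matrix. *)
Lemma rform_inj m n (X Z : 'M[R[i]]_(m, n)) :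
  (forall a b, rform X a b = rform Z a b) -> X = Z.
Proof.
move=> h; apply/eqP; rewrite -subr_eq0; apply/eqP; set D := X - Z.
have D0 a b : rform D a b = 0 by rewrite rformBm h subrr.
apply/matrixP => i j; rewrite [RHS]mxE.
have : D *m delta_mx j 0 = 0 :> 'cV_m.
  by apply: fro_eq0; rewrite -rform1 rform1_mulr D0.
by move/matrixP/(_ i 0); rewrite -colE !mxE.
Qed.

Lemma ae_bounded_mxZ m n (c : R[i]) (F : Y -> 'M[R[i]]_(m, n)) :
  ae_bounded_mx F -> ae_bounded_mx (fun y => c *: F y).
Proof.
move=> mF; have := ae_bounded_mxM (ae_bounded_mx_cst (c%:M : 'M[R[i]]_m)) mF.
by apply: ae_bounded_mx_ext => y; rewrite mul_scalar_mx.
Qed.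

Lemma E_CmxZ n (c : R) (F : Y -> 'M[R[i]]_n) : ae_bounded_mx F ->
  E_Cmx law (fun y => c%:C%C *: F y) = c%:C%C *: E_Cmx law F.
Proof.
move=> mF; apply: rform_inj => a b; rewrite rformZm !rform_E//; last exact: ae_bounded_mxZ.
by rewrite -ExZ; [congr Ex; apply/funext => y; rewrite rformZm | exact: ae_bounded_mx_rform].
Qed.

Lemma ae_eq_E_Cmx n (F G : Y -> 'M[R[i]]_n) : mx_measurable F -> mx_measurable G ->
  {ae law, forall y, F y = G y} -> E_Cmx law F = E_Cmx law G.
Proof.
move=> mF mG FG; apply/matrixP => i j; rewrite [LHS]mxE [RHS]mxE /Cexpectation.
have [fr fi] := mF i j; have [gr gi] := mG i j.
congr (_ +i* _)%C; apply: ae_eq_Ex => //; move: FG; apply: filterS => y -> //.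
Qed.

End ComplexRandomMatrices.

(** * Inverses of matrices with coercive real or imaginary part *)

Section CoerciveMatrices.
Context {R : realType}.

(* Re (- i c) = Im c, so that [iform X a b] is Im (a^* X b). *)
Definition nI : R[i] := (0 +i* -1)%C.

Definition iform m n (X : 'M[R[i]]_(m, n)) a b : R := rform X a (nI *: b).

Lemma sqc_nI : sqc nI = 1.
Proof. by rewrite /sqc /= expr0n add0r sqrrN expr1n. Qed.

Lemma iform_ct m n (X : 'M[R[i]]_(m, n)) a b : iform (ct X) b a = - iform X a b.
Proof.
rewrite /iform rform_ct /rform ctZ -!scalemxAl -scalemxAr [in LHS]mxE [in RHS]mxE.
by rewrite !ReM conjcE /=; ring.
Qed.

Lemma iform_herm n (X : 'M[R[i]]_n) u : ct X = X -> iform X u u = 0.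
Proof. by move=> hX; have := iform_ct X u u; rewrite hX; lra. Qed.

Lemma iformDm m n (X Y : 'M[R[i]]_(m, n)) a b : iform (X + Y) a b = iform X a b + iform Y a b.
Proof. exact: rformDm. Qed.

Lemma iformNm m n (X : 'M[R[i]]_(m, n)) a b : iform (- X) a b = - iform X a b.
Proof. exact: rformNm. Qed.

Lemma iformBm m n (X Y : 'M[R[i]]_(m, n)) a b : iform (X - Y) a b = iform X a b - iform Y a b.
Proof. exact: rformBm. Qed.

Lemma iform_mul m n k l (L : 'M[R[i]]_(k, m)) (X : 'M[R[i]]_(k, l)) (K : 'M[R[i]]_(l, n)) a b :
  iform (ct L *m X *m K) a b = iform X (L *m a) (K *m b).
Proof. by rewrite /iform rform_mul scalemxAr. Qed.

Lemma ct_mulmx11 n (u : 'cV[R[i]]_n) : (ct u *m u) 0 0 = (fro u)%:C%C.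
Proof.
rewrite mxE /fro rmorph_sum; apply: eq_bigr => i _.
by rewrite big_ord1 ctE mul_conj_sqc.
Qed.

Lemma rform_scalar n (z : R[i]) (u : 'cV[R[i]]_n) :
  rform z%:M u u = complex.Re z * fro u.
Proof.
rewrite /rform mul_mx_scalar -scalemxAl mxE ct_mulmx11.
by rewrite ReM /= mulr0 subr0.
Qed.

Lemma iform_scalar n (z : R[i]) (u : 'cV[R[i]]_n) :
  iform z%:M u u = complex.Im z * fro u.
Proof.
have -> : iform z%:M u u = rform (nI * z)%:M u u.
  by rewrite -scale_scalar_mx /iform /rform -!scalemxAr -!scalemxAl.
by rewrite rform_scalar ReM /=; ring.
Qed.

Lemma fro_col_sum m n (X : 'M[R[i]]_(m, n)) :
  fro X = \sum_j fro (X *m delta_mx j 0 : 'cV[R[i]]_m).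
Proof.
rewrite /fro exchange_big; apply: eq_bigr => j _; apply: eq_bigr => i _.
by rewrite big_ord1 -colE mxE.
Qed.

Lemma fro_delta n (j : 'I_n) : fro (delta_mx j 0 : 'cV[R[i]]_n) = 1.
Proof.
rewrite /fro (bigD1 j)//= big_ord1 mxE !eqxx /= sqc_real expr1n big1 ?addr0//.
by move=> i ij; rewrite big_ord1 mxE (negbTE ij) sqc0.
Qed.

Section Coercive.
Context {n : nat}.
Variables (A : 'M[R[i]]_n) (k : R[i]) (c : R).
Hypotheses (k1 : sqc k = 1) (c0 : 0 < c).
Hypothesis coercive : forall u, c * fro u <= rform A u (k *: u).

(** Young's inequality with weight c. The unimodular [k] lets one argument serve both kinds of
    coercivity: [k = 1] for the real part, [k = nI] for the imaginary part. *)
Lemma coercive_fro (u : 'cV[R[i]]_n) : c ^+ 2 * fro u <= fro (A *m u).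
Proof.
have h := coercive u.
have : rform A u (k *: u) = rform 1%:M u (k *: (A *m u)).
  by rewrite scalemxAr rform1_mulr.
move=> e; move: h; rewrite e => h.
have := rform1_le u (k *: (A *m u)) c0; rewrite froZ k1 mul1r => h2.
have : c * fro u <= c^-1 * fro (A *m u) by lra.
by rewrite ler_pdivlMl// mulrA -expr2.
Qed.

Lemma coercive_unit : A \in unitmx.
Proof.
rewrite -row_free_unit -kermx_eq0; apply/eqP/row_matrixP => i.
rewrite row0; set v := row i _.
have vA : v *m A = 0.
  by apply/sub_kermxP; exact: row_sub.
have := coercive (ct v).
rewrite /rform ctK vA mul0mx mxE /= fro_ct pmulr_rle0// => v0.
by apply: fro_eq0; apply: le_anti; rewrite v0 fro_ge0.
Qed.

Lemma coercive_inv_vec (b : 'cV[R[i]]_n) : fro (invmx A *m b) <= c ^- 2 * fro b.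
Proof.
rewrite ler_pdivlMl ?exprn_gt0//; apply: le_trans (coercive_fro _) _.
by rewrite mulmxA mulmxV ?coercive_unit// mul1mx.
Qed.

Lemma coercive_inv : fro (invmx A) <= c ^- 2 * n%:R.
Proof.
rewrite fro_col_sum; apply: le_trans (_ : \sum_(j < n) c ^- 2 <= _).
  apply: ler_sum => j _; apply: le_trans (coercive_inv_vec _) _.
  by rewrite fro_delta mulr1.
by rewrite sumr_const card_ord mulr_natr.
Qed.

End Coercive.

Lemma invmxB n (A B : 'M[R[i]]_n) : A \in unitmx -> B \in unitmx ->
  invmx A - invmx B = invmx A *m (B - A) *m invmx B.
Proof.
move=> uA uB; rewrite mulmxBr mulmxBl mulVmx// mul1mx -mulmxA mulmxV//.
by rewrite mulmx1.
Qed.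

Lemma invmxBr n (A B : 'M[R[i]]_n) : A \in unitmx -> B \in unitmx ->
  invmx B - invmx A = invmx A *m (A - B) *m invmx B.
Proof.
move=> uA uB; rewrite mulmxBr mulmxBl (mulVmx uA) mul1mx -mulmxA (mulmxV uB).
by rewrite mulmx1.
Qed.

Lemma iform_inv n (A : 'M[R[i]]_n) w : A \in unitmx ->
  iform (invmx A) w w = - iform A (invmx A *m w) (invmx A *m w).
Proof.
move=> uA; rewrite -iform_mul -iform_ct !ctM ctK mulmxA -ctM mulmxV//.
by rewrite ct1 mul1mx.
Qed.

(** The mirror image of [iform_inv], with A^-* in place of A^-1. Both are needed because a
    difference of two solutions meets one resolvent on its left and the other on its right. *)
Lemma iform_inv_ct n (A : 'M[R[i]]_n) w : A \in unitmx ->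
  iform (invmx A) w w = - iform A (ct (invmx A) *m w) (ct (invmx A) *m w).
Proof.
move=> uA; rewrite -iform_mul -iform_ct !ctM !ctK -ctM.
by rewrite mulVmx// ct1 mulmx1.
Qed.

Lemma rform_inv n (A : 'M[R[i]]_n) w : A \in unitmx ->
  rform (invmx A) w w = rform A (invmx A *m w) (invmx A *m w).
Proof.
move=> uA; rewrite -[RHS]rform_ct -rform_mul.
by rewrite -ctM mulmxV// ct1 mul1mx.
Qed.

End CoerciveMatrices.

(** Let i be the infimum of the admissible m >= k. By closedness P holds at i, and if k < i one more
    step would give an admissible value below i. This replaces the iteration of a contraction with
    factor 1 - t towards k. *)
Lemma contraction_limit {R : realType} (P : R -> Prop) (k t m0 : R) :
  (forall m m', m <= m' -> P m -> P m') ->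
  (forall m, (forall e, 0 < e -> P (m + e)) -> P m) ->
  0 < t <= 1 -> (forall m, k < m -> P m -> P (m - (m - k) * t)) ->
  k <= m0 -> P m0 -> P k.
Proof.
move=> Pmono Pcl /andP[t0 t1] step km0 Pm0.
pose S := [set m | k <= m /\ P m]; pose i := inf S.
have infS : has_inf S by split; [exists m0 | exists k => m []].
have ki : k <= i by apply: lb_le_inf; [exists m0 | move=> m []].
have Pi : P i.
  apply: Pcl => e e0; have [m [km Pm] mi] := inf_adherent e0 infS.
  exact: Pmono (ltW mi) Pm.
move: ki; rewrite le_eqVlt => /orP[/eqP -> //|ki].
have : i <= i - (i - k) * t.
  apply: ge_inf; first by case: infS.
  split; last exact: step.
  have : (i - k) * t <= (i - k) * 1 by rewrite ler_wpM2l// subr_ge0 ltW.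
  by rewrite mulr1; lra.
by rewrite lerDl oppr_ge0 pmulr_lle0// subr_le0 leNgt ki.
Qed.

(** * Solutions of the fixed-point equation: imaginary part, Lipschitz bound, uniqueness *)

Section Solutions.
Context {R : realType} {d} {Y : measurableType d} {p : nat}.
Variables (law : probability Y R) (alpha : R) (alpha_gt0 : 0 < alpha).
Variable S : Y -> 'M[R[i]]_p.
Hypotheses (S_herm : forall y, ct (S y) = S y) (S_ae_bounded : ae_bounded_mx law S).

Definition resolvent (W : 'M[R[i]]_p) (y : Y) := invmx (W - S y).

Definition self_energy W y := S y + S y *m resolvent W y *m S y.

(** Carrying the constant c makes invertibility and the bound on the inverse immediate, without
    compactness of the unit sphere. *)
Definition im_posdef (W : 'M[R[i]]_p) : Prop :=
  exists2 c, 0 < c & forall u, c * fro u <= iform W u u.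

(* With W = - M(z)^-1 and S = T / alpha, the equation for M(z) becomes
   W = z - alpha E[S + S (W - S)^-1 S]. *)
Definition is_sol (z : R[i]) (W : 'M[R[i]]_p) : Prop :=
  im_posdef W /\ W = z%:M - (alpha%:C)%C *: E_Cmx law (self_energy W).

Lemma iformA W y u : iform (W - S y) u u = iform W u u.
Proof. by rewrite iformBm (iform_herm _ (S_herm y)) subr0. Qed.

Lemma imdef_unit W y : im_posdef W -> W - S y \in unitmx.
Proof.
move=> [c c0 h]; apply: (coercive_unit (k := nI) (c := c)) => // u.
by rewrite -/(iform _ u u) iformA.
Qed.

Lemma ae_bounded_mx_inv (F : Y -> 'M[R[i]]_p) k c : ae_bounded_mx law F -> sqc k = 1 -> 0 < c ->
  {ae law, forall y, forall u, c * fro u <= rform (F y) u (k *: u)} ->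
  ae_bounded_mx law (fun y => invmx (F y)).
Proof.
move=> [mF _] k1 c0 h; split; first exact: mx_measurable_invmx.
exists (c ^- 2 * p%:R); apply: filterS h => y hy.
exact: (coercive_inv k1 c0 hy).
Qed.

Lemma ae_bounded_mx_A W : ae_bounded_mx law (fun y => W - S y).
Proof. by apply: ae_bounded_mxD; [exact: ae_bounded_mx_cst | exact: ae_bounded_mxN]. Qed.

Lemma resolvent_ae_bounded W : im_posdef W -> ae_bounded_mx law (resolvent W).
Proof.
move=> [c c0 h]; apply: (ae_bounded_mx_inv (k := nI) (c := c)) => //.
- exact: ae_bounded_mx_A.
- exact: sqc_nI.
by apply: aeW => y u; rewrite -/(iform _ u u) iformA.
Qed.

Lemma SRS_ae_bounded W : im_posdef W -> ae_bounded_mx law (fun y => S y *m resolvent W y *m S y).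
Proof. by move=> hW; apply: ae_bounded_mxM => //; apply: ae_bounded_mxM => //; exact: resolvent_ae_bounded. Qed.

Lemma self_energy_ae_bounded W : im_posdef W -> ae_bounded_mx law (self_energy W).
Proof. by move=> hW; apply: ae_bounded_mxD => //; exact: SRS_ae_bounded. Qed.

Lemma sol_rform z W a b : is_sol z W ->
  rform W a b = rform z%:M a b - alpha * Ex law (fun y => rform (self_energy W y) a b).
Proof.
move=> [hW {1}->]; rewrite rformBm rformZm rform_E//; exact: self_energy_ae_bounded.
Qed.

Lemma SRSl W y a b : rform (S y *m resolvent W y *m S y) a b =
  rform (resolvent W y) (S y *m a) (S y *m b).
Proof. by rewrite -{1}(S_herm y) rform_mul. Qed.

Lemma iSRS W y a b : iform (S y *m resolvent W y *m S y) a b =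
  iform (resolvent W y) (S y *m a) (S y *m b).
Proof. by rewrite -{1}(S_herm y) iform_mul. Qed.

Lemma ae_bounded_vec (F : Y -> 'M[R[i]]_p) (a b : Y -> 'cV[R[i]]_p) :
  ae_bounded_mx law F -> ae_bounded_mx law a -> ae_bounded_mx law b -> ae_bounded law (fun y => rform (F y) (a y) (b y)).
Proof.
move=> hF ha hb.
have := ae_bounded_mx_rform (1%:M : 'cV[R[i]]_1) (1%:M : 'cV[R[i]]_1) (ae_bounded_mxM (ae_bounded_mxM (ae_bounded_mx_ct ha) hF) hb).
congr ae_bounded; apply/funext => y; rewrite rform_mul /rform !mulmx1//.
Qed.

Lemma RS_ae_bounded W (u : 'cV[R[i]]_p) : im_posdef W -> ae_bounded_mx law (fun y => resolvent W y *m (S y *m u)).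
Proof.
move=> hW; apply: ae_bounded_mxM; first exact: resolvent_ae_bounded.
by apply: ae_bounded_mxM => //; exact: ae_bounded_mx_cst.
Qed.

Lemma RcS_ae_bounded W (u : 'cV[R[i]]_p) : im_posdef W -> ae_bounded_mx law (fun y => ct (resolvent W y) *m (S y *m u)).
Proof.
move=> hW; apply: ae_bounded_mxM; first by apply: ae_bounded_mx_ct; exact: resolvent_ae_bounded.
by apply: ae_bounded_mxM => //; exact: ae_bounded_mx_cst.
Qed.

Lemma iform_ae_bounded W (a : Y -> 'cV[R[i]]_p) : ae_bounded_mx law a ->
  ae_bounded law (fun y => iform W (a y) (a y)).
Proof.
move=> ha; apply: ae_bounded_vec => //; first exact: ae_bounded_mx_cst.
have := ae_bounded_mxM (ae_bounded_mx_cst law (nI%:M : 'M[R[i]]_p)) ha.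
by apply: ae_bounded_mx_ext => y; rewrite mul_scalar_mx.
Qed.

(** Take imaginary parts in the equation: the Hermitian S drops out, and the sign in Im R = - R^*
    (Im W) R cancels the minus sign in front of the expectation. *)
Lemma sol_iform z W u : is_sol z W -> iform W u u = complex.Im z * fro u +
  alpha * Ex law (fun y => iform W (resolvent W y *m (S y *m u)) (resolvent W y *m (S y *m u))).
Proof.
move=> hs; have [hW _] := hs.
rewrite {1}/iform (sol_rform _ _ hs) -/(iform _ _ _) iform_scalar; congr (_ + _).
rewrite -mulrN; congr (_ * _); rewrite -mulN1r -ExZ; last first.
  exact: ae_bounded_mx_rform (self_energy_ae_bounded hW).
congr Ex; apply/funext => y; rewrite -/(iform _ u u) iformDm (iform_herm _ (S_herm y)).
by rewrite add0r iSRS iform_inv ?imdef_unit// iformA mulN1r opprK.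
Qed.

Lemma sol_iform_ct z W u : is_sol z W -> iform W u u = complex.Im z * fro u +
  alpha * Ex law (fun y =>
    iform W (ct (resolvent W y) *m (S y *m u)) (ct (resolvent W y) *m (S y *m u))).
Proof.
move=> hs; have [hW _] := hs.
rewrite {1}/iform (sol_rform _ _ hs) -/(iform _ _ _) iform_scalar; congr (_ + _).
rewrite -mulrN; congr (_ * _); rewrite -mulN1r -ExZ; last first.
  exact: ae_bounded_mx_rform (self_energy_ae_bounded hW).
congr Ex; apply/funext => y; rewrite -/(iform _ u u) iformDm (iform_herm _ (S_herm y)).
by rewrite add0r iSRS iform_inv_ct ?imdef_unit// iformA mulN1r opprK.
Qed.

Lemma imdef_ge0 W u : im_posdef W -> 0 <= iform W u u.
Proof.
by move=> [c c0 h]; apply: le_trans (h u); rewrite mulr_ge0 ?fro_ge0// ltW.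
Qed.

Lemma sol_iform_ge z W u : is_sol z W -> complex.Im z * fro u <= iform W u u.
Proof.
move=> hs; rewrite (sol_iform u hs) lerDl; apply: mulr_ge0; first exact: ltW.
have [hW _] := hs; apply: Ex_ge0; first by apply: iform_ae_bounded; exact: RS_ae_bounded.
by apply: aeW => y; exact: imdef_ge0.
Qed.

(** Subtract the two equations and insert the resolvent identity R2 - R1 = R1 (W1 - W2) R2. *)
Lemma sol_diff z1 z2 W1 W2 a b : is_sol z1 W1 -> is_sol z2 W2 ->
  rform (W1 - W2) a b = rform (z1 - z2)%:M a b + alpha * Ex law (fun y =>
    rform (W1 - W2) (ct (resolvent W1 y) *m (S y *m a)) (resolvent W2 y *m (S y *m b))).
Proof.
move=> s1 s2; have [h1 _] := s1; have [h2 _] := s2.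
rewrite rformBm (sol_rform _ _ s1) (sol_rform _ _ s2).
have -> : (z1 - z2)%:M = z1%:M - z2%:M :> 'M[R[i]]_p by exact: raddfB.
rewrite (rformBm z1%:M).
have aux (r1 r2 e1 e2 e3 : R) : e3 = e2 - e1 ->
    r1 - alpha * e1 - (r2 - alpha * e2) = r1 - r2 + alpha * e3.
  by move=> ->; ring.
apply: aux; rewrite -ExB; last 2 first.
- exact: ae_bounded_mx_rform (self_energy_ae_bounded h2).
- exact: ae_bounded_mx_rform (self_energy_ae_bounded h1).
congr Ex; apply/funext => y.
rewrite -[LHS]rform_mul ctK -rformBm /self_energy opprD addrACA subrr add0r rformBm !SRSl -rformBm.
suff -> : resolvent W2 y - resolvent W1 y = resolvent W1 y *m (W1 - W2) *m resolvent W2 y by [].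
have u1 := imdef_unit y h1; have u2 := imdef_unit y h2.
have -> : W1 - W2 = (W1 - S y) - (W2 - S y) by rewrite opprB addrA subrK.
exact: invmxBr u1 u2.
Qed.

Lemma op_le_iform (W : 'M[R[i]]_p) k u : op_le W k -> iform W u u <= k * fro u.
Proof.
move=> hb; have := hb u (nI *: u); rewrite froZ sqc_nI mul1r -mulr2n -/(iform _ _ _).
by rewrite -[fro u *+ 2]mulr_natl mulrCA ler_pM2l.
Qed.

Lemma iform_ub (W : 'M[R[i]]_p) : exists2 c, 0 < c & forall u, iform W u u <= c * fro u.
Proof.
exists (1 + fro W); first by rewrite ltr_pwDl ?fro_ge0.
move=> u; have hb : op_le W (1 + fro W).
  apply: op_le_fro; first by rewrite addr_ge0 ?fro_ge0.
  by rewrite sqrrD expr1n mul1r; have := fro_ge0 W; have := sqr_ge0 (fro W); lra.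
exact: op_le_iform.
Qed.

(* X = W1 - W2 solves X = (z1 - z2) + alpha E[S R1 X R2 S], while n = Im W / Im z
   solves n = 1 + alpha E[S R^* n R S] for each of the two solutions; by
   Cauchy-Schwarz the first linear map contracts the gauge given by n1 and n2. *)
Lemma sol_lipschitz z1 z2 W1 W2 k a b : 0 < complex.Im z1 -> 0 < complex.Im z2 ->
  is_sol z1 W1 -> is_sol z2 W2 -> 0 <= k -> op_le ((z1 - z2)%:M : 'M[R[i]]_p) k ->
  2 * rform (W1 - W2) a b <= k * (iform W1 a a / complex.Im z1 + iform W2 b b / complex.Im z2).
Proof.
set e1 := complex.Im z1; set e2 := complex.Im z2 => e10 e20 s1 s2 k0 hk.
pose n1 u := iform W1 u u / e1; pose n2 u := iform W2 u u / e2.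
have [h1 _] := s1; have [h2 _] := s2.
pose P m := forall a b, 2 * rform (W1 - W2) a b <= m * (n1 a + n2 b).
have n1_ge u : fro u <= n1 u by rewrite ler_pdivlMr// mulrC; exact: sol_iform_ge.
have n2_ge u : fro u <= n2 u by rewrite ler_pdivlMr// mulrC; exact: sol_iform_ge.
have n1_0 u : 0 <= n1 u := le_trans (fro_ge0 u) (n1_ge u).
have n2_0 u : 0 <= n2 u := le_trans (fro_ge0 u) (n2_ge u).
have n1E u : n1 u = fro u + alpha * Ex law (fun y => n1 (ct (resolvent W1 y) *m (S y *m u))).
  rewrite {1}/n1 (sol_iform_ct _ s1) mulrDl [e1 * _]mulrC mulfK ?gt_eqF//.
  congr (_ + _); rewrite -mulrA; congr (_ * _); rewrite mulrC -ExZ.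
    by congr Ex; apply/funext => y; rewrite mulrC.
  by apply: iform_ae_bounded; exact: RcS_ae_bounded.
have n2E u : n2 u = fro u + alpha * Ex law (fun y => n2 (resolvent W2 y *m (S y *m u))).
  rewrite {1}/n2 (sol_iform _ s2) mulrDl [e2 * _]mulrC mulfK ?gt_eqF//.
  congr (_ + _); rewrite -mulrA; congr (_ * _); rewrite mulrC -ExZ.
    by congr Ex; apply/funext => y; rewrite mulrC.
  by apply: iform_ae_bounded; exact: RS_ae_bounded.
have [c1 c10 hc1] := iform_ub W1; have [c2 c20 hc2] := iform_ub W2.
(* Since Im W <= c, the gauges satisfy t n(u) <= |u|^2. In one step the excess m - k is multiplied
   by n - |.|^2 instead of n, so it loses at least the fraction t. *)
pose t := Num.min 1 (Num.min (e1 / c1) (e2 / c2)).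
have t0 : 0 < t by rewrite !lt_min ltr01 !divr_gt0.
have t1 : t <= 1 by rewrite ge_min lexx.
have tn1 u : t * n1 u <= fro u.
  apply: le_trans (_ : e1 / c1 * n1 u <= _).
    by rewrite ler_wpM2r// !ge_min lexx orbT.
  rewrite /n1 mulrAC mulrCA mulrA ler_pdivrMr//.
  by rewrite mulfK ?gt_eqF// [leRHS]mulrC.
have tn2 u : t * n2 u <= fro u.
  apply: le_trans (_ : e2 / c2 * n2 u <= _).
    by rewrite ler_wpM2r// !ge_min lexx !orbT.
  rewrite /n2 mulrAC mulrCA mulrA ler_pdivrMr//.
  by rewrite mulfK ?gt_eqF// [leRHS]mulrC.
suff : P k by apply.
apply: (@contraction_limit _ P k t (k + (1 + fro (W1 - W2)))).
- move=> m m' mm' hm a' b'; apply: le_trans (hm a' b') _.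
  by rewrite ler_wpM2r// addr_ge0.
- move=> m hm a' b'; apply/ler_addgt0Pr => e e0.
  have s0 : 0 < 1 + (n1 a' + n2 b') by rewrite ltr_pwDl ?addr_ge0.
  have := hm _ (divr_gt0 e0 s0) a' b'; move/le_trans; apply.
  rewrite mulrDl lerD2l mulrAC ler_pdivrMr// ler_wpM2l ?ltW//.
  by rewrite ltrDr.
- by rewrite t0.
- move=> m km hm a' b'.
  have mk : 0 <= (m - k) by rewrite subr_ge0 ltW.
  have m0 : 0 <= m by apply: le_trans k0 _; exact: ltW.
  rewrite (sol_diff _ _ s1 s2) mulrDr.
  have hz := hk a' b'.
  have hE : 2 * (alpha * Ex law (fun y =>
      rform (W1 - W2) (ct (resolvent W1 y) *m (S y *m a')) (resolvent W2 y *m (S y *m b')))) <=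
      m * ((n1 a' - fro a') + (n2 b' - fro b')).
    rewrite n1E n2E [fro a' + _]addrC addrK [fro b' + _]addrC addrK -mulrDr.
    rewrite mulrCA [m * _]mulrCA ler_pM2l//.
    have hn1 : ae_bounded law (fun y => n1 (ct (resolvent W1 y) *m (S y *m a'))).
      have := ae_boundedZ (e1^-1) (iform_ae_bounded W1 (RcS_ae_bounded a' h1)).
      by congr ae_bounded; apply/funext => y; rewrite mulrC.
    have hn2 : ae_bounded law (fun y => n2 (resolvent W2 y *m (S y *m b'))).
      have := ae_boundedZ (e2^-1) (iform_ae_bounded W2 (RS_ae_bounded b' h2)).
      by congr ae_bounded; apply/funext => y; rewrite mulrC.
    have hr : ae_bounded law (fun y =>
      rform (W1 - W2) (ct (resolvent W1 y) *m (S y *m a')) (resolvent W2 y *m (S y *m b'))).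
      by apply: ae_bounded_vec; [exact: ae_bounded_mx_cst | exact: RcS_ae_bounded | exact: RS_ae_bounded].
    rewrite -ExD// -!ExZ//; last exact: ae_boundedD.
    apply: le_Ex; [exact: ae_boundedZ | by apply: ae_boundedZ; exact: ae_boundedD |].
    by apply: aeW => y; exact: hm.
  have ht : (m - k) * (t * n1 a' + t * n2 b') <= (m - k) * (fro a' + fro b').
    by rewrite ler_wpM2l// lerD.
  apply: le_trans (lerD hz hE) _.
  move: ht; generalize (n1 a') (n2 b') (fro a') (fro b') => x1 x2 x3 x4 ht.
  rewrite -subr_ge0; rewrite -subr_ge0 in ht; apply: le_trans ht _.
  by rewrite le_eqVlt; apply/orP; left; apply/eqP; ring.
- by rewrite lerDl addr_ge0 ?fro_ge0.
move=> a' b'; have hb : op_le (W1 - W2) (1 + fro (W1 - W2)).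
  apply: op_le_fro; first by rewrite addr_ge0 ?fro_ge0.
  by rewrite sqrrD expr1n mul1r; have := fro_ge0 (W1 - W2); have := sqr_ge0 (fro (W1 - W2)); lra.
apply: le_trans (hb _ _) _.
apply: le_trans (_ : (1 + fro (W1 - W2)) * (n1 a' + n2 b') <= _).
  by rewrite ler_wpM2l ?addr_ge0 ?fro_ge0// lerD.
by rewrite ler_wpM2r ?addr_ge0// lerDr.
Qed.

(** The Lipschitz bound at distance zero. Uniqueness is what makes W symmetric in [sol_sym]. *)
Lemma sol_uniq z W1 W2 : 0 < complex.Im z -> is_sol z W1 -> is_sol z W2 -> W1 = W2.
Proof.
move=> z0 s1 s2; apply/eqP; rewrite -subr_eq0; apply/eqP; apply: fro_eq0.
have hb a b : 2 * rform (W1 - W2) a b <= 0.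
  have := @sol_lipschitz z z W1 W2 0 a b z0 z0 s1 s2 (lexx _).
  by rewrite mul0r; apply => a' b'; rewrite subrr raddf0 rform0m mulr0 mul0r.
apply: le_anti; rewrite fro_ge0 andbT fro_col_sum; apply: sumr_le0 => j _.
by rewrite -rform1 rform1_mulr; have := hb ((W1 - W2) *m delta_mx j 0) (delta_mx j 0); lra.
Qed.

End Solutions.

Lemma sum2_const {R : realType} p (c : R) :
  \sum_(i < p) \sum_(j < p) c = p%:R * (p%:R * c).
Proof. by rewrite !sumr_const !card_ord !mulr_natl. Qed.

(** * Real matrices inside complex ones; an induction along a segment *)

Section RealMatrices.
Context {R : realType} {p : nat}.

Lemma complex_mx_sym (A : 'M[R]_p) : A^T = A -> ct (complex_mx A) = complex_mx A.
Proof.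
move=> hA; apply/matrixP => i j; rewrite ctE !mxE conj_real.
by rewrite -[in LHS]hA mxE.
Qed.

Lemma fro_complex_mx (A : 'M[R]_p) : fro (complex_mx A) = \sum_i \sum_j A i j ^+ 2.
Proof. by apply: eq_bigr => i _; apply: eq_bigr => j _; rewrite mxE sqc_real. Qed.

Lemma op_norm_fro (A : 'M[R]_p) (C : R) : 0 <= C -> op_norm A <= C ->
  fro (complex_mx A) <= p%:R * (p%:R * C ^+ 2).
Proof.
(* The supremum in [op_norm] dominates its set only once that set is known to be bounded, hence this
   crude bound. Basis vectors then give |A i j| <= C, and the p^2 entries give the constant. *)
move=> C0 hA; have ub : has_ubound
    [set eucl_norm (A *m v) | v in [set v : 'cV[R]_p | eucl_norm v <= 1]].
  exists (Num.sqrt (\sum_i (\sum_j `|A i j|) ^+ 2)) => _ [v /= v1 <-].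
  apply: ler_wsqrtr; apply: ler_sum => i _.
  rewrite -[leLHS]real_normK ?num_real// ler_sqr ?nnegrE ?sumr_ge0//.
  rewrite mxE; apply: le_trans (ler_norm_sum _ _ _) _; apply: ler_sum => j _.
  rewrite normrM ler_piMr//; apply: le_trans v1.
  rewrite -sqrtr_sqr /eucl_norm; apply: ler_wsqrtr.
  by rewrite (bigD1 j)//= lerDl sumr_ge0// => k _; exact: sqr_ge0.
have entry i j : A i j ^+ 2 <= C ^+ 2.
  have e1 : eucl_norm (delta_mx j 0 : 'cV[R]_p) <= 1.
    rewrite /eucl_norm (bigD1 j)//= mxE !eqxx /= expr1n big1 ?addr0 ?sqrtr1// => k kj.
    by rewrite mxE (negbTE kj) expr0n.
  have : eucl_norm (A *m (delta_mx j 0 : 'cV[R]_p)) <= C.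
    apply: le_trans hA; apply: ub_le_sup => //; by exists (delta_mx j 0).
  move=> h; have {h} : eucl_norm (A *m (delta_mx j 0 : 'cV[R]_p)) ^+ 2 <= C ^+ 2.
    by rewrite ler_sqr ?nnegrE ?sqrtr_ge0.
  rewrite /eucl_norm sqr_sqrtr; last by apply: sumr_ge0 => k _; exact: sqr_ge0.
  apply: le_trans; rewrite (bigD1 i)//= -colE mxE lerDl.
  by apply: sumr_ge0 => k _; exact: sqr_ge0.
rewrite fro_complex_mx.
apply: le_trans (_ : \sum_(i < p) \sum_(j < p) C ^+ 2 <= _).
  by apply: ler_sum => i _; apply: ler_sum => j _.
by rewrite sum2_const.
Qed.

Lemma complex_mx_ae_bounded {d} {Y : measurableType d} (law : probability Y R)
    (T : Y -> 'M[R]_p) (C alpha : R) : 0 <= C ->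
  (forall i j, measurable_fun [set: Y] (fun y => T y i j)) ->
  {ae law, forall y, op_norm (T y) <= C} ->
  ae_bounded_mx law (fun y => complex_mx (alpha *: T y)).
Proof.
move=> C0 mT hT; split.
  move=> i j; split; under eq_fun do rewrite !mxE /=.
    by apply: measurable_funM => //; exact: measurable_cst.
  exact: measurable_cst.
exists (alpha ^+ 2 * (p%:R * (p%:R * C ^+ 2))); apply: filterS hT => y hy.
have -> : complex_mx (alpha *: T y) = alpha%:C%C *: complex_mx (T y).
  by apply/matrixP => i j; rewrite !mxE rmorphM.
by rewrite froZ sqc_real ler_wpM2l ?sqr_ge0// op_norm_fro.
Qed.

End RealMatrices.

(** Connectedness of [0, 1]: P is open and closed along the segment, and the supremum of the t such
    that P holds on all of [0, t] must be 1. *)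
Lemma segment_induction {R : realType} (P : R -> Prop) : P 0 ->
  (forall t, 0 <= t <= 1 -> P t ->
     exists2 e, 0 < e & forall s, 0 <= s <= 1 -> `|s - t| < e -> P s) ->
  (forall t, 0 <= t <= 1 ->
     (forall e, 0 < e -> exists s, [/\ 0 <= s <= 1, `|s - t| < e & P s]) -> P t) ->
  P 1.
Proof.
move=> P0 Pop Pcl.
pose S := [set t | 0 <= t <= 1 /\ forall s, 0 <= s <= t -> P s]; pose m := sup S.
have S0 : S 0.
  split; first by rewrite lexx ler01.
  by move=> s s0; have -> : s = 0 by apply/eqP; rewrite eq_le andbC.
have supS : has_sup S by split; [exists 0 | exists 1 => t [/andP[]]].
have m0 : 0 <= m by apply: ub_le_sup => //; case: supS.
have m1 : m <= 1 by apply: ge_sup; [exists 0 | move=> t [/andP[]]].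
have m01 : 0 <= m <= 1 by rewrite m0.
have Plt s : 0 <= s < m -> P s.
  move=> /andP[s0 sm]; have e0 : 0 < m - s by rewrite subr_gt0.
  have [t [_ ht] st] := sup_adherent e0 supS.
  by apply: ht; rewrite s0 ltW//; move: st; rewrite opprB addrC subrK.
have Pm : P m.
  apply: Pcl => // e e0; move: m0; rewrite le_eqVlt => /orP[/eqP <-|m0].
    by exists 0; split => //; rewrite ?lexx ?ler01// subrr normr0.
  exists (Num.max 0 (m - e / 2)); have h : Num.max 0 (m - e / 2) < m.
    by rewrite gt_max m0/=; lra.
  split.
  - by rewrite le_max lexx /= ltW// (lt_le_trans h).
  - rewrite ltr0_norm ?subr_lt0// opprB.
    by apply: le_lt_trans (_ : e / 2 < e); [rewrite lerBlDr -lerBlDl le_max lexx orbT | lra].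
  - by apply: Plt; rewrite h le_max lexx.
have [e e0 he] := Pop m m01 Pm.
have Ple s : 0 <= s <= Num.min 1 (m + e / 2) -> P s.
  rewrite le_min => /and3P[s0 s1 sm].
  have [sltm|mles] := ltP s m; first by apply: Plt; rewrite s0.
  by apply: he; rewrite ?s0// ger0_norm ?subr_ge0//; lra.
have [m1E|lt1] := eqVneq m 1; first by rewrite -m1E.
have : Num.min 1 (m + e / 2) <= m.
  apply: ub_le_sup; first by case: supS.
  have me : 0 <= m + e / 2 by rewrite addr_ge0// divr_ge0// ltW.
  by split => //; rewrite le_min ge_min lexx ler01 me.
rewrite ge_min => /orP[]; last by move: e0; lra.
by move=> h; move: lt1; rewrite eq_le h m1.
Qed.

(** * From M to a solution W = - M^-1 on the whole upper half-plane *)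

Section FixedPointSolution.
Context {R : realType} {d} {Y : measurableType d} {p : nat}.
Variables (law : probability Y R) (alpha : R) (alpha_gt0 : 0 < alpha).
Variable T : Y -> 'M[R]_p.
Hypothesis T_sym : forall y, (T y)^T = T y.
Let S y := complex_mx (alpha^-1 *: T y).
Hypothesis S_ae_bounded : ae_bounded_mx law S.

Lemma scaled_mx_herm y : ct (S y) = S y.
Proof. by apply: complex_mx_sym; rewrite linearZ /= T_sym. Qed.

Variable M : R[i] -> 'M[R[i]]_p.
Hypothesis hM : is_M_alpha alpha law T M.

Let W z := - invmx (M z).

Lemma sqrt_normc (x : R[i]) : `|x| = (Num.sqrt (sqc x))%:C%C.
Proof. exact: normc_def. Qed.

Lemma normc_lt (x : R[i]) (e : R) : 0 < e -> (`|x| < e%:C%C) = (sqc x < e ^+ 2).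
Proof.
move=> e0; rewrite sqrt_normc ltcR -[in LHS](gtr0_norm e0) -sqrtr_sqr.
by rewrite ltr_sqrt// exprn_gt0.
Qed.

Lemma M_continuous z : upper_half_plane z -> forall e, 0 < e ->
  exists2 k, 0 < k & forall w, sqc (w - z) < k -> fro (M w - M z) <= e.
Proof.
move=> hz e e0; have [hA _ _ _] := hM.
have e'0 : 0 < e / (1 + p%:R * p%:R) by rewrite divr_gt0// ltr_pwDl// mulr_ge0.
set e' := e / _ in e'0.
have FF : Filter (nbhs (z : R[i]^o)) by exact: nbhs_filter.
have near_all : nbhs (z : R[i]^o) [set w | forall i j, sqc (M w i j - M z i j) < e'].
  apply: (@filter_forall _ _ (fun i w => forall j, sqc (M w i j - M z i j) < e') _ FF) => i.
  apply: (@filter_forall _ _ (fun j w => sqc (M w i j - M z i j) < e') _ FF) => j.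
  have /derivable1_diffP/differentiable_continuous := hA i j z hz.
  move=> /cvgrPdist_lt /(_ (Num.sqrt e')%:C%C).
  rewrite ltcR sqrtr_gt0 => /(_ e'0); apply: filterS => w.
  rewrite normc_lt ?sqrtr_gt0// sqr_sqrtr; last exact: ltW.
  by rewrite -opprB sqcN.
have /nbhs_ballP[k /= k0 hk] := near_all.
have kR : k = (complex.Re k)%:C%C by rewrite RRe_real// gtr0_real.
have k0' : 0 < complex.Re k by move: k0; rewrite kR ltcR.
exists (complex.Re k ^+ 2); first by rewrite exprn_gt0.
move=> w hw; have /hk hwij : ball (z : R[i]^o) k w.
  by rewrite -ball_normE /= kR normc_lt// -opprB sqcN.
rewrite /fro; apply: le_trans (_ : \sum_(i < p) \sum_(j < p) e' <= _).
  by apply: ler_sum => i _; apply: ler_sum => j _; rewrite !mxE; exact: ltW.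
rewrite sum2_const mulrA /e' mulrCA ler_piMr ?ltW//.
by rewrite ltr_pdivrMr ?mul1r ?ltrDr// ltr_pwDl// mulr_ge0.
Qed.

(** The normalization at infinity says M(i eta) = (i / eta)(1 - Z) with Z small, so Im M(i eta) >= 1
    / (2 eta) for large eta. This is the starting point of the continuation in [M_imdef]. *)
Lemma M_imdef_exists : exists2 eta, 0 < eta & im_posdef (M (0 +i* eta)%C).
Proof.
have [_ _ hlim _] := hM.
have e0 : 0 < (2 * (1 + p%:R))^-1 :> R by rewrite invr_gt0 mulr_gt0// ltr_pwDl.
set e := _^-1 in e0.
pose F i j (eta : R) :=
  sqc ((0 +i* eta)%C * M (0 +i* eta)%C i j + (1%:M : 'M[R[i]]_p) i j) < e ^+ 2.
have FF : Filter (pinfty_nbhs R) by exact: _.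
have near_all : pinfty_nbhs R [set eta | forall i j, F i j eta].
  apply: (@filter_forall _ _ (fun i eta => forall j, F i j eta) _ FF) => i.
  apply: (@filter_forall _ _ (fun j eta => F i j eta) _ FF) => j.
  have := hlim i j; move=> /cvgrPdist_lt /(_ e%:C%C).
  rewrite ltcR => /(_ e0); apply: filterS => eta.
  by rewrite normc_lt// mxE -opprD sqcN addrC.
move: near_all => [m [_ hm]].
have [m1 m1m m10] : exists2 eta : R, m < eta & 0 < eta.
  by exists (1 + `|m|); [have := ler_norm m; lra | rewrite ltr_pwDl].
exists m1 => //; have {}hm := hm m1 m1m.
set X := M _ in hm *.
pose Z := (0 +i* m1)%C *: X + 1%:M.
have hZ : op_le Z 2^-1.
  apply: op_le_fro => //.
  apply: le_trans (_ : \sum_(i < p) \sum_(j < p) e ^+ 2 <= _).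
    apply: ler_sum => i _; apply: ler_sum => j _; rewrite !mxE.
    by have := hm i j; rewrite /F -/X !mxE => /ltW.
  rewrite sum2_const mulrA -expr2 -exprMn ler_sqr ?nnegrE//.
    rewrite /e invfM mulrCA ger_pMr// ler_pdivrMr ?mul1r ?ltr_pwDl//.
    by rewrite lerDr.
  by apply: mulr_ge0 => //; exact: ltW.
exists (m1^-1 * 2^-1); first by rewrite mulr_gt0 ?invr_gt0.
move=> u; have -> : iform X u u = m1^-1 * rform (1%:M - Z) u u.
  rewrite /Z opprD addrCA subrr addr0 rformNm /iform /rform -!scalemxAr -scalemxAl.
  rewrite [in LHS]mxE [in RHS]mxE ReM ReM /=; set a := complex.Re _; set b := complex.Im _.
  by field; rewrite gt_eqF.
rewrite -mulrA ler_pM2l ?invr_gt0// rformBm rform1.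
by have := op_le_rform u hZ; lra.
Qed.

Lemma M_sol z : upper_half_plane z -> im_posdef (M z) -> is_sol law alpha S z (W z).
Proof.
move=> hz [c c0 hc]; have [_ _ _ /(_ z hz)[uM eqM]] := hM.
have hW : im_posdef (W z).
  (* Im W is the congruence of Im M by M^-1, and |u| <= |M| |M^-1 u| bounds |M^-1 u| from below. *)
  exists (c * (1 + fro (M z))^-1).
    by rewrite mulr_gt0// invr_gt0 ltr_pwDl ?fro_ge0.
  move=> u; rewrite /W iformNm iform_inv// opprK; apply: le_trans (hc _).
  rewrite -mulrA ler_pM2l// ler_pdivrMl ?ltr_pwDl ?fro_ge0//.
  rewrite -{1}[u]mul1mx -(mulmxV uM) -mulmxA; apply: le_trans (fro_mulmx_le _ _) _.
  by rewrite ler_wpM2r ?fro_ge0// lerDr.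
split => //.
(* From 1 + M T / alpha = - M (W - S) the inverse is R W, and S R W = S R (W - S) + S R S = S + S R
   S. *)
have Q y : complex_mx (T y) *m invmx (1%:M + (alpha^-1)%:C%C *: (M z *m complex_mx (T y)))
    = alpha%:C%C *: self_energy S (W z) y.
  have a0 : (alpha%:C%C : R[i]) != 0 by rewrite eq_complex /= gt_eqF.
  have TS : complex_mx (T y) = alpha%:C%C *: S y.
    by apply/matrixP => i j; rewrite !mxE -rmorphM /= mulrA mulfV ?mul1r// gt_eqF.
  have uA := imdef_unit scaled_mx_herm y hW.
  have -> : 1%:M + (alpha^-1)%:C%C *: (M z *m complex_mx (T y)) = - (M z *m (W z - S y)).
    rewrite TS -scalemxAr scalerA fmorphV /= mulVf// scale1r.
    by rewrite mulmxBr /W mulmxN mulmxV// opprB addrC opprK.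
  have -> : invmx (- (M z *m (W z - S y))) = resolvent S (W z) y *m W z.
    have u2 : - (M z *m (W z - S y)) \in unitmx.
      by rewrite -scaleN1r unitmxZ ?unitrN ?unitr1// unitmx_mul uM.
    rewrite -[LHS]mulmx1 -[RHS](mulKmx u2); congr (_ *m _).
    rewrite mulNmx -mulmxA /resolvent mulKVmx// /W mulmxN opprK mulmxV//.
  rewrite TS -scalemxAl; congr (_ *: _); rewrite /self_energy.
  rewrite -{2}[W z](subrK (S y)) mulmxDr /resolvent mulVmx// mulmxDr mulmx1.
  by rewrite mulmxA.
rewrite {1}/W eqM opprD opprK; congr (_ - _).
have -> : (fun y => complex_mx (T y) *m
  invmx (1%:M + (alpha^-1)%:C%C *: (M z *m complex_mx (T y)))) =
  (fun y => alpha%:C%C *: self_energy S (W z) y) by apply/funext.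
have mQ := self_energy_ae_bounded scaled_mx_herm S_ae_bounded hW.
by rewrite E_CmxZ.
Qed.

Lemma iform_W z u : upper_half_plane z ->
  iform (M z) u u = iform (W z) (ct (M z) *m u) (ct (M z) *m u).
Proof.
move=> hz; have [_ _ _ /(_ z hz)[uM _]] := hM.
have uV : invmx (M z) \in unitmx by rewrite unitmx_inv.
by rewrite -{1}[M z]invmxK (iform_inv_ct u uV) invmxK /W iformNm.
Qed.

Lemma M_iform_ge z u : upper_half_plane z -> im_posdef (M z) ->
  complex.Im z * fro (ct (M z) *m u) <= iform (M z) u u.
Proof.
move=> hz hi; rewrite iform_W//.
by apply: (sol_iform_ge alpha_gt0 scaled_mx_herm S_ae_bounded); exact: M_sol.
Qed.

Lemma fro_ct_ge z (u : 'cV[R[i]]_p) : upper_half_plane z ->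
  fro u <= (1 + fro (invmx (M z))) * fro (ct (M z) *m u).
Proof.
move=> hz; have [_ _ _ /(_ z hz)[uM _]] := hM.
rewrite -{1}[u]mul1mx -ct1 -(mulmxV uM) ctM -mulmxA.
apply: le_trans (fro_mulmx_le _ _) _.
by rewrite fro_ct ler_wpM2r ?fro_ge0// lerDr.
Qed.

Let half_arith (c f a b : R) : c * f <= b -> - (a - b) <= c / 2 * f -> c / 2 * f <= a.
Proof. lra. Qed.

Let quarter_arith (k f a b q : R) : k * f <= a -> a <= 2 * b + 2 * q ->
  q <= k / 4 * f -> k / 4 * f <= b.
Proof. lra. Qed.

Let closing_arith (e h k f a b q : R) : a - b <= e * f -> q <= a ->
  h * (k / 4 * f) <= q -> e * f <= h * k / 8 * f -> h * k / 8 * f <= b.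
Proof. lra. Qed.

(* The set where Im M is positive definite is closed because there
   Im M >= (Im z) M M^*, a bound that survives limits and is definite since M is
   invertible; no maximum principle is needed. *)
Lemma M_imdef z : upper_half_plane z -> im_posdef (M z).
Proof.
move=> hz; have [eta eta0 him] := M_imdef_exists.
pose zt t : R[i] := ((t * complex.Re z) +i* ((1 - t) * eta + t * complex.Im z))%C.
have zt0 : zt 0 = (0 +i* eta)%C by rewrite /zt !mul0r subr0 mul1r addr0.
have zt1 : zt 1 = z.
  by apply: complex_ext; rewrite /zt /= ?mul1r ?subrr ?mul0r ?add0r.
have ztup t : 0 <= t <= 1 -> upper_half_plane (zt t).
  move=> /andP[t0 t1]; rewrite /upper_half_plane /zt /=.
  have [->|tN0] := eqVneq t 0; first by rewrite mul0r addr0 subr0 mul1r.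
  by rewrite ltr_wpDl ?mulr_ge0 ?mulr_gt0 ?subr_ge0 ?(ltW eta0)// lt_def tN0.
have ztc s t : sqc (zt s - zt t) =
    (s - t) ^+ 2 * (complex.Re z ^+ 2 + (complex.Im z - eta) ^+ 2).
  by rewrite /sqc ReD ImD ReN ImN /zt /=; ring.
have ztcont t : 0 <= t <= 1 -> forall e, 0 < e ->
    exists2 k, 0 < k & forall s, `|s - t| < k -> fro (M (zt s) - M (zt t)) <= e.
  move=> ht e e0; have [k k0 hk] := M_continuous (ztup t ht) e0.
  set L := complex.Re z ^+ 2 + (complex.Im z - eta) ^+ 2 in ztc.
  have L0 : 0 < 1 + L by rewrite ltr_pwDl// addr_ge0 ?sqr_ge0.
  exists (Num.sqrt (k / (1 + L))); first by rewrite sqrtr_gt0 divr_gt0.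
  move=> s; rewrite -sqrtr_sqr ltr_sqrt ?divr_gt0// ltr_pdivlMr// => h.
  apply: hk; rewrite ztc; apply: le_lt_trans h; rewrite ler_wpM2l ?sqr_ge0//.
  by rewrite lerDr.
rewrite -zt1; apply: (segment_induction (P := fun t => im_posdef (M (zt t)))).
- by rewrite zt0.
- move=> t ht [c c0 hc]; have [|k k0 hk] := ztcont t ht ((c / 2) ^+ 2).
    by rewrite exprn_gt0// divr_gt0.
  exists k; first exact: k0.
  move=> s hs /hk hst; exists (c / 2); first exact: divr_gt0.
  move=> u; have hb : op_le (M (zt s) - M (zt t)) (c / 2).
    by apply: op_le_fro => //; rewrite divr_ge0// ltW.
  have := op_le_iform u (op_leN hb); rewrite iformNm iformBm.
  exact: half_arith (hc u).
- move=> t ht hcl; have hzt := ztup t ht.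
  pose h := Num.min eta (complex.Im z).
  have h0 : 0 < h by rewrite lt_min eta0.
  have hh s : 0 <= s <= 1 -> h <= complex.Im (zt s).
    move=> /andP[s0 s1]; rewrite /zt /=.
    have a1 : h <= eta by rewrite ge_min lexx.
    have a2 : h <= complex.Im z by rewrite ge_min lexx orbT.
    have b1 : 0 <= (1 - s) * (eta - h) by rewrite mulr_ge0 ?subr_ge0.
    have b2 : 0 <= s * (complex.Im z - h) by rewrite mulr_ge0 ?subr_ge0.
    by rewrite -subr_ge0; have := addr_ge0 b1 b2; congr (0 <= _); ring.
  pose ka := (1 + fro (invmx (M (zt t))))^-1.
  have ka0 : 0 < ka by rewrite invr_gt0 ltr_pwDl ?fro_ge0.
  (* Room for two losses: e^2 <= ka / 4 when |M^* u|^2 passes from the limit point to the nearby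
     point, and e <= h ka / 8 when Im M passes back. The 1 ensures e^2 <= e. *)
  pose e := Num.min 1 (Num.min (ka / 4) (h * ka / 8)).
  have hka0 : 0 < h * ka by exact: mulr_gt0.
  have e0 : 0 < e by rewrite !lt_min ltr01 (divr_gt0 ka0)// (divr_gt0 hka0).
  have e1 : e <= 1 by rewrite ge_min lexx.
  have e2 : e <= ka / 4 by rewrite !ge_min lexx orbT.
  have e3 : e <= h * ka / 8 by rewrite !ge_min lexx !orbT.
  have [|k k0 hk] := ztcont t ht (e ^+ 2); first by rewrite exprn_gt0.
  have [s [hs /hk hst his]] := hcl k k0.
  exists (h * ka / 8); first by rewrite (divr_gt0 hka0).
  move=> u; set D := M (zt s) - M (zt t) in hst.
  have hb : op_le D e by apply: op_le_fro => //; exact: ltW.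
  have i1 := op_le_iform u hb; rewrite /D iformBm in i1.
  have i2 := M_iform_ge u (ztup s hs) his.
  have i3 : ka * fro u <= fro (ct (M (zt t)) *m u).
    by rewrite ler_pdivrMl ?ltr_pwDl ?fro_ge0//; exact: fro_ct_ge.
  have i4 : fro (ct (M (zt t)) *m u) <= 2 * fro (ct (M (zt s)) *m u) + 2 * (e ^+ 2 * fro u).
    have -> : M (zt t) = M (zt s) - D by rewrite opprB addrCA subrr addr0.
    rewrite ctB mulmxBl; apply: le_trans (froD_le _ _) _; rewrite froN lerD2l ler_pM2l//.
    by apply: op_le_mulmx; [exact: ltW | exact: op_le_ct].
  have e4 : e ^+ 2 <= ka / 4.
    by apply: le_trans e2; rewrite expr2 ler_piMr// ltW.
  have i5 : (ka / 4) * fro u <= fro (ct (M (zt s)) *m u).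
    have e5 : e ^+ 2 * fro u <= ka / 4 * fro u by rewrite ler_wpM2r ?fro_ge0.
    exact: quarter_arith i3 i4 e5.
  have i6 : h * ((ka / 4) * fro u) <= complex.Im (zt s) * fro (ct (M (zt s)) *m u).
    by apply: ler_pM => //; [exact: ltW | rewrite !mulr_ge0 ?fro_ge0 ?ltW | exact: hh].
  have i7 : e * fro u <= h * ka / 8 * fro u by rewrite ler_wpM2r ?fro_ge0.
  exact: closing_arith i1 i2 i6 i7.
Qed.

Lemma M_is_sol z : upper_half_plane z -> is_sol law alpha S z (W z).
Proof. by move=> hz; apply: M_sol => //; exact: M_imdef. Qed.

End FixedPointSolution.

(** * Comparison of W with a dual point: the upper bound *)

Section Comparison.
Context {R : realType} {d} {Y : measurableType d} {p : nat}.
Variables (law : probability Y R) (alpha : R) (alpha_gt0 : 0 < alpha).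
Variable S : Y -> 'M[R[i]]_p.
Hypotheses (S_herm : forall y, ct (S y) = S y) (S_ae_bounded : ae_bounded_mx law S).

Lemma coercive_real_unit (A : 'M[R[i]]_p) e : 0 < e ->
  (forall u, e * fro u <= rform A u u) -> A \in unitmx.
Proof.
move=> e0 h; apply: (coercive_unit (k := 1) (c := e)) => // u.
by rewrite scale1r.
Qed.

(** With v = A^-1 w, expand the nonnegative form of A0^-1 at w - A0 v and use Re w^* v = Re v^* A v.
    Only A0 has to be Hermitian, so A may be the complex matrix W - S. *)
Lemma resolvent_convex (A A0 : 'M[R[i]]_p) w : A \in unitmx -> A0 \in unitmx ->
  ct A0 = A0 -> (forall u, 0 <= rform A0 u u) ->
  rform (A - A0) (invmx A *m w) (invmx A *m w) <= rform (invmx A0 - invmx A) w w.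
Proof.
have aux (a b c : R) : 0 <= a - b + (- b - - c) -> b - c <= a - b by lra.
move=> uA uA0 hA0 pA0; set v := invmx A *m w.
have h0 : 0 <= rform (invmx A0) (w - A0 *m v) (w - A0 *m v).
  by rewrite rform_inv.
have e1 : rform (invmx A0) w (A0 *m v) = rform 1%:M w v.
  by rewrite -rform_mulr mulVmx.
have e2 : rform (invmx A0) (A0 *m v) w = rform 1%:M w v.
  by rewrite -rform_mull hA0 mulmxV// rform1C.
have e3 : rform (invmx A0) (A0 *m v) (A0 *m v) = rform A0 v v.
  by rewrite -rform_mull hA0 mulmxV// rform1_mulr.
have e4 : rform (invmx A) w w = rform 1%:M w v by rewrite /v rform1_mulr.
have e5 : rform A v v = rform (invmx A) w w by rewrite -rform_inv.
rewrite rformDl !rformDr !rformNl !rformNr e1 e2 e3 in h0.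
by rewrite !rformBm e5 e4; exact: aux.
Qed.

(* [Phi W = z] is the equation of [is_sol], and [Phi Z^-1] is G(Z), see [mx_G_Phi]. *)
Definition Phi (W : 'M[R[i]]_p) := W + alpha%:C%C *: E_Cmx law (self_energy S W).

(** For W = Z^-1 this is the essential infimum condition of the dual domain, with an explicit margin
    e that bounds the resolvent. *)
Definition re_posdef (W : 'M[R[i]]_p) e : Prop :=
  {ae law, forall y, forall u, e * fro u <= rform (W - S y) u u}.

Lemma redef_ae_bounded W e : 0 < e -> re_posdef W e -> ae_bounded_mx law (resolvent S W).
Proof.
move=> e0 h; apply: (ae_bounded_mx_inv (k := 1) (c := e)) => //; first exact: ae_bounded_mx_A.
  by rewrite sqc_real expr1n.
by apply: filterS h => y hy u; rewrite scale1r.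
Qed.

Lemma redef_self_energy_ae_bounded W e : 0 < e -> re_posdef W e -> ae_bounded_mx law (self_energy S W).
Proof.
move=> e0 h; apply: ae_bounded_mxD => //; apply: ae_bounded_mxM => //; apply: ae_bounded_mxM => //.
exact: redef_ae_bounded e0 h.
Qed.

(* D = Re W - W0 - dl n satisfies D >= alpha E[S R^* D R S] by [resolvent_convex];
   adding the least multiple m n that makes D nonnegative, n = 1 + alpha E[S R^* n R S]
   forces m = 0. *)
Lemma sol_compare z W W0 e dl : 0 < complex.Im z -> is_sol law alpha S z W ->
  ct W0 = W0 -> 0 < e -> re_posdef W0 e -> 0 <= dl ->
  (forall u, rform (Phi W0) u u <= (complex.Re z - dl) * fro u) ->
  forall u, dl * (iform W u u / complex.Im z) <= rform (W - W0) u u.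
Proof.
set eta := complex.Im z => eta0 hs hW0 e0 hA0 dl0 hPhi.
have [hW _] := hs.
have mQ0 := redef_self_energy_ae_bounded e0 hA0; have mQ := self_energy_ae_bounded S_herm S_ae_bounded hW.
pose n u := iform W u u / eta.
pose D u := rform (W - W0) u u - dl * n u.
pose v (u : 'cV[R[i]]_p) y := resolvent S W y *m (S y *m u).
have n_ge u : fro u <= n u.
  by rewrite ler_pdivlMr// mulrC; exact: (sol_iform_ge alpha_gt0 S_herm S_ae_bounded).
have n0 u : 0 <= n u := le_trans (fro_ge0 u) (n_ge u).
have mn u : ae_bounded law (fun y => n (v u y)).
  have := ae_boundedZ (eta^-1) (iform_ae_bounded W (RS_ae_bounded S_herm S_ae_bounded u hW)).
  by congr ae_bounded; apply/funext => y; rewrite mulrC.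
have md u : ae_bounded law (fun y => rform (W - W0) (v u y) (v u y)).
  by apply: ae_bounded_vec; [exact: ae_bounded_mx_cst | exact: RS_ae_bounded | exact: RS_ae_bounded].
have nE u : n u = fro u + alpha * Ex law (fun y => n (v u y)).
  rewrite {1}/n (sol_iform S_herm S_ae_bounded _ hs) mulrDl [eta * _]mulrC mulfK ?gt_eqF//.
  congr (_ + _); rewrite -mulrA; congr (_ * _); rewrite mulrC -ExZ.
    by congr Ex; apply/funext => y; rewrite mulrC.
  by apply: iform_ae_bounded; exact: RS_ae_bounded.
have dE u : dl * fro u + alpha * Ex law (fun y => rform (W - W0) (v u y) (v u y))
    <= rform (W - W0) u u.
  have aux (E01 E0 E1 x f w0 : R) : w0 + alpha * E0 <= (x - dl) * f ->
      alpha * E01 <= alpha * (E0 - E1) ->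
      dl * f + alpha * E01 <= x * f - alpha * E1 - w0 by lra.
  rewrite rformBm (sol_rform S_herm S_ae_bounded _ _ hs) rform_scalar.
  have := hPhi u; rewrite /Phi rformDm rformZm (rform_E _ _ mQ0).
  move=> /aux; apply; rewrite ler_pM2l//.
  have m0 := ae_bounded_mx_rform u u mQ0; have m1 := ae_bounded_mx_rform u u mQ.
  rewrite -ExB//; apply: le_Ex => //; first exact: ae_boundedB.
    apply: filterS hA0 => y hy.
    rewrite -rformBm /self_energy opprD addrACA subrr add0r [leRHS]rformBm !(SRSl S_herm) -[leRHS]rformBm.
    have -> : W - W0 = (W - S y) - (W0 - S y) by rewrite opprB addrA subrK.
    apply: resolvent_convex.
    - exact: imdef_unit.
    - exact: coercive_real_unit e0 hy.
    - by rewrite ctB hW0 S_herm.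
    - by move=> u'; apply: le_trans (hy u'); apply: mulr_ge0; rewrite ?fro_ge0// ltW.
have DE u : alpha * Ex law (fun y => D (v u y)) <= D u.
  rewrite /D ExB//; last exact: ae_boundedZ.
  have aux (E1 E2 f w : R) : dl * f + alpha * E1 <= w ->
      alpha * (E1 - dl * E2) <= w - dl * (f + alpha * E2) by lra.
  by rewrite ExZ// (nE u); exact: aux (dE u).
pose P m := forall u, 0 <= D u + m * n u.
suff P0 : P 0 by move=> u; have := P0 u; rewrite mul0r addr0 subr_ge0.
have [c c0 hc] := iform_ub W.
pose t := Num.min 1 (eta / c).
have t0 : 0 < t by rewrite lt_min ltr01 divr_gt0.
have tn u : t * n u <= fro u.
  apply: le_trans (_ : eta / c * n u <= _).
    by rewrite ler_wpM2r// !ge_min lexx orbT.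
  rewrite /n mulrAC mulrCA mulrA ler_pdivrMr//.
  by rewrite mulfK ?gt_eqF// [leRHS]mulrC.
have fbW : op_le (W - W0) (1 + fro (W - W0)).
  apply: op_le_fro; first by rewrite addr_ge0 ?fro_ge0.
  rewrite sqrrD expr1n mul1r; have := fro_ge0 (W - W0).
  by have := sqr_ge0 (fro (W - W0)); generalize (fro (W - W0)) => k; lra.
(* The initial m pays for both parts of D: 1 + |W - W0|^2 dominates the operator norm of W - W0,
   [dl] dominates the subtracted multiple of n, and n(u) >= |u|^2. *)
apply: (@contraction_limit _ P 0 t (1 + fro (W - W0) + dl)).
- move=> m m' mm' hm u; apply: le_trans (hm u) _.
  by rewrite lerD2l ler_wpM2r.
- move=> m hm u; apply/ler_addgt0Pr => x x0.
  have s0 : 0 < 1 + n u by rewrite ltr_pwDl.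
  have := hm _ (divr_gt0 x0 s0) u; move/le_trans; apply.
  rewrite mulrDl addrA lerD2l mulrAC ler_pdivrMr// ler_wpM2l ?ltW//.
  by rewrite ltrDr.
- by rewrite t0 ge_min lexx.
- move=> m m0 hm u; rewrite subr0.
  have hD : ae_bounded law (fun y => D (v u y)) by apply: ae_boundedB => //; exact: ae_boundedZ.
  have : 0 <= alpha * Ex law (fun y => D (v u y) + m * n (v u y)).
    apply: mulr_ge0; first exact: ltW.
    apply: Ex_ge0; first by apply: ae_boundedD => //; exact: ae_boundedZ.
    by apply: aeW => y; exact: hm.
  rewrite ExD// ?ExZ//; last exact: ae_boundedZ.
  have h1 : m * (t * n u) <= m * fro u by rewrite ler_wpM2l// ltW.
  have aux (E1 E2 Du f nu : R) : nu = f + alpha * E2 -> alpha * E1 <= Du ->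
      m * (t * nu) <= m * f -> 0 <= alpha * (E1 + m * E2) ->
      0 <= Du + (m - m * t) * nu.
    move=> nuE; have : m * nu = m * f + m * (alpha * E2) by rewrite nuE; ring.
    lra.
  exact: aux (nE u) (DE u) h1.
- by rewrite !addr_ge0 ?fro_ge0.
move=> u; have := op_le_rform u (op_leN fbW); rewrite rformNm => h1.
have h2 : (1 + fro (W - W0)) * fro u <= (1 + fro (W - W0)) * n u.
  by rewrite ler_wpM2l ?addr_ge0 ?fro_ge0.
rewrite /D; move: h1 h2; generalize (rform (W - W0) u u) ((1 + fro (W - W0)) * fro u).
by generalize (1 + fro (W - W0)) (n u) => k x y z' h1 h2; lra.
Qed.

(** As - W^-1 is M, this says Im M = O(Im z). With v = W^-1 w the comparison gives dl n(v) <= Re v^*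
    w - c |v|^2, and Young's inequality with weight c removes v. *)
Lemma sol_inv_iform_le z W W0 e dl c w : 0 < complex.Im z -> is_sol law alpha S z W ->
  ct W0 = W0 -> 0 < e -> re_posdef W0 e -> 0 < dl -> 0 < c ->
  (forall u, c * fro u <= rform W0 u u) ->
  (forall u, rform (Phi W0) u u <= (complex.Re z - dl) * fro u) ->
  iform (- invmx W) w w <= complex.Im z / (dl * c) * fro w.
Proof.
move=> eta0 hs hW0 e0 hA0 dl0 c0 hc hPhi; have [hW _] := hs.
have uW : W \in unitmx.
  case: hW => k k0 hk; exact: (coercive_unit (k := nI) (c := k)).
rewrite iformNm iform_inv// opprK; set v := invmx W *m w.
have h1 := sol_compare eta0 hs hW0 e0 hA0 (ltW dl0) hPhi v.
have h2 := hc v; rewrite rformBm in h1.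
have h3 : rform W v v = rform 1%:M v w.
  by rewrite /v rform1C -rform_inv// rform1_mulr.
have h4 : 2 * rform 1%:M v w <= c * fro v + c^-1 * fro w by exact: rform1_le.
have {h1 h2} h6 : dl * (iform W v v / complex.Im z) <= c^-1 * fro w.
  have ci : 0 <= c^-1 * fro w by rewrite mulr_ge0 ?fro_ge0// invr_ge0 ltW.
  have cv : 0 <= c * fro v by rewrite mulr_ge0 ?fro_ge0// ltW.
  move: h1 h2 h4 ci cv; rewrite h3.
  move: (rform W0 v v) (rform _ v w) (c * fro v) (c^-1 * fro w) (dl * _).
  by move=> a1 a2 a3 a4 a5; lra.
have -> : iform W v v = complex.Im z / dl * (dl * (iform W v v / complex.Im z)).
  by field; rewrite !gt_eqF.
have -> : complex.Im z / (dl * c) * fro w = complex.Im z / dl * (c^-1 * fro w).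
  by field; rewrite !gt_eqF.
by apply: ler_wpM2l h6; rewrite divr_ge0 ?ltW.
Qed.

End Comparison.

(** * Recovering the support of mu from Im Tr M *)

Section PoissonKernel.
Context {R : realType}.
Variable mu : probability (measurableTypeR R) R.

(** The imaginary part of 1 / (l - z) at z = x + i eta, that is pi times the Poisson kernel. *)
Definition poisson (x eta : R) (l : measurableTypeR R) : R :=
  eta / ((l - x) ^+ 2 + eta ^+ 2).

Lemma poisson_den_gt0 x eta (l : R) : 0 < eta -> 0 < (l - x) ^+ 2 + eta ^+ 2.
Proof. by move=> e0; rewrite ltr_wpDl ?sqr_ge0// exprn_gt0. Qed.

Lemma poisson_ge0 x eta l : 0 < eta -> 0 <= poisson x eta l.
Proof. by move=> e0; rewrite divr_ge0 ?ltW// poisson_den_gt0. Qed.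

Lemma poisson_le x eta l : 0 < eta -> poisson x eta l <= eta^-1.
Proof.
move=> e0; rewrite /poisson ler_pdivrMr ?poisson_den_gt0// mulrDr.
by rewrite [X in _ + X]mulrC exprS expr1 -mulrA mulfV ?gt_eqF// mulr1 lerDr
  mulr_ge0 ?sqr_ge0// invr_ge0 ltW.
Qed.

Lemma poisson_ae_bounded x eta : 0 < eta -> ae_bounded mu (poisson x eta).
Proof.
move=> e0; split; last first.
  by exists (eta^-1); apply: aeW => l; rewrite ger0_norm ?poisson_ge0// poisson_le.
apply: measurable_funM; first exact: measurable_cst.
apply: measurable_funV; apply: measurable_funD; last exact: measurable_cst.
by apply: measurable_funX; apply: measurable_funB; [exact: measurable_id | exact: measurable_cst].
Qed.

Lemma Im_stieltjes z : complex.Im (stieltjes mu z) =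
  Ex mu (poisson (complex.Re z) (complex.Im z)).
Proof.
rewrite /stieltjes /Cexpectation /= /Ex; congr Rintegral; apply/funext => l.
case: z => x eta; rewrite /poisson /= sub0r sqrrN.
by rewrite mulNr opprK.
Qed.

Lemma iform_delta n (X : 'M[R[i]]_n) i :
  iform X (delta_mx i 0) (delta_mx i 0) = complex.Im (X i i).
Proof.
rewrite /iform /rform -scalemxAr mxE.
have -> : (ct (delta_mx i 0) *m X *m delta_mx i 0 : 'M[R[i]]_1) 0 0 = X i i.
  rewrite -mulmxA -colE mxE (bigD1 i)//= ctE mxE !eqxx conjC1 mul1r mxE big1 ?addr0//.
  by move=> j ji; rewrite ctE mxE (negbTE ji) conjC0 mul0r.
by rewrite ReM /=; ring.
Qed.

Lemma Im_trace n (X : 'M[R[i]]_n) :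
  complex.Im (\tr X) = \sum_i iform X (delta_mx i 0) (delta_mx i 0).
Proof. by rewrite Im_sum; apply: eq_bigr => i _; rewrite iform_delta. Qed.

Lemma Im_trace_mu p (M : R[i] -> 'M[R[i]]_p) z : (0 < p)%N ->
  is_mu_alpha mu M -> upper_half_plane z ->
  complex.Im (\tr (M z)) = p%:R * Ex mu (poisson (complex.Re z) (complex.Im z)).
Proof.
move=> p0 [_ h] hz; rewrite -Im_stieltjes (h z hz).
have -> : (p%:R : R[i])^-1 = ((p%:R)^-1)%:C%C by rewrite fmorphV rmorph_nat.
by rewrite ImM /= mul0r addr0 mulrA mulfV ?mul1r// pnatr_eq0 -lt0n.
Qed.

(** The kernel is at least 1 / (2 eta) on the interval. Together with the factor eta of the
    hypothesis this makes the mass quadratic in the length, so that covers by short intervals have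
    vanishing total mass. *)
Lemma poisson_interval_le x eta K : 0 < eta -> Ex mu (poisson x eta) <= K * eta ->
  (mu `[(x - eta)%R, (x + eta)%R]%classic <= (2 * K * eta ^+ 2)%:E)%E.
Proof.
move=> e0 hK; set I := `[_, _]%classic.
have mI : measurable I by exact: measurable_itv.
have hI : ae_bounded mu (\1_I : measurableTypeR R -> R).
  split; first exact: measurable_indic.
  exists 1; apply: aeW => l; rewrite indicE; case: (_ \in _) => /=.
    by rewrite normr1.
  by rewrite normr0.
have : Ex mu (fun l => (2 * eta)^-1 * \1_I l) <= Ex mu (poisson x eta).
  apply: le_Ex; [exact: ae_boundedZ | exact: poisson_ae_bounded | apply: aeW => l].
  rewrite indicE; case: (boolP (l \in I)) => [|_]; last by rewrite mulr0 poisson_ge0.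
  rewrite inE /I /= in_itv /= => /andP[l1 l2].
  rewrite mulr1 /poisson ler_pdivlMr ?poisson_den_gt0// ler_pdivrMl ?mulr_gt0//.
  have : 0 <= (eta - (l - x)) * (eta + (l - x)).
    by apply: mulr_ge0; lra.
  by rewrite !expr2; lra.
rewrite ExZ// => h.
have hm : Ex mu \1_I = fine (mu I).
  by rewrite /Ex /Rintegral integral_indic// setIT.
have fm : mu I \is a fin_num by exact: fin_num_measure.
rewrite -(fineK fm) lee_fin -hm.
have {}h := le_trans h hK; rewrite ler_pdivrMl ?mulr_gt0// in h.
by move/le_trans: h; apply; rewrite le_eqVlt; apply/orP; left; apply/eqP; ring.
Qed.

(* Cover by n intervals of length of order 1/n: each has mass O(1/n^2). *)
Lemma poisson_null x1 l r K : 0 < r -> 0 <= K -> x1 <= l - r ->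
  (forall x eta, x1 <= x -> 0 < eta -> Ex mu (poisson x eta) <= K * eta) ->
  mu `](l - r)%R, (l + r)%R[%classic = 0%E.
Proof.
move=> r0 Kge0 x1l hK.
have bound (n : nat) : (mu `](l - r)%R, (l + r)%R[%classic <= (2 * K * r ^+ 2 / n.+1%:R)%:E)%E.
  have N0 : n.+1%:R != 0 :> R by rewrite pnatr_eq0.
  pose eta := r / n.+1%:R; have e0 : 0 < eta by rewrite divr_gt0.
  (* The n + 1 closed intervals of radius eta = r / (n + 1) around these centres tile
     [l - r, l + r]. *)
  pose c (j : nat) := l - r + j.*2.+1%:R * eta.
  pose F j : set (measurableTypeR R) :=
    if (j < n.+1)%N then `[(c j - eta)%R, (c j + eta)%R]%classic else set0.
  have mF j : measurable (F j) by rewrite /F; case: ifP => // _; exact: measurable_itv.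
  have sub : `](l - r)%R, (l + r)%R[%classic `<=` \big[setU/set0]_(j < n.+1) F j.
    move=> x /=; rewrite in_itv /= => /andP[x1' x2'].
    pose j := Num.truncn ((x - (l - r)) / (2 * eta)).
    have q0 : 0 <= (x - (l - r)) / (2 * eta).
      by rewrite divr_ge0 ?mulr_ge0// ?ltW// subr_gt0.
    have /andP[j1 j2] := truncn_itv q0; rewrite -/j in j1 j2.
    have jn : (j < n.+1)%N.
      rewrite -(ltr_nat R); apply: le_lt_trans j1 _.
      rewrite ltr_pdivrMr ?mulr_gt0// /eta.
      have -> : n.+1%:R * (2 * (r / n.+1%:R)) = 2 * r :> R by move: N0; move: (n.+1%:R : R) => N N0; field.
      lra.
    rewrite -bigcup_mkord; exists j => //=; rewrite /F jn /= in_itv /=.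
    rewrite ler_pdivlMr ?mulr_gt0// in j1; rewrite ltr_pdivrMr ?mulr_gt0// in j2.
    rewrite /c -addn1 -muln2 natrD natrM; rewrite -addn1 natrD in j2.
    by apply/andP; split; lra.
  have sA := @content_subadditive _ _ _ mu _ F n.+1 (fun k _ => mF k) _ sub.
  apply: le_trans (sA _) _; first exact: measurable_itv.
  apply: (@le_trans _ _ (\sum_(j < n.+1) (2 * K * eta ^+ 2)%:E)%E).
    apply: lee_sum => j _; rewrite /F ltn_ord; apply: poisson_interval_le => //.
    apply: hK => //; apply: le_trans x1l _; rewrite lerDl mulr_ge0// ltW//.
  rewrite sumEFin lee_fin sumr_const card_ord -[leLHS]mulr_natl /eta.
  by rewrite le_eqVlt; apply/orP; left; apply/eqP; move: N0; move: (n.+1%:R : R) => N N0; field.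
apply/eqP; rewrite eq_le measure_ge0 andbT; apply/lee_addgt0Pr => e e0; rewrite add0e.
pose n := Num.truncn (2 * K * r ^+ 2 / e).
apply: le_trans (bound n) _; rewrite lee_fin ler_pdivrMr// -ler_pdivrMl// [leLHS]mulrC.
by apply/ltW; rewrite /n truncnS_gt.
Qed.

(** A support point l > x0 would have a neighbourhood of radius (l - x0) / 2 of mass zero. The
    constant may depend on the left end x1 because in the application it blows up as x1 approaches
    x0. *)
Lemma upper_edge_le x0 (K : R -> R) : (forall x, x0 < x -> 0 <= K x) ->
  (forall x1 x eta, x0 < x1 -> x1 <= x -> 0 < eta ->
     Ex mu (poisson x eta) <= K x1 * eta) -> (upper_edge mu <= x0%:E)%E.
Proof.
move=> Kge0 hK; apply: ge_ereal_sup => _ [l /= hl <-]; rewrite lee_fin leNgt.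
apply/negP => xl; pose r := (l - x0) / 2.
have r0 : 0 < r by rewrite divr_gt0// subr_gt0.
have := hl `](l - r)%R, (l + r)%R[%classic (@itv_open _ _ _ _).
rewrite (@poisson_null (l - r) l r (K (l - r))) ?ltxx//.
- by move=> h; have : false by apply: h; rewrite /= in_itv /=; lra.
- by apply: Kge0; rewrite /r; lra.
by move=> x eta; apply: hK; rewrite /r; lra.
Qed.

(** A point outside the support lies in an interval with rational ends and mass zero, and there are
    only countably many of these. *)
Lemma mu_above_edge lam : (upper_edge mu <= lam%:E)%E ->
  {ae mu, forall l, l <= lam}.
Proof.
move=> hlam.
pose F (q : rat * rat) : set (measurableTypeR R) :=
  `](ratr q.1 : R), (ratr q.2 : R)[%classic.
suff : {ae mu, forall l, forall q, mu (F q) = 0%E -> ~ F q l}.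
  apply: filterS => l hl; rewrite leNgt; apply/negP => laml.
  have : ~ measure_support mu l.
    move=> sl; have : (l%:E <= lam%:E)%E by apply: le_trans hlam; apply: ereal_sup_ubound; exists l.
    by rewrite lee_fin leNgt laml.
  move=> /existsNP[U /not_implyP[oU /not_implyP[Ul /negP]]].
  rewrite -leNgt => U0.
  have /nbhs_ballP[e /= e0 he] : nbhs l U by exact: open_nbhs_nbhs.
  have [q1 /andP[q1a q1b]] : exists q, l - e < ratr q < l.
    have [q] := @rat_in_itvoo _ (l - e) l ltac:(lra).
    by rewrite in_itv; exists q.
  have [q2 /andP[q2a q2b]] : exists q, l < ratr q < l + e.
    have [q] := @rat_in_itvoo _ l (l + e) ltac:(lra).
    by rewrite in_itv; exists q.
  apply: (hl (q1, q2)); last by rewrite /F /= in_itv /= q1b.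
  apply/eqP; rewrite eq_le measure_ge0 andbT; apply: le_trans U0.
  apply: le_measure; rewrite ?inE; [exact: measurable_itv | exact: open_measurable |].
  move=> y; rewrite /F /= in_itv /= => /andP[y1 y2]; apply: he.
  by rewrite /ball /= ltr_norml; lra.
have [f finj] : exists f : rat * rat -> nat, injective f.
  by exists pickle; exact: pcan_inj pickleK.
suff : {ae mu, forall l, forall n : nat, forall q, unpickle n = Some q -> mu (F q) = 0%E -> ~ F q l}.
  by apply: filterS => l hl q; apply: (hl (pickle q)); rewrite pickleK.
apply: ae_foralln => n; case: (unpickle n) => [q|]; last exact: aeW.
have [F0|] := pselect (mu (F q) = 0%E); last by move=> h; apply: aeW => l q' [<-].
exists (F q); split => //; first exact: measurable_itv.
by move=> l /= h; apply: contrapT => nF; apply: h => q' [<-].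
Qed.

Lemma Ex_poisson_le lam x eta : {ae mu, forall l, l <= lam} -> lam < x -> 0 < eta ->
  Ex mu (poisson x eta) <= eta / (x - lam) ^+ 2.
Proof.
move=> hl lx e0; rewrite -[leRHS](Ex_cst mu); apply: le_Ex.
- exact: poisson_ae_bounded.
- exact: ae_bounded_cst.
have FF : Filter (almost_everywhere mu) by exact: ae_filter_ringOfSetsType.
move: hl; apply: filterS => l ll; rewrite /poisson ler_pM2l// lef_pV2 ?posrE ?poisson_den_gt0//.
  have : (x - lam) ^+ 2 <= (l - x) ^+ 2.
    rewrite -[leRHS]sqrrN ler_sqr ?nnegrE; lra.
  by have := sqr_ge0 eta; lra.
by rewrite exprn_gt0// subr_gt0.
Qed.

End PoissonKernel.

(** * Loss of positivity along a finite sequence of matrices *)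

Section Crossing.
Context {R : realType} {p : nat}.
Implicit Types A X : 'M[R[i]]_p.

Lemma small_form_arith (m e f q iq ruv ruu iuu : R) :
  q <= m * f -> iq <= m * f -> ruu + iuu <= e * f ->
  e * f + e * ruv <= e * (e * q) + ruu -> e * f - e * ruv <= e ^+ 2 * iq + iuu ->
  2 * (e * f) <= e ^+ 2 * (2 * (m * f)) + e * f.
Proof.
have e2 : 0 <= e ^+ 2 by rewrite sqr_ge0.
move=> /(ler_wpM2l e2) q1 /(ler_wpM2l e2) q2 q3; rewrite [e * (e * q)]mulrA -expr2.
lra.
Qed.

Lemma small_form_arith2 (m e f : R) : 0 < e * f ->
  2 * (e * f) <= e ^+ 2 * (2 * (m * f)) + e * f -> 1 <= 2 * (e * m).
Proof.
move=> ef h; rewrite -(ler_pM2l ef) mulr1; move: h; clear ef.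
have -> : e ^+ 2 * (2 * (m * f)) = e * f * (2 * (e * m)) by ring.
by generalize (e * f) (2 * (e * m)) => a b; lra.
Qed.

(** The left side sees only the skew-Hermitian part i N of A; the inequality is N >= 0 tested at v -
    i u. *)
Lemma rform_anti_le A v u : (forall w, 0 <= iform A w w) ->
  rform A v u - rform A u v <= iform A v v + iform A u u.
Proof.
have aux (a b c e : R) : 0 <= a - b + (- c - - e) -> b + c <= a + e by lra.
move=> h; have nII : nI * Num.conj nI = 1 :> R[i].
  by apply: complex_ext; rewrite ?ReM ?ImM conjcE /=; ring.
pose w := Num.conj nI *: u.
have := h (v - w); rewrite /iform scalerBr.
rewrite rformDl !rformDr !rformNr !rformNl -!/(iform _ _ _) => h0.
have e1 : iform A v w = rform A v u by rewrite /iform /w scalerA nII scale1r.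
have e2 : iform A w v = - rform A u v.
  rewrite /iform /w /rform ctZ conjCK -!scalemxAl -scalemxAr !mxE mulrA.
  have -> : nI * nI = -1 :> R[i] by apply: complex_ext; rewrite ?ReM ?ImM /=; ring.
  by rewrite mulN1r ReN.
have e3 : iform A w w = iform A u u.
  rewrite {1}/iform /w /iform /rform ctZ conjCK scalerA nII scale1r -!scalemxAl.
  by rewrite -scalemxAr.
by have := aux _ _ _ _ h0; rewrite e1 e2 e3.
Qed.

Lemma rform_sym_le A v u : (forall w, 0 <= rform A w w) ->
  rform A v u + rform A u v <= rform A v v + rform A u u.
Proof.
move=> h; have := h (v - u); rewrite rformDl !rformDr !rformNr !rformNl.
by generalize (rform A v v) (rform A v u) (rform A u v) (rform A u u) => a b c e; lra.
Qed.

(* For A = H + iN with H, N >= 0, a direction u where both forms are small forces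
   the inverse to be large: 1 = |(A^-* u)^* A u| for unit u. *)
Lemma small_form_inv_large A u e : A \in unitmx ->
  (forall w, 0 <= rform A w w) -> (forall w, 0 <= iform A w w) ->
  0 < fro u -> 0 < e -> rform A u u + iform A u u <= e * fro u ->
  1 <= 4 * e ^+ 2 * fro (invmx A).
Proof.
move=> uA hr hi u0 e0 hu.
pose m := Num.sqrt (fro (invmx A)).
have m0 : 0 <= m by exact: sqrtr_ge0.
have mE : m ^+ 2 = fro (invmx A) by rewrite sqr_sqrtr ?fro_ge0.
have hm : op_le (invmx A) m by apply: op_le_fro => //; rewrite mE.
pose v := ct (invmx A) *m u.
have vu : rform A v u = fro u.
  by rewrite /v -rform_mull ctK mulVmx// rform1.
have qv : rform A v v <= m * fro u.
  rewrite /v -rform_mul ctK mulVmx// mul1mx; exact: op_le_rform (op_le_ct hm).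
have iv : iform A v v <= m * fro u.
  have -> : iform A v v = iform (- invmx A) u u by rewrite iformNm iform_inv_ct// opprK.
  exact: op_le_iform (op_leN hm).
(* Adding these two inequalities cancels Re u^* A v and leaves 2 e |u|^2 <= 2 e^2 m |u|^2 + e |u|^2,
   whence 1 <= 2 e m. *)
have h1 := rform_sym_le (e%:C%C *: v) u hr.
have h2 := rform_anti_le (e%:C%C *: v) u hi.
have iZ : iform A (e%:C%C *: v) (e%:C%C *: v) = e ^+ 2 * iform A v v.
  by rewrite /iform scalerA mulrC -scalerA rformZl rformZr mulrA.
rewrite iZ !rformZl !rformZr in h1 h2; rewrite vu in h1 h2.
have h := small_form_arith qv iv hu h1 h2.
have h3 : 1 <= 2 * (e * m) by apply: small_form_arith2 h; rewrite mulr_gt0.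
have := ler_pM ler01 ler01 h3 h3; rewrite mulr1; move/le_trans; apply.
by rewrite -mE le_eqVlt; apply/orP; left; apply/eqP; ring.
Qed.

(** Descend from K to the first index k where the real part fails to be nonnegative. A vector
    showing this has form at most e1 |u|^2 at index k + 1, where real and imaginary parts are both
    still nonnegative, so [small_form_inv_large] applies there. *)
Lemma crossing (A : nat -> 'M[R[i]]_p) (K : nat) (e1 e2 : R) :
  (forall k, A k \in unitmx) -> (forall k w, 0 <= iform (A k) w w) ->
  0 < e1 -> 0 <= e2 ->
  (forall k, op_le (A k.+1 - A k) e1) ->
  (forall k w, iform (A k) w w <= e2 * fro w) ->
  (forall w, 0 <= rform (A K) w w) ->
  (forall w, 0 <= rform (A 0%N) w w) \/
  exists2 k, (k <= K)%N & 1 <= 4 * (e1 + e2) ^+ 2 * fro (invmx (A k)).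
Proof.
move=> uA hi e10 e20 hst him hK.
have [//|nP] := pselect (forall w, 0 <= rform (A 0%N) w w); first by left.
right; elim: K hK => [|K IH] hK; first by case: nP.
have [h|] := pselect (forall w, 0 <= rform (A K) w w).
  by have [k kK hk] := IH h; exists k; [exact: leqW | exact: hk].
move=> /existsNP[u /negP]; rewrite -ltNge => hu.
exists K.+1; first exact: leqnn.
apply: (small_form_inv_large (uA K.+1) hK (hi K.+1) (u := u)).
- rewrite lt_def fro_ge0 andbT; apply/negP => /eqP/fro_eq0 u0.
  by move: hu; rewrite u0 /rform mulmx0 mxE ltxx.
- by rewrite ltr_pwDl.
rewrite mulrDl; apply: lerD; last exact: him.
have := op_le_rform u (hst K); rewrite rformBm => h.
by apply: le_trans h; rewrite lerDl oppr_ge0 ltW.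
Qed.

(** Expand u in the basis and bound the cross terms by diagonal ones. The factor p is not sharp, but
    only a finite constant is needed. *)
Lemma iform_trace_le X u : (forall w, 0 <= iform X w w) ->
  iform X u u <= p%:R * (\sum_i iform X (delta_mx i 0) (delta_mx i 0)) * fro u.
Proof.
move=> h; pose a i : 'cV[R[i]]_p := u i 0 *: delta_mx i 0.
have uE : u = \sum_i a i.
  apply/matrixP => i j; rewrite ord1 summxE (bigD1 i)//= big1 ?addr0.
    by rewrite !mxE !eqxx mulr1.
  by move=> k ki; rewrite !mxE eq_sym (negbTE ki) mulr0.
have suml (I : Type) (s : seq I) (F : I -> 'cV[R[i]]_p) b :
    iform X (\sum_(i <- s) F i) b = \sum_(i <- s) iform X (F i) b.
  elim: s => [|i s IH]; last by rewrite !big_cons -IH; exact: rformDl.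
  by rewrite !big_nil /iform /rform /ct trmx0 map_mx0 !mul0mx mxE.
have sumr (I : Type) (s : seq I) (F : I -> 'cV[R[i]]_p) b :
    iform X b (\sum_(i <- s) F i) = \sum_(i <- s) iform X b (F i).
  elim: s => [|i s IH]; last by rewrite !big_cons /iform scalerDr rformDr -!/(iform _ _ _) IH.
  by rewrite !big_nil /iform scaler0 /rform mulmx0 mxE.
have cs b c : iform X b c + iform X c b <= iform X b b + iform X c c.
  have := h (b - c); rewrite /iform scalerBr rformDl !rformDr !rformNr !rformNl.
  rewrite -!/(iform _ _ _).
  by generalize (iform X b b) (iform X b c) (iform X c b) (iform X c c) => x y z t; lra.
have aE i : iform X (a i) (a i) = sqc (u i 0) * iform X (delta_mx i 0) (delta_mx i 0).
  rewrite /a /iform scalerA mulrC -scalerA; set b := nI *: _.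
  rewrite /rform ctZ -!scalemxAl -scalemxAr scalerA mul_conj_sqc mxE.
  by rewrite ReM /= mul0r subr0.
have sq_le i : sqc (u i 0) <= fro u by exact: sqc_fro.
have h1 : 2 * iform X u u <= \sum_i \sum_j (iform X (a i) (a i) + iform X (a j) (a j)).
  have -> : 2 * iform X u u = \sum_i \sum_j (iform X (a i) (a j) + iform X (a j) (a i)).
    rewrite [RHS](eq_bigr (fun i => \sum_j iform X (a i) (a j) + \sum_j iform X (a j) (a i)));
      last by move=> i _; rewrite big_split.
    rewrite big_split /= [X in _ = _ + X]exchange_big /=.
    have -> : \sum_i \sum_j iform X (a i) (a j) = iform X u u.
      rewrite [in RHS]uE suml; apply: eq_bigr => i _; rewrite sumr //.
    by ring.
  by apply: ler_sum => i _; apply: ler_sum => j _.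
have h2 : \sum_i \sum_j (iform X (a i) (a i) + iform X (a j) (a j)) =
    2 * (p%:R * \sum_i iform X (a i) (a i)).
  rewrite (eq_bigr (fun i => p%:R * iform X (a i) (a i) + \sum_j iform X (a j) (a j))).
    rewrite big_split /= -mulr_sumr sumr_const card_ord -[X in _ + X]mulr_natl.
    by ring.
  by move=> i _; rewrite big_split /=; congr (_ + _); rewrite sumr_const card_ord mulr_natl.
rewrite h2 ler_pM2l// in h1; apply: le_trans h1 _; rewrite -mulrA ler_wpM2l//.
rewrite mulr_suml; apply: ler_sum => i _; rewrite aE mulrC.
by apply: ler_wpM2l.
Qed.

End Crossing.

(** * Bounds on solutions that do not depend on Im z *)

Section UniformBounds.
Context {R : realType} {d} {Y : measurableType d} {p : nat}.
Variables (law : probability Y R) (alpha : R) (alpha_gt0 : 0 < alpha).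
Variable S : Y -> 'M[R[i]]_p.
Hypotheses (S_herm : forall y, ct (S y) = S y) (S_ae_bounded : ae_bounded_mx law S).
Variables (t : R) (t_gt0 : 0 < t).
Hypothesis S_bound : {ae law, forall y, fro (S y) <= t ^+ 2}.

(** The operator norm is at most sqrt f <= (1 + f) / 2 with f = |X|^2; being affine in f, this bound
    can be averaged knowing only E |R|^2. *)
Lemma op_le_sqrt m n (X : 'M[R[i]]_(m, n)) : op_le X (2^-1 * (1 + fro X)).
Proof.
apply: op_le_fro; first by rewrite mulr_ge0 ?invr_ge0// addr_ge0 ?fro_ge0.
have := sqr_ge0 (1 - fro X); generalize (fro X) => f; rewrite !expr2; lra.
Qed.

(** This and the next three constants dominate in turn |W^-1|^2, E |R|^2, the norm of W - z, and Im
    W / Im z for |z| <= B. Each is built from earlier ones, and none involves Im z. *)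
Definition inv_bound (dist : R) := p%:R / dist ^+ 2.
Definition resolvent_bound dist := 2 * (inv_bound dist / alpha) + 2 * inv_bound dist.
Definition shift_bound dist := alpha * (t + t * (2^-1 * (1 + resolvent_bound dist)) * t).
Definition im_bound dist B := p%:R * inv_bound dist * (B + shift_bound dist) ^+ 2.

Lemma inv_bound_ge0 dist : 0 <= inv_bound dist.
Proof. by rewrite divr_ge0 ?sqr_ge0. Qed.

Lemma resolvent_bound_ge0 dist : 0 <= resolvent_bound dist.
Proof.
have a0 := ltW alpha_gt0; have k0 := inv_bound_ge0 dist.
by rewrite /resolvent_bound addr_ge0// mulr_ge0// divr_ge0.
Qed.

Lemma shift_bound_ge0 dist : 0 <= shift_bound dist.
Proof.
have t0 := ltW t_gt0; have k1 := resolvent_bound_ge0 dist.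
by rewrite mulr_ge0 ?(ltW alpha_gt0)// addr_ge0// !mulr_ge0 ?invr_ge0// addr_ge0.
Qed.

Lemma im_bound_ge0 dist B : 0 <= im_bound dist B.
Proof.
apply: mulr_ge0; last exact: sqr_ge0.
by apply: mulr_ge0 => //; exact: inv_bound_ge0.
Qed.

Variables (z : R[i]) (W : 'M[R[i]]_p) (dist : R).
Hypotheses (eta_gt0 : 0 < complex.Im z) (hs : is_sol law alpha S z W) (dist_gt0 : 0 < dist).
Hypothesis trace_le :
  \sum_i iform (- invmx W) (delta_mx i 0) (delta_mx i 0) <= p%:R * (complex.Im z / dist ^+ 2).

Let hW : im_posdef W := proj1 hs.

Lemma sol_unit : W \in unitmx.
Proof. by case: hW => k k0 hk; apply: (coercive_unit (k := nI) (c := k)). Qed.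

Lemma iform_Ninv w :
  iform (- invmx W) w w = iform W (invmx W *m w) (invmx W *m w).
Proof. by rewrite iformNm iform_inv ?sol_unit// opprK. Qed.

Lemma trace_inv_le : \sum_i iform (- invmx W) (delta_mx i 0) (delta_mx i 0) <= complex.Im z * inv_bound dist.
Proof. by move: trace_le; rewrite /inv_bound mulrA [X in _ <= X / _]mulrC -mulrA. Qed.

(** The trace of Im M = W^-* (Im W) W^-1 is at least Im z |W^-1|^2, and Im z cancels against the
    hypothesis. *)
Lemma fro_invW : fro (invmx W) <= inv_bound dist.
Proof.
rewrite -(ler_pM2l eta_gt0); apply: le_trans trace_inv_le.
rewrite fro_col_sum mulr_sumr; apply: ler_sum => i _.
rewrite iform_Ninv; exact: (sol_iform_ge alpha_gt0 S_herm S_ae_bounded).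
Qed.

Lemma resolvent_diff y : resolvent S W y *m (S y *m invmx W) = resolvent S W y - invmx W.
Proof.
have uA := imdef_unit S_herm y hW.
have := invmxB uA sol_unit; rewrite -/(resolvent S W y) opprB addrCA subrr addr0 => ->.
by rewrite mulmxA.
Qed.

Lemma resolvent_ae_boundedW : ae_bounded_mx law (resolvent S W).
Proof. exact: (resolvent_ae_bounded S_herm S_ae_bounded hW). Qed.

Lemma ae_bounded_mx_RB : ae_bounded_mx law (fun y => resolvent S W y - invmx W).
Proof. by apply: ae_bounded_mxD; [exact: resolvent_ae_boundedW | exact: ae_bounded_mx_cst]. Qed.

(** At u = W^-1 e_i the expectation in [sol_iform] involves R S W^-1 e_i, which is column i of R -
    W^-1 by [resolvent_diff]; the trace that bounds W^-1 thus also bounds this second moment. *)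
Lemma Ex_fro_diff : Ex law (fun y => fro (resolvent S W y - invmx W)) <= inv_bound dist / alpha.
Proof.
rewrite ler_pdivlMr// mulrC -(ler_pM2l eta_gt0); apply: le_trans trace_inv_le.
pose v i : 'cV[R[i]]_p := invmx W *m delta_mx i 0.
have mv i : ae_bounded_mx law (fun y => resolvent S W y *m (S y *m v i)) by exact: RS_ae_bounded.
have -> : (fun y => fro (resolvent S W y - invmx W)) =
    (fun y => \sum_i fro (resolvent S W y *m (S y *m v i))).
  apply/funext => y; rewrite fro_col_sum; apply: eq_bigr => i _.
  by rewrite -resolvent_diff /v !mulmxA.
rewrite Ex_sum; last by move=> i; exact: ae_bounded_mx_fro.
rewrite !mulr_sumr; apply: ler_sum => i _.
rewrite iform_Ninv (sol_iform S_herm S_ae_bounded _ hs) mulrCA ler_wpDl//.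
  by rewrite mulr_ge0 ?fro_ge0// ltW.
rewrite ler_pM2l// -ExZ; last exact: ae_bounded_mx_fro.
apply: le_Ex; first by apply: ae_boundedZ; exact: ae_bounded_mx_fro.
  by apply: iform_ae_bounded; exact: mv.
by apply: aeW => y; exact: (sol_iform_ge alpha_gt0 S_herm S_ae_bounded).
Qed.

Lemma Ex_fro_resolvent : Ex law (fun y => fro (resolvent S W y)) <= resolvent_bound dist.
Proof.
have m1 := ae_bounded_mx_fro ae_bounded_mx_RB.
apply: le_trans (_ : Ex law (fun y => 2 * fro (resolvent S W y - invmx W) + 2 * fro (invmx W)) <= _).
  apply: le_Ex; first exact: ae_bounded_mx_fro resolvent_ae_boundedW.
    by apply: ae_boundedD; [exact: ae_boundedZ | exact: ae_bounded_cst].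
  apply: aeW => y; apply: le_trans (froD_le _ _).
  by rewrite subrK.
rewrite ExD ?Ex_cst ?ExZ//; [|exact: ae_boundedZ | exact: ae_bounded_cst].
by rewrite /resolvent_bound; apply: lerD; rewrite ler_pM2l//; [exact: Ex_fro_diff | exact: fro_invW].
Qed.

Lemma op_le_self_energy : op_le (alpha%:C%C *: E_Cmx law (self_energy S W)) (shift_bound dist).
Proof.
move=> a b; rewrite rformZm (rform_E _ _ (self_energy_ae_bounded S_herm S_ae_bounded hW)).
have mQ := ae_bounded_mx_rform a b (self_energy_ae_bounded S_herm S_ae_bounded hW).
have mR := ae_bounded_mx_fro resolvent_ae_boundedW.
rewrite /shift_bound mulrCA -mulrA ler_pM2l// -ExZ//.
have F0 : 0 <= fro a + fro b by rewrite addr_ge0 ?fro_ge0.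
pose g r := (t + t * (2^-1 * (1 + r)) * t) * (fro a + fro b).
have gE r : g r = (t + t * 2^-1 * t) * (fro a + fro b) +
    (t * 2^-1 * t * (fro a + fro b)) * r by rewrite /g; ring.
apply: (@le_trans _ _ (Ex law (fun y => g (fro (resolvent S W y))))).
  apply: le_Ex; first exact: ae_boundedZ.
    have := ae_boundedD (ae_bounded_cst law ((t + t * 2^-1 * t) * (fro a + fro b)))
      (ae_boundedZ (t * 2^-1 * t * (fro a + fro b)) mR).
    by congr ae_bounded; apply/funext => y; rewrite gE.
  move: S_bound; apply: filterS => y hy.
  have hS : op_le (S y) t by apply: op_le_fro => //; exact: ltW.
  have hR := op_le_sqrt (resolvent S W y).
  have r0 : 0 <= 2^-1 * (1 + fro (resolvent S W y)).
    by rewrite mulr_ge0 ?invr_ge0// addr_ge0 ?fro_ge0.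
  have t0 := ltW t_gt0.
  have h := op_leD hS (op_leM (mulr_ge0 t0 r0) t0 (op_leM t0 r0 hS hR) hS).
  exact: (h a b).
rewrite (_ : (fun y => g (fro (resolvent S W y))) = (fun y => (t + t * 2^-1 * t) * (fro a + fro b) +
    (t * 2^-1 * t * (fro a + fro b)) * fro (resolvent S W y))); last by apply/funext => y; rewrite gE.
rewrite ExD; [|exact: ae_bounded_cst|exact: ae_boundedZ].
rewrite Ex_cst ExZ// -/(g (resolvent_bound dist)) gE lerD2l; apply: ler_wpM2l; last exact: Ex_fro_resolvent.
by rewrite !mulr_ge0 ?invr_ge0// ltW.
Qed.

Lemma sol_W_eq : W = z%:M - alpha%:C%C *: E_Cmx law (self_energy S W).
Proof. exact: (proj2 hs). Qed.

Lemma rform_W_ge u : (complex.Re z - shift_bound dist) * fro u <= rform W u u.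
Proof.
rewrite [in leRHS]sol_W_eq rformBm rform_scalar mulrBl lerD2l lerN2.
exact: op_le_rform op_le_self_energy.
Qed.

(** Im W = W^* (Im M) W, where Im M = O(Im z) by the trace bound and W is bounded by B plus the
    shift. *)
Lemma iform_W_le B u : 0 < B -> sqc z <= B ^+ 2 ->
  iform W u u <= complex.Im z * im_bound dist B * fro u.
Proof.
move=> B0 hB; have hfb : op_le W (B + shift_bound dist).
  by rewrite [W]sol_W_eq; apply: op_leD; [exact: op_le_scalar | exact/op_leN/op_le_self_energy].
have uE : invmx W *m (W *m u) = u by rewrite mulKmx// sol_unit.
rewrite -{1 2}uE -iform_Ninv.
apply: le_trans (iform_trace_le _ _) _.
  by move=> w; rewrite iform_Ninv; exact: imdef_ge0 hW.
have h1 := trace_inv_le.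
have BK : 0 <= B + shift_bound dist by rewrite addr_ge0 ?shift_bound_ge0// ltW.
have h2 := op_le_mulmx u BK hfb.
have tr0 : 0 <= \sum_i iform (- invmx W) (delta_mx i 0) (delta_mx i 0).
  by apply: sumr_ge0 => i _; rewrite iform_Ninv; exact: imdef_ge0 hW.
have h3 := ler_pM tr0 (fro_ge0 _) h1 h2.
rewrite -mulrA; apply: le_trans (ler_wpM2l _ h3) _ => //.
by rewrite le_eqVlt; apply/orP; left; apply/eqP; rewrite /im_bound; ring.
Qed.

End UniformBounds.

Section Vanishing.
Context {R : realType} {d} {Y : measurableType d}.
Variable law : probability Y R.

(** The points where P fails lie in every set where g n >= 1, and by Markov these have arbitrarily
    small mass. P itself need not be measurable, which suits a statement about all vectors. *)
Lemma ae_of_small_means (P : Y -> Prop) (g : nat -> Y -> R) :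
  (forall n, ae_bounded law (g n)) -> (forall n y, 0 <= g n y) ->
  (forall n, {ae law, forall y, P y \/ 1 <= g n y}) ->
  (forall e, 0 < e -> exists n, Ex law (g n) <= e) -> {ae law, forall y, P y}.
Proof.
move=> mg g0 hP small; pose A n := [set y | 1 <= g n y].
have mA n : measurable (A n).
  have [mgn _] := mg n.
  have := mgn measurableT _ (measurable_itv `[1, +oo[); rewrite setTI.
  by congr measurable; apply/seteqP; split => y /=; rewrite in_itv /= andbT.
have Aneg : law (\bigcap_n A n) = 0%E.
  apply/eqP; rewrite eq_le measure_ge0 andbT; apply/lee_addgt0Pr => e e0; rewrite add0e.
  have [n hn] := small e e0.
  apply: (@le_trans _ _ (law (A n))).
    apply: le_measure; rewrite ?inE //; first exact: bigcap_measurable.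
    by move=> y; apply.
  have hI : ae_bounded law (\1_(A n) : Y -> R).
    split; first exact: measurable_indic.
    exists 1; apply: aeW => y; rewrite indicE; case: (_ \in _) => /=.
      by rewrite normr1.
    by rewrite normr0.
  have hm : Ex law \1_(A n) = fine (law (A n)).
    by rewrite /Ex /Rintegral integral_indic// setIT.
  have fm : law (A n) \is a fin_num by exact: fin_num_measure.
  rewrite -(fineK fm) lee_fin -hm; apply: le_trans hn; apply: le_Ex => //.
  apply: aeW => y; rewrite indicE; case: (boolP (y \in A n)) => /=; last by rewrite g0.
  by rewrite inE.
have notA : {ae law, forall y, ~ (\bigcap_n A n) y}.
  exists (\bigcap_n A n); split => //; first exact: bigcap_measurable.
  by move=> y /= /contrapT.
have := ae_foralln hP; move: notA; apply: filterS2 => y nA h.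
apply: contrapT => nP; apply: nA => n _.
by case: (h n).
Qed.

End Vanishing.

(** * Descent from large x to a point x1 to the right of the support *)

Section RightOfSupport.
Context {R : realType} {d} {Y : measurableType d} {p : nat}.
Variables (law : probability Y R) (alpha : R) (alpha_gt0 : 0 < alpha).
Variable S : Y -> 'M[R[i]]_p.
Hypotheses (S_herm : forall y, ct (S y) = S y) (S_ae_bounded : ae_bounded_mx law S).
Hypothesis S_sym : forall y, (S y)^T = S y.
Variables (t : R) (t_gt0 : 0 < t).
Hypothesis S_bound : {ae law, forall y, fro (S y) <= t ^+ 2}.

Lemma self_energy_tr W y : (self_energy S W y)^T = self_energy S W^T y.
Proof.
rewrite /self_energy linearD /= !trmx_mul S_sym mulmxA; congr (_ + _ *m _ *m _).
by rewrite /resolvent trmx_inv linearB /= S_sym.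
Qed.

Lemma E_Cmx_self_energy_tr W : (E_Cmx law (self_energy S W))^T = E_Cmx law (self_energy S W^T).
Proof.
apply/matrixP => i j; rewrite [LHS]mxE [LHS]mxE [RHS]mxE; congr (Cexpectation law _).
by apply/funext => y; rewrite -self_energy_tr [RHS]mxE.
Qed.

Lemma imdef_tr (W : 'M[R[i]]_p) : im_posdef W -> im_posdef W^T.
Proof.
move=> [c c0 h]; exists c => // u; rewrite -fro_conj.
have -> : iform W^T u u = iform W (map_mx Num.conj u) (map_mx Num.conj u).
  have trE (X : 'M[R[i]]_1) : X 0 0 = X^T 0 0 by rewrite mxE.
  rewrite /iform /rform trE !trmx_mul trmxK mulmxA; congr (complex.Re (_ 0 0)).
  have -> : (ct u)^T = map_mx Num.conj u by rewrite /ct map_trmx trmxK.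
  have -> : ct (map_mx Num.conj u) = u^T.
    by apply/matrixP => i j; rewrite ctE !mxE conjCK.
  by rewrite linearZ /= -!scalemxAl -scalemxAr.
exact: h.
Qed.

(** S is symmetric as well as Hermitian, so W^T solves the same equation, and uniqueness
    concludes. *)
Lemma sol_sym z W : 0 < complex.Im z -> is_sol law alpha S z W -> W^T = W.
Proof.
move=> z0 hs; have [hW eqW] := hs.
apply: (sol_uniq alpha_gt0 S_herm S_ae_bounded z0 _ hs).
split; first exact: imdef_tr.
rewrite {1}eqW linearB /= tr_scalar_mx linearZ /=; congr (_ - _ *: _).
exact: E_Cmx_self_energy_tr.
Qed.

Variables (lam : R) (W : R[i] -> 'M[R[i]]_p).
Hypothesis hsol : forall z, 0 < complex.Im z -> is_sol law alpha S z (W z).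
Hypothesis trace_le : forall z, lam < complex.Re z -> 0 < complex.Im z ->
  \sum_i iform (- invmx (W z)) (delta_mx i 0) (delta_mx i 0) <=
    p%:R * (complex.Im z / (complex.Re z - lam) ^+ 2).
Variables (x1 : R) (lam_lt : lam < x1).

Let dist := x1 - lam.
Let k0 : R := @inv_bound R p dist.
Let k1 := @resolvent_bound R p alpha dist.
Let k2 := @shift_bound R p alpha t dist.
(** At Re z = X0 the real part of W is at least X0 - k2 >= t + 1, more than any S(y): the descent
    starts from positivity. The term |x1| gives x1 < X0 and |Re z| <= X0 on the region. *)
Let X0 := k2 + t + 1 + `|x1|.
Let k3 := @im_bound R p alpha t dist (X0 + 1) + 1.

Lemma dist_gt0 : 0 < dist. Proof. by rewrite subr_gt0. Qed.
Lemma k1_ge0 : 0 <= k1. Proof. exact: resolvent_bound_ge0. Qed.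
Lemma k2_ge0 : 0 <= k2. Proof. exact: shift_bound_ge0. Qed.
Lemma k3_gt0 : 0 < k3. Proof. by rewrite ltr_wpDl// im_bound_ge0. Qed.

Lemma X0_gt : x1 < X0.
Proof.
have aux (a b : R) : x1 <= b -> 0 <= a -> 0 < t -> x1 < a + t + 1 + b by lra.
exact: aux (ler_norm x1) k2_ge0 t_gt0.
Qed.

Lemma X0_gt0 : 0 < X0.
Proof.
have aux (a b : R) : 0 <= b -> 0 <= a -> 0 < t -> 0 < a + t + 1 + b by lra.
exact: aux (normr_ge0 x1) k2_ge0 t_gt0.
Qed.

Definition region z := x1 <= complex.Re z <= X0 /\ 0 < complex.Im z <= 1.

Lemma trace_region_le z : x1 <= complex.Re z -> 0 < complex.Im z ->
  \sum_i iform (- invmx (W z)) (delta_mx i 0) (delta_mx i 0) <=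
    p%:R * (complex.Im z / dist ^+ 2).
Proof.
move=> xz z0; have d0 := dist_gt0.
apply: le_trans (trace_le _ z0) _; first exact: lt_le_trans lam_lt xz.
apply: ler_wpM2l => //; rewrite ler_pM2l//.
have dz : dist <= complex.Re z - lam by rewrite lerD2r.
rewrite lef_pV2 ?posrE ?exprn_gt0//; last exact: lt_le_trans dz.
by rewrite ler_sqr ?nnegrE//; [exact: ltW | exact: le_trans (ltW d0) dz].
Qed.

Lemma region_sqc z : region z -> sqc z <= (X0 + 1) ^+ 2.
Proof.
move=> [/andP[z1 z2] /andP[z3 z4]]; have h0 := X0_gt0.
have hx : - X0 <= complex.Re z.
  apply: le_trans z1; rewrite lerNl; apply: le_trans (_ : `|x1| <= _).
    by rewrite -normrN ler_norm.
  have aux (a : R) : 0 <= a -> 0 < t -> 0 <= a + t + 1 by lra.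
  by rewrite lerDr; exact: aux k2_ge0 t_gt0.
have h1 : complex.Re z ^+ 2 <= X0 ^+ 2.
  by rewrite -[leLHS]real_normK ?num_real// ler_sqr ?nnegrE ?(ltW h0)// ler_norml hx.
have h2 : complex.Im z ^+ 2 <= 1 by rewrite expr_le1// ltW.
have aux (a b c : R) : 0 < a -> b <= a ^+ 2 -> c <= 1 -> b + c <= a ^+ 2 + a *+ 2 + 1 by lra.
by rewrite /sqc sqrrD expr1n mulr1; exact: aux.
Qed.

Lemma iform_region z u : region z -> iform (W z) u u <= complex.Im z * k3 * fro u.
Proof.
move=> hz; have [/andP[z1 z2] /andP[z3 z4]] := hz.
have B0 : 0 < X0 + 1 by rewrite addr_gt0// X0_gt0.
have := iform_W_le alpha_gt0 S_herm S_ae_bounded t_gt0 S_bound z3 (hsol z3)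
  (trace_region_le z1 z3) u B0 (region_sqc hz).
move/le_trans; apply; rewrite ler_wpM2r ?fro_ge0// ler_pM2l//.
by rewrite lerDl.
Qed.

(** On the region n <= k3 for both solutions, so the gauge estimate of [sol_lipschitz] becomes an
    operator bound. *)
Lemma lip_region z z' k : region z -> region z' -> 0 < k -> sqc (z - z') <= k ^+ 2 ->
  op_le (W z - W z') (k * k3).
Proof.
move=> hz hz' k0' hk a b.
have [/andP[z1 z2] /andP[z3 z4]] := hz; have [/andP[z1' z2'] /andP[z3' z4']] := hz'.
apply: le_trans (sol_lipschitz alpha_gt0 S_herm S_ae_bounded a b z3 z3' (hsol z3) (hsol z3')
  (ltW k0') (op_le_scalar k0' hk)) _.
rewrite -mulrA ler_pM2l// mulrDr; apply: lerD; rewrite ler_pdivrMr//.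
  by rewrite [leRHS]mulrC mulrA; exact: iform_region.
by rewrite [leRHS]mulrC mulrA; exact: iform_region.
Qed.

(* The index is clamped at n + 1, so that the whole sequence stays in the region. *)
Definition grid_point (n k : nat) : R[i] :=
  ((x1 + (minn k n.+1)%:R * ((X0 - x1) / n.+1%:R)) +i* n.+1%:R^-1)%C.

Lemma grid_point_region n k : region (grid_point n k).
Proof.
have L0 : 0 < X0 - x1 by rewrite subr_gt0 X0_gt.
have h0 : 0 <= (X0 - x1) / n.+1%:R by rewrite divr_ge0// ltW.
split; rewrite /grid_point /=.
  rewrite lerDl mulr_ge0//= -lerBrDl mulrA ler_pdivrMr// mulrC ler_pM2l//.
  by rewrite ler_nat geq_minr.
by rewrite invr_gt0 ltr0n invf_le1// ler1n.
Qed.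

(** The grid has mesh (X0 - x1) / (n + 1) and height 1 / (n + 1). After multiplication by k3 the
    first bounds the increments of W and the second bounds Im W; [c] collects both. *)
Let c := (X0 - x1 + 1) * k3.

Lemma grid n (X : 'M[R[i]]_p) : ct X = X -> (forall u, rform X u u <= t * fro u) ->
  (forall w, 0 <= rform (W (grid_point n 0) - X) w w) \/
  exists2 k, (k <= n.+1)%N & 1 <= 4 * (c / n.+1%:R) ^+ 2 * fro (invmx (W (grid_point n k) - X)).
Proof.
move=> hX hXt; have L0 : 0 < X0 - x1 by rewrite subr_gt0 X0_gt.
have kk := k3_gt0.
have iA z w : iform (W z - X) w w = iform (W z) w w.
  by rewrite iformBm (iform_herm _ hX) subr0.
have him k : 0 < complex.Im (grid_point n k) by have [_ /andP[]] := grid_point_region n k.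
have -> : c / n.+1%:R = (X0 - x1) / n.+1%:R * k3 + n.+1%:R^-1 * k3.
  by rewrite /c mulrDl mulrDl mul1r mulrAC [k3 / _]mulrC.
apply: (@crossing _ _ (fun k => W (grid_point n k) - X) n.+1).
- move=> k; have [[e e0 he] _] := hsol (him k).
  apply: (coercive_unit (k := nI) (c := e)) => // u.
  by rewrite -/(iform _ u u) iA.
- by move=> k w; rewrite iA; apply: imdef_ge0; exact: (proj1 (hsol (him k))).
- by rewrite mulr_gt0// divr_gt0.
- by rewrite mulr_ge0 ?invr_ge0 ?(ltW kk).
- move=> k; rewrite opprB addrA subrK; apply: lip_region; try exact: grid_point_region.
    by rewrite divr_gt0.
  rewrite /sqc ReD ImD ReN ImN /grid_point /= subrr expr0n addr0 opprD addrACA subrr add0r -mulrBl.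
  rewrite exprMn -[leRHS]mul1r ler_wpM2r ?sqr_ge0//.
  have [kn|nk] := ltnP k n.+1.
    rewrite (minn_idPl kn) ?(minn_idPl (ltnW kn)) -natrB// subSn// subnn expr1n //.
  by rewrite ?(minn_idPr nk) (minn_idPr (leqW nk)) subrr expr0n.
- by move=> k w; rewrite iA; apply: iform_region; exact: grid_point_region.
move=> w; rewrite rformBm subr_ge0; apply: le_trans (hXt w) _.
have [/andP[z1 z2] /andP[z3 z4]] := grid_point_region n n.+1.
apply: le_trans (rform_W_ge alpha_gt0 S_herm S_ae_bounded t_gt0 S_bound z3 (hsol z3) (trace_region_le z1 z3) w).
rewrite ler_wpM2r ?fro_ge0// /grid_point /= minnn mulrCA mulfV ?mulr1 ?pnatr_eq0//.
have aux (a b : R) : 0 <= b -> t <= a + t + 1 + b - a by lra.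
by rewrite [x1 + _]addrC subrK; exact: aux (normr_ge0 x1).
Qed.

(** The case X = 0 of [grid]: the alternative of a large inverse contradicts the deterministic bound
    k0 on |W^-1|^2 once n is large. *)
Lemma rform_W_ge0 n : 4 * c ^+ 2 * k0 < n.+1%:R ->
  forall w, 0 <= rform (W (grid_point n 0)) w w.
Proof.
move=> hn.
have [||h|[k _ hk]] := @grid n 0.
- by rewrite /ct trmx0 map_mx0.
- by move=> u; rewrite rform0m mulr_ge0 ?fro_ge0// ltW.
- by move=> w; have := h w; rewrite subr0.
exfalso; move: hk; rewrite subr0; apply/negP; rewrite -ltNge.
have [/andP[z1 z2] /andP[z3 z4]] := grid_point_region n k.
have h1 := fro_invW alpha_gt0 S_herm S_ae_bounded z3 (hsol z3) (trace_region_le z1 z3).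
have N0 : 0 < n.+1%:R :> R by rewrite ltr0n.
apply: le_lt_trans (_ : 4 * (c / n.+1%:R) ^+ 2 * k0 < 1).
  by rewrite ler_wpM2l// mulr_ge0 ?sqr_ge0.
have -> : 4 * (c / n.+1%:R) ^+ 2 * k0 = 4 * c ^+ 2 * k0 / n.+1%:R ^+ 2.
  by rewrite exprMn exprVn; ring.
rewrite ltr_pdivrMr ?exprn_gt0// mul1r; apply: lt_le_trans hn _.
by rewrite expr2 ler_peMr ?ler1n// ltW.
Qed.

Definition edge_line eta : R[i] := (x1 +i* eta)%C.

Lemma edge_line_region eta : 0 < eta <= 1 -> region (edge_line eta).
Proof. by move=> h; split => //=; rewrite lexx ltW// X0_gt. Qed.

(** The height of the grid shrinks with n while eta stays fixed; this compares the two heights above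
    x1 at a cost independent of n. *)
Lemma W_vert eta n : 0 < eta <= 1 -> n.+1%:R^-1 <= eta ->
  op_le (W (grid_point n 0) - W (edge_line eta)) (eta * k3).
Proof.
move=> he hn; have [e0 e1] := andP he.
apply: lip_region => //; [exact: grid_point_region | exact: edge_line_region |].
rewrite /sqc ReD ImD ReN ImN /grid_point /= min0n mul0r addr0 subrr expr0n add0r.
have n0 : 0 <= n.+1%:R^-1 :> R by rewrite invr_ge0.
rewrite -[leLHS]real_normK ?num_real// ler_sqr ?nnegrE// ?(ltW e0)// ler_norml.
have aux (a : R) : 0 <= a -> a <= eta -> - eta <= a - eta <= eta.
  by move=> a0 ae; apply/andP; split; lra.
exact: aux.
Qed.

Lemma archi_lt (a : R) : exists n0 : nat, forall n, (n0 <= n)%N -> a < n.+1%:R.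
Proof.
exists (Num.truncn a) => n hn; apply: lt_le_trans (truncnS_gt a) _.
by rewrite ler_nat ltnS.
Qed.

Lemma W_zeta_ge eta : 0 < eta <= 1 ->
  forall w, - (eta * k3) * fro w <= rform (W (edge_line eta)) w w.
Proof.
move=> he w; have [e0 e1] := andP he.
have [n1 h1] := archi_lt (4 * c ^+ 2 * k0); have [n2 h2] := archi_lt eta^-1.
pose n := maxn n1 n2.
have {}h1 := h1 n (leq_maxl _ _); have {}h2 := h2 n (leq_maxr _ _).
have := rform_W_ge0 h1 w.
have /(op_le_rform w) : op_le (W (grid_point n 0) - W (edge_line eta)) (eta * k3).
  by apply: W_vert => //; rewrite invf_ple ?posrE// ltW.
rewrite rformBm.
by generalize (rform (W (grid_point n 0)) w w) (rform (W (edge_line eta)) w w) (eta * k3) (fro w) =>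
  a b e f; lra.
Qed.

(* A point y where this fails has, on every fine grid, a resolvent of size at least
   n / (2 c) by [grid]; by Markov's inequality such y have probability O(1/n). *)
Lemma W_zeta_S_ge eta : 0 < eta <= 1 -> {ae law, forall y, forall w,
  - (eta * k3) * fro w <= rform (W (edge_line eta) - S y) w w}.
Proof.
move=> he; have [e0 e1] := andP he.
have [n0 h0] := archi_lt eta^-1; pose N n := (n + n0)%N.
(* The sum over the grid dominates its largest term, so g n >= 1 wherever [grid] finds a large
   resolvent. Its mean is at most 4 (c / N)^2 times the number of points times k1, hence O(1 /
   N). *)
pose g n y := 4 * (c / (N n).+1%:R) ^+ 2 * \sum_(k < (N n).+2) fro (resolvent S (W (grid_point (N n) k)) y).
have mR n k : ae_bounded_mx law (resolvent S (W (grid_point n k))).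
  have [_ /andP[z3 _]] := grid_point_region n k.
  exact: (resolvent_ae_bounded S_herm S_ae_bounded (proj1 (hsol z3))).
have ms n : ae_bounded law (fun y => \sum_(k < (N n).+2) fro (resolvent S (W (grid_point (N n) k)) y)).
  by apply: ae_bounded_sum => k; apply: ae_bounded_mx_fro; exact: mR.
have s0 n y : 0 <= \sum_(k < (N n).+2) fro (resolvent S (W (grid_point (N n) k)) y).
  by apply: sumr_ge0 => k _; exact: fro_ge0.
have q0 n : 0 <= 4 * (c / (N n).+1%:R) ^+ 2 by rewrite mulr_ge0 ?sqr_ge0.
apply: (@ae_of_small_means _ _ _ _ _ g).
- by move=> n; exact: ae_boundedZ.
- by move=> n y; rewrite mulr_ge0.
- move=> n; move: S_bound; apply: filterS => y hy.
  have [||h|[k kN hk]] := @grid (N n) (S y).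
  + exact: S_herm.
  + by move=> u; apply: op_le_rform; apply: op_le_fro => //; exact: ltW.
  + left => w; have := h w.
    have /(op_le_rform w) : op_le (W (grid_point (N n) 0) - W (edge_line eta)) (eta * k3).
      apply: W_vert => //; rewrite invf_ple ?posrE// ltW// h0//.
      by rewrite /N leq_addl.
    rewrite !rformBm.
    generalize (rform (W (grid_point (N n) 0)) w w) (rform (W (edge_line eta)) w w) (rform (S y) w w).
    by generalize (eta * k3) (fro w) => e f a b s; lra.
  right; apply: le_trans hk _; rewrite /g; apply: ler_wpM2l => //.
  have kN' : (k < (N n).+2)%N by [].
  rewrite (bigD1 (Ordinal kN'))//= lerDl; apply: sumr_ge0 => j _; exact: fro_ge0.
move=> e e0'.
have [m hm] := archi_lt (8 * c ^+ 2 * k1 / e).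
exists m; rewrite /g ExZ// Ex_sum; last by move=> k; apply: ae_bounded_mx_fro; exact: mR.
apply: (@le_trans _ _ (4 * (c / (N m).+1%:R) ^+ 2 * \sum_(k < (N m).+2) k1)).
  apply: ler_wpM2l => //; apply: ler_sum => k _.
  have [/andP[z1 z2] /andP[z3 z4]] := grid_point_region (N m) k.
  exact: (Ex_fro_resolvent alpha_gt0 S_herm S_ae_bounded z3 (hsol z3) (trace_region_le z1 z3)).
rewrite sumr_const card_ord -[k1 *+ _]mulr_natl.
have := hm (N m) (leq_addr _ _); rewrite ltr_pdivrMr// => {}hm.
have NN : 0 < (N m).+1%:R :> R by rewrite ltr0n.
have N2 : (N m).+2%:R <= 2 * (N m).+1%:R :> R.
  by rewrite -natrM ler_nat mul2n -addnn addSn ltnS addnS ltnS leq_addr.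
apply: (@le_trans _ _ (4 * (c / (N m).+1%:R) ^+ 2 * (2 * (N m).+1%:R * k1))).
  by apply: ler_wpM2l => //; apply: ler_wpM2r N2; exact: k1_ge0.
have -> : 4 * (c / (N m).+1%:R) ^+ 2 * (2 * (N m).+1%:R * k1) =
    8 * c ^+ 2 * k1 / (N m).+1%:R.
  by move: NN; move: ((N m).+1%:R : R) => q q0'; field; rewrite gt_eqF.
by rewrite ler_pdivrMr// [leRHS]mulrC; exact: ltW.
Qed.

End RightOfSupport.

(** * The shifted real part of W and the perturbation of the resolvent *)

Section DualPoint.
Context {R : realType} {p : nat}.

(** For symmetric W the entrywise real part is the Hermitian part, so this real matrix keeps the
    quadratic form of W up to the shift. *)
Definition re_shift (W : 'M[R[i]]_p) (k : R) : 'M[R]_p :=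
  (\matrix_(i, j) complex.Re (W i j)) + k%:M.

Lemma re_shift_sym W k : W^T = W -> (re_shift W k)^T = re_shift W k.
Proof.
move=> hW; rewrite /re_shift linearD /= tr_scalar_mx; congr (_ + _).
by apply/matrixP => i j; rewrite !mxE -[in LHS]hW mxE.
Qed.

Lemma complex_re_shift W k : W^T = W ->
  complex_mx (re_shift W k) = (2^-1)%:C%C *: (W + ct W) + (k%:C%C)%:M.
Proof.
move=> hW; apply/matrixP => i j; rewrite [LHS]mxE /re_shift 2![in LHS]mxE.
rewrite [RHS]mxE [X in _ = X + _]mxE [in RHS]mxE ctE.
have -> : W j i = W i j by rewrite -[in LHS]hW mxE.
rewrite [in LHS]mxE [in RHS]mxE rmorphD /= rmorphMn; congr (_ + _).
by apply: complex_ext; rewrite ?ReM ?ImM ?ReD ?ImD conjcE /=; field.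
Qed.

Lemma rform_herm_part (W : 'M[R[i]]_p) u :
  rform ((2^-1)%:C%C *: (W + ct W)) u u = rform W u u.
Proof. by rewrite rformZm rformDm rform_ct; field. Qed.

Lemma rform_re_shift W k u : W^T = W ->
  rform (complex_mx (re_shift W k)) u u = rform W u u + k * fro u.
Proof.
by move=> hW; rewrite complex_re_shift// rformDm rform_herm_part rform_scalar.
Qed.

Lemma op_le_re_shift W k m : W^T = W -> 0 < k -> (forall u, 0 <= iform W u u) ->
  (forall u, iform W u u <= m * fro u) ->
  op_le (W - complex_mx (re_shift W k)) (m + k).
Proof.
move=> hW k0 h0 hm; rewrite complex_re_shift// opprD addrA; apply: op_leD; last first.
  apply: op_leN; apply: op_le_scalar => //; by rewrite sqc_real.
move=> a b; have -> : W - (2^-1)%:C%C *: (W + ct W) = (2^-1)%:C%C *: (W - ct W).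
  apply: rform_inj => u v; rewrite rformBm !rformZm rformBm rformDm.
  by generalize (rform W u v) (rform (ct W) u v) => x y; field.
rewrite rformZm rformBm rform_ct mulrA mulfV ?pnatr_eq0// mul1r.
apply: le_trans (rform_anti_le a b h0) _; rewrite mulrDr; exact: lerD.
Qed.

(* The bound is linear in |R|^2, not cubic: |R0| <= |R| + |R0||F||R| with |R0||F| <= 3. *)
Lemma resolvent_perturb (A A0 : 'M[R[i]]_p) e w : 0 < e ->
  A \in unitmx -> (forall u, e * fro u <= rform A0 u u) ->
  op_le (A - A0) (3 * e) ->
  rform (invmx A0 - invmx A) w w <= 12 * e * fro (invmx A) * fro w.
Proof.
move=> e0 uA hA0 hF; have e0' := ltW e0.
have hc u : e * fro u <= rform A0 u (1 *: u) by rewrite scale1r.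
have s1 : sqc (1 : R[i]) = 1 by rewrite sqc_real expr1n.
have uA0 := coercive_unit e0 hc.
have hR0 : op_le (invmx A0) e^-1.
  move=> a b; rewrite -rform1_mulr.
  have ei : 0 < e^-1 by rewrite invr_gt0.
  apply: le_trans (rform1_le _ _ ei) _; rewrite invrK mulrDr lerD2l.
  apply: le_trans (ler_wpM2l e0' (coercive_inv_vec s1 e0 hc b)) _.
  rewrite mulrA expr2 invfM mulrA mulfV ?gt_eqF// mul1r //.
pose m := Num.sqrt (fro (invmx A)).
have m0 : 0 <= m by exact: sqrtr_ge0.
have mE : m ^+ 2 = fro (invmx A) by rewrite sqr_sqrtr ?fro_ge0.
have hR : op_le (invmx A) m by apply: op_le_fro => //; rewrite mE.
have dE := invmxB uA0 uA.
have ei : 0 <= e^-1 by rewrite invr_ge0.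
have f0 : 0 <= 3 * e by rewrite mulr_ge0.
have hR4 : op_le (invmx A0) (4 * m).
  have -> : invmx A0 = invmx A + invmx A0 *m (A - A0) *m invmx A.
    by rewrite -dE addrCA subrr addr0.
  have -> : 4 * m = m + e^-1 * (3 * e) * m by field; rewrite gt_eqF.
  apply: op_leD => //; apply: op_leM => //; first by rewrite mulr_ge0.
  exact: op_leM.
rewrite dE; have m4 : 0 <= 4 * m by rewrite mulr_ge0.
have := op_le_rform w (op_leM (mulr_ge0 m4 f0) m0 (op_leM m4 f0 hR4 hF) hR).
move/le_trans; apply; rewrite -mE le_eqVlt; apply/orP; left; apply/eqP; ring.
Qed.

End DualPoint.

Section EdgePoint.
Context {R : realType} {d} {Y : measurableType d} {p : nat}.
Variables (law : probability Y R) (alpha : R) (alpha_gt0 : 0 < alpha).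
Variable S : Y -> 'M[R[i]]_p.
Hypotheses (S_herm : forall y, ct (S y) = S y) (S_ae_bounded : ae_bounded_mx law S).
Hypothesis S_sym : forall y, (S y)^T = S y.
Variables (t : R) (t_gt0 : 0 < t).
Hypothesis S_bound : {ae law, forall y, fro (S y) <= t ^+ 2}.
Variables (lam : R) (W : R[i] -> 'M[R[i]]_p).
Hypothesis hsol : forall z, 0 < complex.Im z -> is_sol law alpha S z (W z).
Hypothesis trace_le : forall z, lam < complex.Re z -> 0 < complex.Im z ->
  \sum_i iform (- invmx (W z)) (delta_mx i 0) (delta_mx i 0) <=
    p%:R * (complex.Im z / (complex.Re z - lam) ^+ 2).

(* The witness is Re W(x1 + i eta) + O(eta): the shift makes Re W - S uniformly positive. *)
Lemma edge_point x1 : lam < x1 -> exists2 C, 0 <= C & forall eta, 0 < eta <= 1 ->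
  exists w0 : 'M[R]_p, [/\ w0^T = w0,
    exists2 e, 0 < e & re_posdef law S (complex_mx w0) e,
    exists2 e, 0 < e & forall u, e * fro u <= rform (complex_mx w0) u u &
    forall u, rform (Phi law alpha S (complex_mx w0)) u u <= (x1 + C * eta) * fro u].
Proof.
move=> hx; pose dist := x1 - lam.
pose k1 := @resolvent_bound R p alpha dist; pose k2 := @shift_bound R p alpha t dist.
pose k3 := @im_bound R p alpha t dist (k2 + t + 1 + `|x1| + 1) + 1.
have k3_0 : 0 < k3 by exact: k3_gt0.
have k1_0 : 0 <= k1 by exact: resolvent_bound_ge0.
(* The first term is the shift of the witness; the second is [resolvent_perturb] at margin eta k3,
   averaged with |S u|^2 <= t^2 |u|^2 and E |R|^2 <= k1. *)
exists (2 * k3 + alpha * (12 * k3 * t ^+ 2 * k1)).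
  have k3' := ltW k3_0; have a' := ltW alpha_gt0; have t2 := sqr_ge0 t.
  apply: addr_ge0; first exact: mulr_ge0.
  by do 3![apply: mulr_ge0 => //]; exact: mulr_ge0.
move=> eta he; have [e0 e1] := andP he.
pose z := edge_line x1 eta; pose Wz := W z.
have hz : 0 < complex.Im z by [].
have hW := hsol hz; have [hi _] := hW.
have sW : Wz^T = Wz by exact: (sol_sym alpha_gt0 S_herm S_ae_bounded S_sym hz hW).
have e30 : 0 < eta * k3 by rewrite mulr_gt0.
have h1 := W_zeta_ge alpha_gt0 S_herm S_ae_bounded t_gt0 S_bound hsol trace_le hx he.
have h2 := W_zeta_S_ge alpha_gt0 S_herm S_ae_bounded t_gt0 S_bound hsol trace_le hx he.
(* Positivity holds up to a loss of eta k3, so a shift by twice that amount leaves the margin eta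
   k3. *)
pose w0 := re_shift Wz (2 * (eta * k3)); exists w0.
have hr : re_posdef law S (complex_mx w0) (eta * k3).
  move: h2; apply: filterS => y hy u; rewrite rformBm rform_re_shift//.
  have := hy u; rewrite rformBm -/k2 -/dist -/k3 -/z -/Wz.
  have aux (a s f : R) : - (eta * k3) * f <= a - s ->
    (eta * k3) * f <= a + 2 * (eta * k3) * f - s by lra.
  exact: aux.
split.
- exact: re_shift_sym.
- by exists (eta * k3).
- exists (eta * k3) => // u; rewrite rform_re_shift//.
  have aux (a f : R) : - (eta * k3) * f <= a ->
    (eta * k3) * f <= a + 2 * (eta * k3) * f by lra.
  exact: aux (h1 u).
move=> u.
have mQ0 := redef_self_energy_ae_bounded S_ae_bounded e30 hr; have mQ := self_energy_ae_bounded S_herm S_ae_bounded hi.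
rewrite /Phi rformDm rformZm (rform_E _ _ mQ0) rform_re_shift//.
rewrite (sol_rform S_herm S_ae_bounded _ _ hW) rform_scalar.
have mR := ae_bounded_mx_fro (resolvent_ae_bounded S_herm S_ae_bounded hi).
have hE : Ex law (fun y => rform (self_energy S (complex_mx w0) y) u u) -
    Ex law (fun y => rform (self_energy S Wz y) u u) <= 12 * (eta * k3) * t ^+ 2 * k1 * fro u.
  have q0 := ae_bounded_mx_rform u u mQ0; have q1 := ae_bounded_mx_rform u u mQ.
  rewrite -ExB//.
  apply: (@le_trans _ _ (Ex law (fun y => 12 * (eta * k3) * t ^+ 2 * fro u * fro (resolvent S Wz y)))).
    apply: le_Ex; [exact: ae_boundedB | exact: ae_boundedZ |].
    have := hr; move: S_bound; apply: filterS2 => y hy hA.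
    rewrite -rformBm /self_energy opprD addrACA subrr add0r [leLHS]rformBm !(SRSl S_herm) -[leLHS]rformBm.
    have uA := imdef_unit S_herm y hi.
    apply: le_trans (resolvent_perturb (S y *m u) e30 uA hA _) _.
      have -> : Wz - S y - (complex_mx w0 - S y) = Wz - complex_mx w0.
        by rewrite opprB addrA subrK.
      have -> : 3 * (eta * k3) = eta * k3 + 2 * (eta * k3) by ring.
      apply: op_le_re_shift => //; first by rewrite mulr_gt0.
        by move=> v; exact: imdef_ge0.
      move=> v; have := iform_region alpha_gt0 S_herm S_ae_bounded t_gt0 S_bound hsol trace_le hx v
        (edge_line_region alpha_gt0 t_gt0 _ _ he).
      by [].
    have hS : fro (S y *m u) <= t ^+ 2 * fro u.
      by apply: le_trans (fro_mulmx_le _ _) _; rewrite ler_wpM2r ?fro_ge0.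
    rewrite -/(resolvent S Wz y).
    have a0 : 0 <= 12 * (eta * k3) * fro (resolvent S Wz y).
      by rewrite !mulr_ge0 ?fro_ge0// ltW.
    apply: le_trans (ler_wpM2l a0 hS) _.
    by rewrite le_eqVlt; apply/orP; left; apply/eqP; ring.
  rewrite ExZ//.
  have hR : Ex law (fun y => fro (resolvent S Wz y)) <= k1.
    apply: (Ex_fro_resolvent alpha_gt0 S_herm S_ae_bounded hz hW).
    by apply: (trace_region_le trace_le hx) => /=.
  have a0 : 0 <= 12 * (eta * k3) * t ^+ 2 * fro u.
    by rewrite !mulr_ge0 ?sqr_ge0 ?fro_ge0// ltW.
  apply: le_trans (ler_wpM2l a0 hR) _.
  by rewrite le_eqVlt; apply/orP; left; apply/eqP; ring.
have {}hE := ler_wpM2l (ltW alpha_gt0) hE.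
have aux (E0 E1 f B : R) : alpha * (E0 - E1) <= alpha * (12 * (eta * k3) * t ^+ 2 * k1 * f) ->
  x1 * f - alpha * E1 + 2 * (eta * k3) * f + alpha * E0 <=
  (x1 + (2 * k3 + alpha * (12 * k3 * t ^+ 2 * k1)) * eta) * f.
  move=> h; rewrite -subr_ge0.
  have : 0 <= alpha * (12 * (eta * k3) * t ^+ 2 * k1 * f) - alpha * (E0 - E1).
    by rewrite subr_ge0.
  by congr (0 <= _); ring.
exact: aux hE.
Qed.

End EdgePoint.

(** * Extreme eigenvalues of real symmetric matrices and quadratic forms *)

Section RealSpectrum.
Context {R : realType} {p : nat} (hp : (0 < p)%N).
Implicit Types A : 'M[R]_p.

Lemma symmetricmxP A : A \is symmetricmx <-> A^T = A.
Proof.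
have idE (B : 'M[R]_p) : map_mx idfun B = B by apply/matrixP => i j; rewrite mxE.
split=> [/is_hermitianmxP|h].
  by rewrite expr0 scale1r idE.
by apply/is_hermitianmxP; rewrite expr0 scale1r idE.
Qed.

Lemma complex_mxM A B : complex_mx (A *m B) = complex_mx A *m complex_mx B.
Proof. exact: map_mxM. Qed.

Lemma complex_mxD A B : complex_mx (A + B) = complex_mx A + complex_mx B.
Proof. exact: map_mxD. Qed.

Lemma complex_mxB A B : complex_mx (A - B) = complex_mx A - complex_mx B.
Proof. exact: map_mxB. Qed.

Lemma complex_mxZ (a : R) A : complex_mx (a *: A) = a%:C%C *: complex_mx A.
Proof. exact: map_mxZ. Qed.

Lemma complex_mx1 : complex_mx (1%:M : 'M[R]_p) = 1%:M.
Proof. exact: map_mx1. Qed.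

Lemma complex_mxV A : complex_mx (invmx A) = invmx (complex_mx A).
Proof. exact: map_invmx. Qed.

Lemma complex_mx_unit A : (complex_mx A \in unitmx) = (A \in unitmx).
Proof. exact: map_unitmx. Qed.

Lemma spectral_form A : A^T = A -> exists dP : ('I_p -> R) * 'M[R[i]]_p,
  [/\ forall i, eigenvalue A (dP.1 i), forall u : 'cV[R[i]]_p, fro (dP.2 *m u) = fro u &
      forall u, rform (complex_mx A) u u = \sum_i dP.1 i * sqc ((dP.2 *m u) i 0)].
Proof.
move=> sA; have hA := complex_mx_sym sA; set Ac := complex_mx A in hA *.
have nA : Ac \is hermsymmx by apply/is_hermitianmxP; rewrite expr0 scale1r -[LHS]hA.
have /orthomx_spectralP := hermitian_normalmx nA.
have dreal := hermitian_spectral_diag_real nA.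
set P := spectralmx Ac; set dg := spectral_diag Ac => AE.
have uP : P \in unitmx by exact: spectral_unit.
have invP : invmx P = ct P by apply: invmx_unitary; exact: spectral_unitarymx.
have PP : ct P *m P = 1%:M by rewrite -invP mulVmx.
have dR i : dg 0 i = (complex.Re (dg 0 i))%:C%C.
  by rewrite RRe_real//; exact: (mxOverP dreal).
exists (fun i => complex.Re (dg 0 i), P); split => /=.
(* Being a root of the characteristic polynomial can be tested in R[i], where a row of the unitary P
   is an eigenvector. *)
- move=> i; rewrite eigenvalue_root_char -(fmorph_root (real_complex R)) map_char_poly.
  rewrite -eigenvalue_root_char; apply/eigenvalueP; exists (row i P).
    have PA : P *m Ac = diag_mx dg *m P by rewrite [in LHS]AE !mulmxA (mulmxV uP) mul1mx.
    rewrite -/(complex_mx A) -/Ac -row_mul PA row_mul.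
    have -> : row i (diag_mx dg) = dg 0 i *: delta_mx 0 i.
      apply/rowP => j; rewrite !mxE eqxx /= [j == i]eq_sym.
      by case: (i == j); rewrite ?mulr1n ?mulr1 ?mulr0n ?mulr0.
    by rewrite -scalemxAl -rowE [in LHS]dR.
  apply/eqP => r0; have : row i P *m invmx P = 0 by rewrite r0 mul0mx.
  rewrite -row_mul mulmxV// row1 => /matrixP/(_ 0 i); rewrite !mxE !eqxx /= => /eqP.
  by rewrite oner_eq0.
- by move=> u; rewrite -!rform1 -rform_mul mulmx1 PP.
move=> u; rewrite AE invP rform_mul; set w := P *m u.
rewrite /rform mxE Re_sum; apply: eq_bigr => i _.
have -> : (ct w *m diag_mx dg) 0 i = Num.conj (w i 0) * dg 0 i.
  by rewrite mul_mx_diag mxE ctE.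
by rewrite mulrAC mul_conj_sqc dR ReM /= mulr0 subr0 mulrC.
Qed.

Lemma eigen_form A a : eigenvalue A a -> exists2 u : 'cV[R[i]]_p, 0 < fro u &
  rform (complex_mx A) u u = a * fro u.
Proof.
move=> /eigenvalueP[v vA v0]; pose vc : 'rV[R[i]]_p := map_mx (real_complex R) v.
exists (ct vc).
  rewrite lt_def fro_ge0 andbT; apply: contra v0 => /eqP/fro_eq0 h.
  apply/eqP/rowP => i; have /matrixP/(_ i 0) := h; rewrite ctE !mxE conj_real.
  by case.
have vA' : vc *m complex_mx A = a%:C%C *: vc by rewrite -map_mxM vA map_mxZ.
rewrite /rform ctK vA' -scalemxAl mxE -{1}[vc]ctK ct_mulmx11 ReM /= mul0r subr0 //.
Qed.

Let E A : set R := [set a | eigenvalue A a].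

(** For p = 0 the spectrum would be empty, and [sup] and [inf] would take their default value 0. *)
Lemma eigen_nonempty A : A^T = A -> E A !=set0.
Proof.
move=> /spectral_form[[dg P] /= [h _ _]].
by exists (dg (Ordinal hp)); exact: h.
Qed.

Lemma eigen_le A a : eigenvalue A a -> a <= 2^-1 * (1 + fro (complex_mx A)).
Proof.
move=> /eigen_form[u u0 h]; rewrite -(ler_pM2r u0) -h.
by apply: op_le_rform; exact: op_le_sqrt.
Qed.

Lemma eigen_ge A a : eigenvalue A a -> - (2^-1 * (1 + fro (complex_mx A))) <= a.
Proof.
move=> /eigen_form[u u0 h]; rewrite -(ler_pM2r u0) -h mulNr lerNl -rformNm.
by apply: op_le_rform; apply: op_leN; exact: op_le_sqrt.
Qed.

Lemma lambda_min_form A u : A^T = A -> lambda_min A * fro u <= rform (complex_mx A) u u.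
Proof.
move=> sA; have [[dg P] /= [h1 h2 ->]] := spectral_form sA.
rewrite -h2 /fro mulr_sumr; apply: ler_sum => i _; rewrite big_ord1.
apply: ler_wpM2r; first exact: sqc_ge0.
apply: ge_inf; last exact: h1.
by exists (- (2^-1 * (1 + fro (complex_mx A)))) => a /eigen_ge.
Qed.

Lemma lambda_max_form A u : A^T = A -> rform (complex_mx A) u u <= lambda_max A * fro u.
Proof.
move=> sA; have [[dg P] /= [h1 h2 ->]] := spectral_form sA.
rewrite -h2 /fro mulr_sumr; apply: ler_sum => i _; rewrite big_ord1.
apply: ler_wpM2r; first exact: sqc_ge0.
apply: ub_le_sup; last exact: h1.
by exists (2^-1 * (1 + fro (complex_mx A))) => a /eigen_le.
Qed.

Lemma le_lambda_min A c : A^T = A ->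
  (forall u, c * fro u <= rform (complex_mx A) u u) -> c <= lambda_min A.
Proof.
move=> sA h; apply: lb_le_inf; first exact: eigen_nonempty.
by move=> a /eigen_form[u u0 ha]; rewrite -(ler_pM2r u0) -ha.
Qed.

Lemma lambda_max_le A c : A^T = A ->
  (forall u, rform (complex_mx A) u u <= c * fro u) -> lambda_max A <= c.
Proof.
move=> sA h; apply: ge_sup; first exact: eigen_nonempty.
by move=> a /eigen_form[u u0 ha]; rewrite -(ler_pM2r u0) -ha.
Qed.

Lemma real_formE A (v : 'rV[R]_p) :
  (v *m A *m v^T) 0 0 = rform (complex_mx A) (ct (map_mx (real_complex R) v))
                                             (ct (map_mx (real_complex R) v)).
Proof.
rewrite /rform ctK; have -> : ct (map_mx (real_complex R) v) = map_mx (real_complex R) v^T.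
  by apply/matrixP => i j; rewrite ctE !mxE conj_real.
by rewrite /complex_mx -!map_mxM [in RHS]mxE.
Qed.

Lemma posdef_form A : posdef A ->
  exists2 c, 0 < c & forall u, c * fro u <= rform (complex_mx A) u u.
Proof.
move=> [/symmetricmxP sA pA].
have [[dg P] /= [h1 h2 h3]] := spectral_form sA.
have dpos i : 0 < dg i.
  have /eigenvalueP[v vA v0] := h1 i; have := pA v v0.
  rewrite vA -scalemxAl mxE => h; apply: contraLR h; rewrite -!leNgt => d0.
  rewrite mulr_le0_ge0// mxE; apply: sumr_ge0 => j _.
  by rewrite mxE -expr2 sqr_ge0.
(* A positive lower bound for all eigenvalues that avoids taking a minimum over an index set that
   may be empty. *)
pose c := (1 + \sum_i (dg i)^-1)^-1.
have s0 : 0 < 1 + \sum_i (dg i)^-1.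
  by rewrite ltr_pwDl// sumr_ge0// => i _; rewrite invr_ge0 ltW.
exists c; first by rewrite invr_gt0.
move=> u; rewrite h3 -h2 /fro mulr_sumr; apply: ler_sum => i _; rewrite big_ord1.
apply: ler_wpM2r; first exact: sqc_ge0.
rewrite -[leRHS]invrK lef_pV2 ?posrE ?invr_gt0// (bigD1 i)//= addrCA lerDl.
by rewrite addr_ge0// sumr_ge0// => j _; rewrite invr_ge0 ltW.
Qed.

Lemma form_posdef A c : A^T = A -> 0 < c ->
  (forall u, c * fro u <= rform (complex_mx A) u u) -> posdef A.
Proof.
move=> sA c0 h; split; first exact/symmetricmxP.
move=> v v0; rewrite real_formE; apply: lt_le_trans (h _); rewrite mulr_gt0//.
rewrite lt_def fro_ge0 andbT; apply: contra v0 => /eqP/fro_eq0 hv.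
by apply/eqP/rowP => i; have /matrixP/(_ i 0) := hv; rewrite ctE !mxE conj_real => -[].
Qed.

Lemma form_unit A c : 0 < c ->
  (forall u, c * fro u <= rform (complex_mx A) u u) -> A \in unitmx.
Proof.
move=> c0 h; rewrite -complex_mx_unit; apply: (coercive_unit (k := 1) (c := c)) => // u.
by rewrite scale1r.
Qed.

Lemma posdefV A : posdef A -> posdef (invmx A).
Proof.
move=> pA; have [c c0 hc] := posdef_form pA; have uA := form_unit c0 hc.
case: pA => /symmetricmxP sA pA; split.
  by apply/symmetricmxP; rewrite trmx_inv sA.
move=> v v0; have -> : v *m invmx A *m v^T = (v *m invmx A) *m A *m (v *m invmx A)^T.
  by rewrite mulmxKV// trmx_mul trmx_inv sA mulmxA.
apply: pA; apply: contra v0 => /eqP h.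
by rewrite -[v](mulmxKV uA) h mul0mx.
Qed.

End RealSpectrum.

(** * The dual domain and G in terms of W = Z^-1 and [Phi] *)

Section Translation.
Context {R : realType} {d} {Y : measurableType d} {p : nat} (hp : (0 < p)%N).
Variables (law : probability Y R) (alpha : R) (alpha_gt0 : 0 < alpha).
Variable T : Y -> 'M[R]_p.
Hypothesis T_sym : forall y, (T y)^T = T y.
Let S y := complex_mx (alpha^-1 *: T y).
Hypothesis S_ae_bounded : ae_bounded_mx law S.

Let S_herm y : ct (S y) = S y.
Proof. exact: scaled_mx_herm. Qed.

Let S_sym y : (S y)^T = S y.
Proof. by rewrite /S /complex_mx map_trmx linearZ /= T_sym. Qed.

Lemma E_mx_complex (F : Y -> 'M[R]_p) :
  complex_mx (E_mx law F) = E_Cmx law (fun y => complex_mx (F y)).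
Proof.
apply/matrixP => i j; rewrite !mxE /Cexpectation.
have -> : (fun y => complex.Im (complex_mx (F y) i j)) = (fun=> 0).
  by apply/funext => y; rewrite mxE.
rewrite Rintegral_cst// mul0r; congr (_ +i* _)%C; congr Rintegral.
by apply/funext => y; rewrite mxE.
Qed.

(** From 1 - Z T / alpha = Z (W0 - S) the integrand is alpha (S + S R S). The factor W0 - S is known
    to be invertible only almost surely, so the integrands are identified almost everywhere. *)
Lemma mx_G_Phi (Z : 'M[R]_p) e : Z \in unitmx -> 0 < e ->
  re_posdef law S (complex_mx (invmx Z)) e ->
  complex_mx (mx_G alpha law T Z) = Phi law alpha S (complex_mx (invmx Z)).
Proof.
move=> uZ e0 hr; set W0 := complex_mx (invmx Z) in hr *.
rewrite /mx_G complex_mxD /Phi; congr (_ + _).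
have mQ : ae_bounded_mx law (self_energy S W0) := redef_self_energy_ae_bounded S_ae_bounded e0 hr.
rewrite E_mx_complex -E_CmxZ//.
have TS y : complex_mx (T y) = alpha%:C%C *: S y.
  by rewrite /S -complex_mxZ scalerA mulfV ?gt_eqF// scale1r.
have uZc : complex_mx Z \in unitmx by rewrite complex_mx_unit.
have ZW : complex_mx Z *m W0 = 1%:M by rewrite -complex_mxM mulmxV// complex_mx1.
have FE y : complex_mx (T y *m invmx (1%:M - alpha^-1 *: (Z *m T y))) =
    complex_mx (T y) *m invmx (complex_mx Z *m (W0 - S y)).
  rewrite complex_mxM complex_mxV; congr (_ *m invmx _).
  by rewrite complex_mxB complex_mx1 mulmxBr ZW scalemxAr complex_mxM.
have mT : mx_measurable (fun y => complex_mx (T y)).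
  have [h _] := ae_bounded_mxZ alpha%:C%C S_ae_bounded.
  by move=> i j; under eq_fun do rewrite TS; exact: h.
apply: ae_eq_E_Cmx.
- have h : mx_measurable (fun y => complex_mx (T y) *m invmx (complex_mx Z *m (W0 - S y))).
    apply: mx_measurableM => //; apply: mx_measurable_invmx; apply: mx_measurableM; first by case: (ae_bounded_mx_cst law (complex_mx Z)).
    by case: (ae_bounded_mx_A S_ae_bounded W0).
  by move=> i j; under eq_fun do rewrite FE; exact: h.
- by case: (ae_bounded_mxZ alpha%:C%C mQ).
apply: filterS hr => y hy; rewrite FE.
have uA := coercive_real_unit e0 hy.
have -> : invmx (complex_mx Z *m (W0 - S y)) = resolvent S W0 y *m W0.
  have u2 : complex_mx Z *m (W0 - S y) \in unitmx by rewrite unitmx_mul uZc.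
  rewrite -[LHS]mulmx1 -[RHS](mulKmx u2); congr (_ *m _).
  by rewrite -mulmxA /resolvent mulKVmx.
rewrite TS -scalemxAl; congr (_ *: _); rewrite /self_energy.
rewrite -{2}[W0](subrK (S y)) mulmxDr /resolvent mulVmx// mulmxDr mulmx1.
by rewrite mulmxA.
Qed.

Lemma mx_G_sym (Z : 'M[R]_p) e : Z^T = Z -> Z \in unitmx -> 0 < e ->
  re_posdef law S (complex_mx (invmx Z)) e ->
  (mx_G alpha law T Z)^T = mx_G alpha law T Z.
Proof.
move=> sZ uZ e0 hr; apply: (map_mx_inj (f := real_complex R)) => //.
rewrite -map_trmx -!/(complex_mx _) (mx_G_Phi uZ e0 hr) /Phi.
rewrite linearD /= linearZ /= (E_Cmx_self_energy_tr law S_sym).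
have -> : (complex_mx (invmx Z))^T = complex_mx (invmx Z); last by [].
by rewrite /complex_mx map_trmx trmx_inv sZ.
Qed.

Lemma mx_domain_forms (Z : 'M[R]_p) : mx_domain alpha law T Z ->
  [/\ Z^T = Z, Z \in unitmx,
     exists2 c, 0 < c & forall u, c * fro u <= rform (complex_mx (invmx Z)) u u &
     exists2 e, 0 < e & re_posdef law S (complex_mx (invmx Z)) e].
Proof.
move=> [pZ he]; have [c c0 hc] := posdef_form pZ.
have [/symmetricmxP sZ _] := pZ; split => //.
- exact: form_unit c0 hc.
- exact: posdef_form (posdefV pZ).
have hae := ess_inf_le law (fun y => (lambda_min (invmx Z - alpha^-1 *: T y))%:E).
move: he hae; set s := ess_inf _ _ => s0 hae.
(* The essential infimum is an extended real; if it is +oo, the margin 1 will do. *)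
have [e e0 es] : exists2 e : R, 0 < e & (e%:E <= s)%E.
  move: s0; case: s {hae} => [r| |] //.
    by rewrite lte_fin => r0; exists r.
  by move=> _; exists 1; rewrite ?leey.
exists e => //; apply: filterS hae => y hy u.
have {}hy : e <= lambda_min (invmx Z - alpha^-1 *: T y) by rewrite -lee_fin (le_trans es).
rewrite /S -complex_mxB; apply: le_trans (lambda_min_form _ _).
  by rewrite ler_wpM2r ?fro_ge0.
by rewrite linearB /= trmx_inv sZ linearZ /= T_sym.
Qed.

Lemma forms_mx_domain (w0 : 'M[R]_p) c e : w0^T = w0 -> 0 < c -> 0 < e ->
  (forall u, c * fro u <= rform (complex_mx w0) u u) ->
  re_posdef law S (complex_mx w0) e -> mx_domain alpha law T (invmx w0).
Proof.
move=> sw c0 e0 hc hr; split.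
  exact: posdefV (form_posdef sw c0 hc).
apply: (@lt_le_trans _ _ e%:E); first by rewrite lte_fin.
apply/ess_infP; apply: filterS hr => y hy.
rewrite invmxK lee_fin; apply: (le_lambda_min hp).
  by rewrite linearB /= sw linearZ /= T_sym.
by move=> u; rewrite complex_mxB; exact: hy.
Qed.

End Translation.

(** * The two inequalities and the formula for the edge *)

Section EdgeFormula.
Context {R : realType} {d} {Y : measurableType d} {p : nat} (hp : (0 < p)%N).
Variables (law : probability Y R) (alpha : R) (alpha_gt0 : 0 < alpha).
Variable T : Y -> 'M[R]_p.
Hypothesis T_sym : forall y, (T y)^T = T y.
Hypothesis T_measurable : forall i j, measurable_fun [set: Y] (fun y => T y i j).
Variables (CT : R) (CT_gt0 : 0 < CT).
Hypothesis T_bounded : {ae law, forall y, op_norm (T y) <= CT}.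
Variable M : R[i] -> 'M[R[i]]_p.
Hypothesis hM : is_M_alpha alpha law T M.
Variable mu : probability (measurableTypeR R) R.
Hypothesis hmu : is_mu_alpha mu M.

Let S y := complex_mx (alpha^-1 *: T y).

Let S_ae_bounded : ae_bounded_mx law S.
Proof. exact: complex_mx_ae_bounded (ltW CT_gt0) T_measurable T_bounded. Qed.

Let S_hermitian y : ct (S y) = S y.
Proof. exact: scaled_mx_herm. Qed.

Let S_sym y : (S y)^T = S y.
Proof. by rewrite /S /complex_mx map_trmx linearZ /= T_sym. Qed.

Let W z := - invmx (M z).

Let W_sol z : 0 < complex.Im z -> is_sol law alpha S z (W z).
Proof. exact: (M_is_sol alpha_gt0 T_sym S_ae_bounded hM). Qed.

Let NinvW z : 0 < complex.Im z -> - invmx (W z) = M z.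
Proof.
move=> z0; have [_ _ _ /(_ z z0)[uM _]] := hM.
have uN : (-1 : R[i]) \is a GRing.unit by rewrite unitrN unitr1.
have uV : invmx (M z) \in unitmx by rewrite unitmx_inv.
rewrite /W -[- invmx (M z)]scaleN1r invmxZ; last by rewrite unitmxZ.
by rewrite invmxK invrN invr1 scaleN1r opprK.
Qed.

Let p_gt0 : 0 < p%:R :> R. Proof. by rewrite ltr0n. Qed.

Lemma sum_iform_M z : 0 < complex.Im z ->
  \sum_i iform (- invmx (W z)) (delta_mx i 0) (delta_mx i 0) =
    p%:R * Ex mu (poisson (complex.Re z) (complex.Im z)).
Proof. by move=> z0; rewrite (NinvW z0) -Im_trace (Im_trace_mu hp hmu). Qed.

Lemma upper_edge_le_lambda_max Z : mx_domain alpha law T Z ->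
  (upper_edge mu <= (lambda_max (mx_G alpha law T Z))%:E)%E.
Proof.
move=> /(mx_domain_forms T_sym)[sZ uZ [c c0 hc] [e e0 hr]].
set x0 := lambda_max _.
have hPhi u : rform (Phi law alpha S (complex_mx (invmx Z))) u u <= x0 * fro u.
  rewrite -(mx_G_Phi alpha_gt0 S_ae_bounded uZ e0 hr); apply: lambda_max_form => //.
  exact: (mx_G_sym alpha_gt0 T_sym S_ae_bounded sZ uZ e0 hr).
(* For x >= x1 > x0 the gap [dl = x1 - x0] is admissible because Phi <= x0 <= x - dl; K is then the
   bound of [sol_inv_iform_le], averaged over the p basis vectors. *)
apply: (upper_edge_le (K := fun x => ((x - x0) * c)^-1)) => [x hx|x1 x eta hx1 hx eta0].
  by rewrite invr_ge0 mulr_ge0 ?subr_ge0 ?(ltW hx) ?(ltW c0).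
have dl0 : 0 < x1 - x0 by rewrite subr_gt0.
pose z : R[i] := (x +i* eta)%C; have hz : 0 < complex.Im z by [].
have hs := W_sol hz.
rewrite -(ler_pM2l p_gt0) -[Ex _ _]/(Ex mu (poisson (complex.Re z) (complex.Im z))).
rewrite -sum_iform_M//; apply: le_trans (_ : \sum_(i < p) eta / ((x1 - x0) * c) <= _).
  apply: ler_sum => i _.
  have sW : ct (complex_mx (invmx Z)) = complex_mx (invmx Z).
    by apply: complex_mx_sym; rewrite trmx_inv sZ.
  apply: le_trans (sol_inv_iform_le alpha_gt0 S_hermitian S_ae_bounded (delta_mx i 0) hz hs sW e0 hr
    dl0 c0 hc _) _.
    move=> u; apply: le_trans (hPhi u) _; apply: ler_wpM2r; first exact: fro_ge0.
    by rewrite /= opprB addrCA lerDl subr_ge0.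
  by rewrite fro_delta mulr1.
by rewrite sumr_const card_ord -[leLHS]mulr_natl [_^-1 * eta]mulrC.
Qed.

(** A real [lam] above the edge is used because the edge is an extended real. Half of the gap
    between lam and x keeps x1 away from the support, and the other half absorbs the error C eta. *)
Lemma inf_le_right lam x : (upper_edge mu <= lam%:E)%E -> lam < x ->
  (ereal_inf [set (lambda_max (mx_G alpha law T Z))%:E | Z in mx_domain alpha law T]
     <= x%:E)%E.
Proof.
move=> hlam lx; pose x1 := (lam + x) / 2.
have lx1 : lam < x1 by rewrite /x1; lra.
have x1x : x1 < x by rewrite /x1; lra.
pose t := alpha^-1 * (p%:R * CT).
have t0 : 0 < t by rewrite !mulr_gt0 ?invr_gt0.
have S_bound : {ae law, forall y, fro (S y) <= t ^+ 2}.
  move: T_bounded; apply: filterS => y hy.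
  rewrite /S complex_mxZ froZ sqc_real /t exprMn; apply: ler_wpM2l; first exact: sqr_ge0.
  apply: le_trans (op_norm_fro (ltW CT_gt0) hy) _.
  by rewrite exprMn expr2 mulrA.
have trace_le z : lam < complex.Re z -> 0 < complex.Im z ->
    \sum_i iform (- invmx (W z)) (delta_mx i 0) (delta_mx i 0) <=
      p%:R * (complex.Im z / (complex.Re z - lam) ^+ 2).
  move=> z1 z2; rewrite sum_iform_M// ler_pM2l//.
  exact: Ex_poisson_le (mu_above_edge hlam) z1 z2.
have [C C0 hC] := edge_point alpha_gt0 S_hermitian S_ae_bounded S_sym t0 S_bound W_sol trace_le lx1.
have C1 : 0 < 1 + C by rewrite ltr_pwDl.
(* Chosen so that x1 + C eta <= x; dividing by 1 + C rather than C covers C = 0. *)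
pose eta := Num.min 1 ((x - x1) / (1 + C)).
have eta0 : 0 < eta by rewrite lt_min ltr01 divr_gt0// subr_gt0.
have [|w0 [sw [e e0 hr] [c c0 hc] hPhi]] := hC eta.
  by rewrite eta0 ge_min lexx.
have uw := form_unit c0 hc.
apply: (@le_trans _ _ (lambda_max (mx_G alpha law T (invmx w0)))%:E).
  apply: ereal_inf_lbound; exists (invmx w0) => //.
  exact: (forms_mx_domain hp T_sym sw c0 e0 hc hr).
have uZ : invmx w0 \in unitmx by rewrite unitmx_inv.
have sZ : (invmx w0)^T = invmx w0 by rewrite trmx_inv sw.
have hr' : re_posdef law S (complex_mx (invmx (invmx w0))) e by rewrite invmxK.
rewrite lee_fin; apply: (lambda_max_le hp).
  exact: (mx_G_sym alpha_gt0 T_sym S_ae_bounded sZ uZ e0 hr').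
move=> u; rewrite (mx_G_Phi alpha_gt0 S_ae_bounded uZ e0 hr') invmxK.
apply: le_trans (hPhi u) _; apply: ler_wpM2r; first exact: fro_ge0.
rewrite -lerBrDl; apply: (@le_trans _ _ ((1 + C) * eta)).
  by rewrite ler_wpM2r ?lerDr// ltW.
by rewrite mulrC -ler_pdivlMr// ge_min lexx orbT.
Qed.

Lemma upper_edgeE : upper_edge mu =
  ereal_inf [set (lambda_max (mx_G alpha law T Z))%:E | Z in mx_domain alpha law T].
Proof.
apply/eqP; rewrite eq_le; apply/andP; split.
  by apply: le_ereal_inf_tmp => _ [Z hZ <-]; exact: upper_edge_le_lambda_max.
(* A finite edge is approached from the right, +oo is trivial, and for an edge -oo every real lam is
   admissible, so x - 1 serves for each x. *)
move: inf_le_right; case: (upper_edge mu) => [u| |] h.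
- by apply/lee_addgt0Pr => e e0; apply: (h u) => //; rewrite ltrDl.
- exact: leey.
suff -> : ereal_inf [set (lambda_max (mx_G alpha law T Z))%:E
   | Z in mx_domain alpha law T] = -oo%E by [].
by apply: eq_ninfty => x; apply: (h (x - 1)); rewrite ?leNye// ltrBlDr ltrDl.
Qed.

End EdgeFormula.

Theorem propositionB1 (R : realType) (p q r : nat) (hp : (0 < p)%N)
    (Pstar : R.-pker (Rvec R r) ~> (Rvec R q))
    (alpha : R) (alpha_gt0 : 0 < alpha)
    (T : Rvec R q -> 'M[R]_p)
    (T_sym : forall y, T y \is symmetricmx)
    (T_measurable : forall i j,
       measurable_fun [set: Rvec R q] (fun y => T y i j : measurableTypeR R))
    (T_neq0 : (0 < law_y Pstar [set y | T y != 0%R])%E)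
    (CT : R) (CT_gt0 : 0 < CT)
    (T_bounded : {ae law_y Pstar, forall y, op_norm (T y) <= CT})
    (M : R[i] -> 'M[R[i]]_p)
    (hM : is_M_alpha alpha (law_y Pstar) T M)
    (mu : probability (measurableTypeR R) R)
    (hmu : is_mu_alpha mu M) :
  upper_edge mu =
  ereal_inf [set (lambda_max (mx_G alpha (law_y Pstar) T Z))%:E
              | Z in mx_domain alpha (law_y Pstar) T].
Proof.
by apply: (upper_edgeE hp alpha_gt0 (fun y => (symmetricmxP (T y)).1 (T_sym y))
  T_measurable CT_gt0 T_bounded hM hmu).
Qed.
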